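(* Let $N\ge2$, let $H$ be a Finsler norm on $\mathbb{R}^N$, let $p\ge2$ and let $u$ be a weak stable solution of $$-\operatorname{div}\big(H(\nabla u)^{p-1}\nabla H(\nabla u)\big)=|u|^{q-1}u\quad\text{in }\mathbb{R}^N.$$ Assume that $$\begin{cases}p-1<q<\infty & \text{if } N\le\dfrac{p(p+3)}{p-1},\\[2mm] p-1<q<q_c(N,p) & \text{if } N>\dfrac{p(p+3)}{p-1},\end{cases}$$ where $$q_c(N,p)=\frac{\big((p-1)N-p\big)^2+p^2(p-2)-p^2(p-1)N+2p^2\sqrt{(p-1)(N-1)}}{(N-p)\big((p-1)N-p(p+3)\big)}.$$ Then $u\equiv0$.
   Context: Finsler norm: a function $H:\mathbb{R}^N\to[0,\infty)$ which is a norm on $\mathbb{R}^N$, is of class $C^2(\mathbb{R}^N\setminus\{0\})$, and whose unit ball $\{\xi\in\mathbb{R}^N: H(\xi)<1\}$ is uniformly convex, i.e. all the principal curvatures of its boundary are bounded away from zero (equivalently, there is $\Lambda>0$ with $\langle D^2H(\xi)v,v\rangle\ge\Lambda|v|^2$ for all $\xi$ with $H(\xi)=1$ and all $v\perp\nabla H(\xi)$). Weak solution: a function $u\in W^{1,p}_{loc}(\mathbb{R}^N)\cap L^\infty_{loc}(\mathbb{R}^N)$ (real-valued, possibly sign-changing and globally unbounded) with $$\int_{\mathbb{R}^N}H(\nabla u)^{p-1}\langle\nabla H(\nabla u),\nabla\varphi\rangle\,dx=\int_{\mathbb{R}^N}|u|^{q-1}u\,\varphi\,dx\quad\forall\varphi\in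 C^1_c(\mathbb{R}^N).$$ Such solutions are known to be of class $C^{1,\alpha}_{loc}(\mathbb{R}^N)$ for some $\alpha\in(0,1)$. Stability: $u$ is stable if $L_u(\varphi,\varphi)\ge0$ for all $\varphi\in C^1_c(\mathbb{R}^N)$, where $$L_u(\varphi,\varphi)=\int_{\mathbb{R}^N}(p-1)H(\nabla u)^{p-2}\langle\nabla H(\nabla u),\nabla\varphi\rangle^2\,dx+\int_{\mathbb{R}^N}H(\nabla u)^{p-1}\langle D^2H(\nabla u)\nabla\varphi,\nabla\varphi\rangle\,dx-\int_{\mathbb{R}^N}q|u|^{q-1}\varphi^2\,dx,$$ with the integrands of the first two integrals understood as $0$ at points where $\nabla u=0$. *)

(* Defs.v *)
From HB Require Import structures.
From mathcomp Require Import all_boot all_order all_algebra.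
From mathcomp Require Import all_classical all_reals all_analysis.

Set Implicit Arguments.
Unset Strict Implicit.
Unset Printing Implicit Defensive.
Import Order.TTheory GRing.Theory Num.Theory.
Import numFieldNormedType.Exports.

Local Open Scope classical_set_scope.
Local Open Scope ring_scope.

Section measurable_rV.
Context (R : realType) (n : nat).

Let coord : 'I_n -> 'rV[R]_n -> R := fun i x => x 0 i.

Let rV_set0 : g_sigma_preimage coord set0.
Proof. exact: sigma_algebra0. Qed.

Let rV_setC A : g_sigma_preimage coord A -> g_sigma_preimage coord (~` A).
Proof. exact: sigma_algebraC. Qed.

Let rV_bigcup (F : (set 'rV[R]_n)^nat) :
  (forall i, g_sigma_preimage coord (F i)) ->
  g_sigma_preimage coord (\bigcup_i (F i)).
Proof. exact: sigma_algebra_bigcup. Qed.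

(* The sigma-algebra generated by the coordinates, i.e. the Borel one. *)
HB.instance Definition _ := @isMeasurable.Build default_measure_display
  'rV[R]_n (g_sigma_preimage coord) rV_set0 rV_setC rV_bigcup.

End measurable_rV.

Section lebesgue_rV.
Context (R : realType).

Lemma measurable_coord_rV n (i : 'I_n) :
  measurable_fun [set: 'rV[R]_n] (fun x : 'rV[R]_n => x 0 i).
Proof.
move=> _ Y mY; rewrite setTI; apply: sub_sigma_algebra.
case: n i => [[]//|n] i; rewrite -bigcup_mkord_ord.
exists i => /=; first exact: ltn_ord.
by exists Y => //; rewrite setTI inord_val.
Qed.

Lemma measurable_fun_rVP d (T : measurableType d) n (f : T -> 'rV[R]_n) :
  (forall i, measurable_fun [set: T] (fun x => f x 0 i)) ->
  measurable_fun [set: T] f.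
Proof.
move=> mf _ Y; rewrite setTI.
rewrite /measurable/= /g_sigma_preimage => mY.
pose G := [set A : set 'rV[R]_n | measurable (f @^-1` A)].
apply: (mY G); split.
  split.
  - by rewrite /G/= preimage_set0.
  - by move=> A; rewrite /G/= setTD -preimage_setC; exact: measurableC.
  - by move=> F mF; rewrite /G/= preimage_bigcup; exact: bigcupT_measurable.
case: n f mf {mY Y} @G => [|n] f mf G A.
  by rewrite big_ord0.
rewrite -bigcup_mkord_ord => -[i /= _ [B mB <-]].
by rewrite /G/= setTI -comp_preimage -[X in measurable X]setTI; exact: mf.
Qed.

Definition rV_cons n (tx : R * 'rV[R]_n) : 'rV[R]_n.+1 :=
  row_mx (const_mx tx.1 : 'rV_1) tx.2.

Definition rV_uncons n (x : 'rV[R]_n.+1) : R * 'rV[R]_n :=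
  (x 0 0, rsubmx (x : 'rV_(1 + n))).

Lemma rV_consK n : cancel (@rV_cons n) (@rV_uncons n).
Proof.
move=> [t x]; rewrite /rV_uncons /rV_cons row_mxKr; congr pair.
have -> : (0 : 'I_n.+1) = lshift n (0 : 'I_1) by exact/val_inj.
by rewrite [LHS]row_mxEl mxE.
Qed.

Lemma measurable_rV_cons n : measurable_fun setT (@rV_cons n).
Proof.
apply: measurable_fun_rVP => i.
case: (split_ordP (i : 'I_(1 + n))) => j ->.
  rewrite (_ : (fun _ => _) = fst); first exact: measurable_fst.
  by apply/funext => -[t x]; rewrite [LHS]row_mxEl mxE.
rewrite (_ : (fun _ => _) = (fun x : 'rV[R]_n => x 0 j) \o snd).
  exact: measurableT_comp (measurable_coord_rV j) measurable_snd.
by apply/funext => -[t x]; rewrite [LHS]row_mxEr.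
Qed.

Lemma measurable_rV_uncons n : measurable_fun setT (@rV_uncons n).
Proof.
apply/measurable_fun_pairP; split; first exact: measurable_coord_rV.
apply: measurable_fun_rVP => i; under eq_fun do rewrite /= mxE.
exact: measurable_coord_rV.
Qed.

Section step.
Context n (m : {sigma_finite_measure set 'rV[R]_n -> \bar R}).

Definition lebesgue_rV_step : set 'rV[R]_n.+1 -> \bar R :=
  pushforward (@lebesgue_measure R \x m)%E (@rV_cons n).

Let mcons A : measurable A -> measurable (@rV_cons n @^-1` A).
Proof.
by move=> mA; rewrite -[X in measurable X]setTI; exact: measurable_rV_cons.
Qed.

Let lebesgue_rV_step0 : lebesgue_rV_step set0 = 0%E.
Proof. by rewrite /lebesgue_rV_step /pushforward preimage_set0 measure0. Qed.

Let lebesgue_rV_step_ge0 A : (0 <= lebesgue_rV_step A)%E.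
Proof. exact: (measure_ge0 (@lebesgue_measure R \x m)%E). Qed.

Let lebesgue_rV_step_sigma_additive : semi_sigma_additive lebesgue_rV_step.
Proof.
move=> F mF tF mUF; rewrite /lebesgue_rV_step /pushforward preimage_bigcup.
apply: (measure_semi_sigma_additive (s := (@lebesgue_measure R \x m)%E)).
- by move=> k; exact: mcons.
- apply/trivIsetP => i j _ _ ij; rewrite -preimage_setI.
  by move/trivIsetP : tF => /(_ _ _ I I ij) ->; rewrite preimage_set0.
- by rewrite -preimage_bigcup; exact: mcons.
Qed.

HB.instance Definition _ := isMeasure.Build _ _ _ lebesgue_rV_step
  lebesgue_rV_step0 lebesgue_rV_step_ge0 lebesgue_rV_step_sigma_additive.

Let lebesgue_rV_step_sigma_finite : sigma_finite setT lebesgue_rV_step.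
Proof.
have /sigma_finiteP[F [TF ndF Foo]] := sigma_finiteT (@lebesgue_measure R).
have /sigma_finiteP[G [TG ndG Goo]] := sigma_finiteT m.
exists (fun k => @rV_uncons n @^-1` (F k `*` G k)).
  rewrite -preimage_bigcup; apply/esym; rewrite -subTset => x _ /=.
  have [k _ Fk] : (\bigcup_k F k) (rV_uncons x).1 by rewrite -TF.
  have [l _ Gl] : (\bigcup_k G k) (rV_uncons x).2 by rewrite -TG.
  exists (maxn k l) => //; split.
  - by move: Fk; exact/subsetPset/ndF/leq_maxl.
  - by move: Gl; exact/subsetPset/ndG/leq_maxr.
move=> k; have [mF Fk] := Foo k; have [mG Gk] := Goo k; split.
  rewrite -[X in measurable X]setTI; apply: measurable_rV_uncons => //.
  exact: measurableX.
rewrite /lebesgue_rV_step /pushforward -comp_preimage.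
rewrite (_ : _ \o _ = id); last by apply/funext => x /=; rewrite rV_consK.
by rewrite preimage_id product_measure1E// lte_mul_pinfty// ge0_fin_numE.
Qed.

HB.instance Definition _ := @Measure_isSigmaFinite.Build _ _ _
  lebesgue_rV_step lebesgue_rV_step_sigma_finite.

End step.

Fixpoint lebesgue_rV n : {sigma_finite_measure set 'rV[R]_n -> \bar R} :=
  match n with
  | 0 => \d_(0 : 'rV[R]_0)
  | k.+1 => lebesgue_rV_step (lebesgue_rV k)
  end.

End lebesgue_rV.

Section calculus.
Context (R : realType) (N : nat).
Implicit Types (f H : 'rV[R]_N -> R) (x v w : 'rV[R]_N) (U : set 'rV[R]_N).

(* The norm `|x| of the library on 'rV[R]_N is the sup norm, hence these. *)
Definition dotv v w : R := \sum_(i < N) v 0 i * w 0 i.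

Definition enorm v : R := Num.sqrt (dotv v v).

Definition grad f x : 'rV[R]_N := \row_i 'D_(delta_mx 0 i) f x.

Definition hess f x : 'M[R]_N :=
  \matrix_(i, j) 'D_(delta_mx 0 j) (fun y => grad f y 0 i) x.

(* To be used with U open. *)
Definition C1_on U f :=
  forall x, U x -> differentiable f x /\ {for x, continuous (grad f)}.

Definition C2_on U f := C1_on U f /\ forall i, C1_on U (fun x => grad f x 0 i).

Definition C1c f := C1_on setT f /\ compact (closure [set x | f x != 0]).

Definition is_norm H :=
  [/\ forall x, 0 <= H x,
      forall x, H x = 0 -> x = 0,
      forall t x, H (t *: x) = `|t| * H x
    & forall x y, H (x + y) <= H x + H y].

(* Outer unit normal to the level sets of H. *)
Definition gauss_map H x := (enorm (grad H x))^-1 *: grad H x.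

(* k is an eigenvalue of the shape operator at x of the level set of H through
   x, that is, of the differential of the Gauss map on the tangent space; with
   the outer normal, k = 1 / r on a Euclidean sphere of radius r. *)
Definition principal_curvature H x (k : R) :=
  exists v, [/\ v != 0, dotv (grad H x) v = 0
              & 'D_v (gauss_map H) x = k *: v].

(* For a norm H, the boundary of [set x | H x < 1] is [set x | H x = 1]. *)
Definition uniformly_convex_ball H :=
  exists2 c, 0 < c &
    forall x k, H x = 1 -> principal_curvature H x k -> c <= k.

Definition finsler_norm H :=
  [/\ is_norm H, C2_on [set x | x != 0] H & uniformly_convex_ball H].

End calculus.

Section weak_solutions.
Context (R : realType) (N : nat).
Implicit Types (f H u phi : 'rV[R]_N -> R) (Du : 'rV[R]_N -> 'rV[R]_N).
Implicit Types (p q : R).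

Local Notation mu := (lebesgue_rV R N).

Definition Lp_loc p f := measurable_fun setT f /\
  forall K, compact K -> mu.-integrable K (fun x => (`|f x| `^ p)%:E).

Definition Linfty_loc f := measurable_fun setT f /\
  forall K, compact K -> exists M, {ae mu, forall x, K x -> `|f x| <= M}.

Definition weak_gradient u Du := forall phi i, C1c phi ->
  \int[mu]_x (u x * grad phi x 0 i) = - \int[mu]_x (Du x 0 i * phi x).

(* u belongs to W^{1,p}_loc, with weak gradient Du. *)
Definition W1p_loc p u Du :=
  [/\ Lp_loc p u, forall i, Lp_loc p (fun x => Du x 0 i) & weak_gradient u Du].

(* Where Du x = 0 the factor H (Du x) `^ (p - 1) vanishes for p > 1, so that the
   junk value of grad H at 0 does not matter. *)
Definition weak_solution H p q u Du :=
  [/\ W1p_loc p u Du, Linfty_loc u &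
      forall phi, C1c phi ->
        \int[mu]_x (H (Du x) `^ (p - 1) * dotv (grad H (Du x)) (grad phi x)) =
        \int[mu]_x (`|u x| `^ (q - 1) * u x * phi x)].

(* The case Du x = 0 is explicit since 0 `^ 0 = 1 and grad H, hess H have junk
   values at 0. *)
Definition stability_form H p q u Du phi : R :=
  \int[mu]_x (if Du x == 0 then 0 else
    (p - 1) * H (Du x) `^ (p - 2) * dotv (grad H (Du x)) (grad phi x) ^+ 2)
  + \int[mu]_x (if Du x == 0 then 0 else
    H (Du x) `^ (p - 1) * dotv (grad phi x *m hess H (Du x)) (grad phi x))
  - \int[mu]_x (q * `|u x| `^ (q - 1) * phi x ^+ 2).

Definition stable H p q u Du :=
  forall phi, C1c phi -> 0 <= stability_form H p q u Du phi.

End weak_solutions.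

Definition q_c (R : realType) (N : nat) (p : R) : R :=
  let n := N%:R in
  (((p - 1) * n - p) ^+ 2 + p ^+ 2 * (p - 2) - p ^+ 2 * (p - 1) * n
    + 2 * p ^+ 2 * Num.sqrt ((p - 1) * (n - 1)))
  / ((n - p) * ((p - 1) * n - p * (p + 3))).

(* Main.v *)
(* Testing the equation with |u|^(g-1) u z^2 and the stability inequality with
   |u|^((g-1)/2) u z gives, up to errors supported where the cut-off z varies,
     g Y <= X   and   q X <= (p - 1) ((g + 1) / 2)^2 Y,
   where X and Y are the integrals of |u|^(q+g) z^2 and H(Du)^p |u|^(g-1) z^2.
   The terms in Du use only Euler's identity <grad H(xi), xi> = H(xi), the fact
   that xi lies in the kernel of D^2 H(xi), and |<grad H(xi), v>| <= H(v). When
   (p - 1) ((g + 1) / 2)^2 < g q the two inequalities are incompatible for X > 0,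
   so Young's inequality absorbs the errors and, for a cut-off at scale rho,
     X <= C rho^(N - r),  r = p (q + g) / (q - p + 1).
   The range of q is exactly what allows some g > 1 with r > N; letting rho tend
   to infinity gives u = 0. Both tests are legitimate by dominated convergence,
   with u replaced by mollifications, so no regularity theory is needed. *)

Require Import Defs.
From HB Require Import structures.
From mathcomp Require Import all_boot all_order all_algebra.
From mathcomp Require Import all_classical all_reals all_analysis.
From mathcomp Require Import measurable_realfun ring lra.

Set Implicit Arguments.
Unset Strict Implicit.
Unset Printing Implicit Defensive.
Import Order.TTheory GRing.Theory Num.Theory.
Import numFieldNormedType.Exports.
Local Open Scope classical_set_scope.
Local Open Scope ring_scope.

(** * Borel sets and cubes *)

(** The obstacle is that test functions must be C^1 with compact support, whereas u has only a weak
    gradient. Powers are therefore taken of mollifications of u, and the passage to the limit rests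
    on two bounds: the sup bound on u, which averaging preserves, and an integrable majorant for the
    p-th powers of the gradients. The second comes from Jensen's inequality: the p-th power of a
    mollified derivative is at most the mollification of the p-th power. This reduces the
    approximation to L^1: mollifications that converge fast enough in L^1 converge almost everywhere
    under an integrable majorant.

    Young's inequality is used pointwise, with t standing for |grad z| / z, so the errors integrate
    directly and all constants are independent of the scale rho.

    As g increases to the larger root G0 of (p - 1) ((g + 1) / 2)^2 = g q, the condition r > N
    becomes N (q - p + 1) < p (q + G0). Isolating the square root in G0 and squaring gives a
    quadratic inequality in q - p + 1. For large N its larger root is q_c - p + 1, which is where
    the expression of q_c comes from. *)

Section rV_topology.
Context (R : realType).

Lemma coord_le_norm n (x : 'rV[R]_n) i : `|x 0 i| <= `|x|.
Proof.
rewrite [leRHS]/Num.norm /= mx_normrE; apply/bigmax_geP; right => /=.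
by exists (0, i).
Qed.

Lemma norm_rV_le n (x : 'rV[R]_n) r :
  0 <= r -> (forall i, `|x 0 i| <= r) -> `|x| <= r.
Proof.
move=> r0 xr; rewrite [leLHS]/Num.norm /= mx_normrE; apply/bigmax_leP; split => //.
by move=> [j i] _ /=; rewrite ord1.
Qed.

Lemma norm_rV_lt n (x : 'rV[R]_n) r :
  0 < r -> (forall i, `|x 0 i| < r) -> `|x| < r.
Proof.
move=> r0 xr; rewrite [ltLHS]/Num.norm /= mx_normrE; apply/bigmax_ltP; split => //.
by move=> [j i] _ /=; rewrite ord1.
Qed.

Definition cube n (r : R) : set 'rV[R]_n := [set x | `|x| <= r].
Arguments cube : clear implicits.

Lemma closed_cube n r : closed (cube n r).
Proof.
rewrite (_ : cube n r = (fun x : 'rV[R]_n => `|x|) @^-1` [set y | y <= r])//.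
by apply: closed_comp => [x _|]; [exact: norm_continuous|exact: closed_le].
Qed.

Lemma compact_cube n r : compact (cube n r).
Proof.
apply: bounded_closed_compact; last exact: closed_cube.
exists r; split; first exact: num_real.
by move=> M rM x /= xr; apply: le_trans xr (ltW rM).
Qed.

Lemma cubeS n r s : r <= s -> cube n r `<=` cube n s.
Proof. by move=> rs x /= xr; apply: le_trans rs. Qed.

(** Coordinate preimages generate the sigma-algebra, so a property stable under its operations need
    only be checked on them. For n = 0 there are no coordinates and the generating family is
    empty. *)
Lemma measurable_rV_ind n (G : set (set 'rV[R]_n)) : sigma_algebra setT G ->
  (forall i B, measurable B -> G ((fun x : 'rV[R]_n => x 0 i) @^-1` B)) ->
  forall A, measurable A -> G A.
Proof.
move=> sG GB A; rewrite /measurable/= /g_sigma_preimage => mA.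
apply: (mA G); split => //.
case: n G sG GB A mA => [|n] G sG GB A mA B; first by rewrite big_ord0.
rewrite -bigcup_mkord_ord => -[i /= _ [C mC <-]].
by rewrite setTI; exact: GB.
Qed.

(** Second countability: an open set is the union of the countably many boxes with rational centre
    and half-side 1/(k+1) that it contains. *)
Lemma measurable_open_rV n (U : set 'rV[R]_n) : open U -> measurable U.
Proof.
move=> oU.
pose box (a : 'rV[rat]_n * nat) : set 'rV[R]_n :=
  \bigcap_(i in [set: 'I_n]) [set x | `|x 0 i - ratr (a.1 0 i)| < a.2.+1%:R^-1].
pose F a := if `[< box a `<=` U >] then box a else set0.
have -> : U = \bigcup_a F a.
  apply/seteqP; split => [x Ux|x [a _]]; last first.
    by rewrite /F; case: asboolP => // aU /aU.
  have [e /= e0 eU] : nbhs_ball x U by apply/nbhs_ballP; exact: open_nbhs_nbhs.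
  (* Two points of one box differ by less than 2/(k+1) in each coordinate, so such a box through x
     stays inside the ball of radius e. *)
  have [k] : exists k : nat, 2 * k.+1%:R^-1 < e.
    have /ltr_add_invr[k] : 0 < e / 2 by lra.
    by rewrite add0r => ke; exists k; move: ke; set t := _^-1; lra.
  move=> ke.
  have k0 : 0 < k.+1%:R^-1 :> R by rewrite invr_gt0.
  have qP i : exists q, `|x 0 i - ratr q| < k.+1%:R^-1.
    have /(@rat_in_itvoo R)[q] : x 0 i - k.+1%:R^-1 < x 0 i + k.+1%:R^-1.
      by rewrite (lt_trans (y := x 0 i))// ?ltrDl// gtrBl.
    rewrite in_itv/= => /andP[h1 h2]; exists q.
    by rewrite ltr_distlC h1 h2.
  have [q hq] := choice qP.
  have bx : box (\row_i q i, k) x by move=> i _ /=; rewrite mxE.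
  exists (\row_i q i, k) => //; rewrite /F; case: asboolP => // -[] y byx.
  apply: eU; rewrite -ball_normE /ball_/=; apply: norm_rV_lt => // i.
  rewrite !mxE; have /= := bx i I; have /= := byx i I; rewrite !mxE => h1 h2.
  rewrite (_ : _ - _ = (x 0 i - ratr (q i)) - (y 0 i - ratr (q i))); last by lra.
  by rewrite (le_lt_trans (ler_normB _ _))// (lt_trans _ ke)// mulr2n mulrDl !mul1r ltrD.
apply: countable_bigcupT_measurable; first exact: countableP.
move=> a; rewrite /F; case: ifP => // _.
apply: fin_bigcap_measurable => [|i _]; first exact: finite_finset.
rewrite [X in measurable X](_ : _ =
  (fun x : 'rV[R]_n => x 0 i) @^-1` ball (ratr (a.1 0 i) : R) a.2.+1%:R^-1); last first.
  by apply/seteqP; split => x /=; rewrite -ball_normE /ball_/= distrC.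
rewrite -[X in measurable X]setTI; apply: measurable_coord_rV => //.
by rewrite ball_itv; exact: measurable_itv.
Qed.

Lemma measurable_closed_rV n (K : set 'rV[R]_n) : closed K -> measurable K.
Proof.
move=> cK; rewrite -[K]setCK; apply: measurableC; apply: measurable_open_rV.
exact: closed_openC.
Qed.

Lemma measurable_cube n r : measurable (cube n r).
Proof. by apply: measurable_closed_rV; exact: closed_cube. Qed.

(** Relative to an open set, because the derivatives of H are continuous only away from the
    origin. *)
Lemma open_continuous_measurable_rV n (U : set 'rV[R]_n) (f : 'rV[R]_n -> R) :
  open U -> {in U, continuous f} -> measurable_fun U f.
Proof.
move=> oU cf; apply: (measurability _ (@RGenOInfty.measurableE R)).
move=> _ /= [_ [x ->] <-]; apply: measurable_open_rV.
rewrite openE => y [Uy fy]; rewrite /interior/=.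
have xf : nbhs y (f @^-1` `]x, +oo[).
  move: fy => /=; rewrite in_itv/= andbT => fy.
  have fx : \forall z \near y, x < f z.
    by apply: (cvgr_gt (f y) (cf y (mem_set Uy)) _ fy).
  apply: filterS fx => z /= xz; by rewrite in_itv/= andbT.
apply: filterS2 (open_nbhs_nbhs (conj oU Uy)) xf.
by move=> z Uz fz; split.
Qed.

Lemma continuous_measurable_rV n (f : 'rV[R]_n -> R) :
  continuous f -> measurable_fun setT f.
Proof.
by move=> cf; apply: (open_continuous_measurable_rV openT) => x _; exact: cf.
Qed.

End rV_topology.
Arguments cube {R} n r.
Arguments measurable_cube {R} n r.
Arguments closed_cube {R} n r.
Arguments compact_cube {R} n r.

(** * Lebesgue measure of cubes and translation invariance *)

Section lebesgue_rV_theory.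
Context (R : realType).
Local Notation leb := (@lebesgue_measure R).

Lemma lebesgue_rVS n (A : set 'rV[R]_n.+1) :
  lebesgue_rV R n.+1 A = (leb \x lebesgue_rV R n)%E (@rV_cons R n @^-1` A).
Proof. by []. Qed.

Lemma rV_consE0 n (tx : R * 'rV[R]_n) : (rV_cons tx : 'rV[R]_n.+1) 0 0 = tx.1.
Proof. by rewrite -[in RHS](rV_consK tx). Qed.

Lemma rV_consES n (tx : R * 'rV[R]_n) i :
  (rV_cons tx : 'rV[R]_n.+1) 0 (rshift 1 i) = tx.2 0 i.
Proof. by rewrite /rV_cons [LHS]row_mxEr. Qed.

Lemma rV_consDr n (t : R) (x : 'rV[R]_n) (a : 'rV[R]_n.+1) :
  rV_cons (t, x) + a = rV_cons (t + (rV_uncons a).1, x + (rV_uncons a).2).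
Proof.
apply/rowP => i; case: (split_ordP (i : 'I_(1 + n))) => j ->.
  rewrite ord1 (_ : lshift n 0 = 0); last exact/val_inj.
  by rewrite [LHS]mxE !rV_consE0.
by rewrite rV_consES mxE rV_consES !mxE.
Qed.

Lemma norm_rV_cons n (tx : R * 'rV[R]_n) r : 0 <= r ->
  (`|rV_cons tx| <= r) = (`|tx.1| <= r) && (`|tx.2| <= r).
Proof.
move=> r0.
apply/idP/andP => [h|[h1 h2]].
  split; first by rewrite -rV_consE0 (le_trans (coord_le_norm _ _)).
  by apply: norm_rV_le => // i; rewrite -rV_consES (le_trans (coord_le_norm _ _)).
apply: norm_rV_le => // i; case: (split_ordP (i : 'I_(1 + n))) => j ->.
  by rewrite ord1 (_ : lshift n 0 = 0) ?rV_consE0//; exact/val_inj.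
by rewrite rV_consES (le_trans (coord_le_norm _ _)).
Qed.

Lemma lebesgue_rV_cube n r : 0 <= r ->
  lebesgue_rV R n (cube n r) = ((2 * r) ^+ n)%:E.
Proof.
move=> r0; elim: n => [|n IHn].
  rewrite expr0 /= diracE mem_set// /cube/= (le_trans _ r0)//.
  by apply: norm_rV_le => // -[].
rewrite lebesgue_rVS (_ : _ @^-1` _ = `[(- r), r] `*` cube n r); last first.
  apply/seteqP; split => x; rewrite /cube/= norm_rV_cons// in_itv/= -ler_norml.
    by move=> /andP.
  by move=> [-> ->].
rewrite product_measure1E//; last exact: measurable_cube.
rewrite IHn -[X in (X * _)%E]/(leb `[(- r), r]%classic) lebesgue_measure_itv/= lte_fin exprS.
case: ifPn => h.
  by rewrite -EFinD -EFinM opprK (_ : 2 * r = r + r) ?mulr2n ?mulrDl ?mul1r.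
have -> : r = 0 by apply/eqP; rewrite eq_le r0 andbT leNgt; apply: contra h => h; lra.
by rewrite mulr0 mul0e mul0r.
Qed.

Lemma lebesgue_rV_cube_fin n r : (lebesgue_rV R n (cube n r) < +oo)%E.
Proof.
apply: (@le_lt_trans _ _ (lebesgue_rV R n (cube n `|r|))).
  apply: le_measure; rewrite ?inE; [exact: measurable_cube|exact: measurable_cube|].
  exact/cubeS/ler_norm.
by rewrite lebesgue_rV_cube// ltry.
Qed.

(** The translated measure gives half-open intervals their length, which characterises Lebesgue
    measure. *)
Lemma lebesgue_measure_translation (a : R) (A : set R) : measurable A ->
  leb ((fun t => t + a) @^-1` A) = leb A.
Proof.
have mf : measurable_fun setT (fun t : measurableTypeR R => (t : R) + a : measurableTypeR R).
  by apply: measurable_funD => //; exact: measurable_cst.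
pose phi : {mfun measurableTypeR R >-> measurableTypeR R} :=
  HB.pack (fun t : measurableTypeR R => (t : R) + a : measurableTypeR R) (isMeasurableFun.Build _ _ _ _ _ mf).
move=> mA; apply/esym.
apply: (@lebesgue_measure_unique R (pushforward leb phi)) => //.
move=> _ [[x y]] _ <- /=; rewrite /pushforward.
rewrite [X in _ = leb X](_ : _ = `]x - a, y - a]%classic); last first.
  by apply/seteqP; split => t /=; rewrite !in_itv/= ltrBlDr lerBrDr.
by rewrite !lebesgue_measure_itv/= !lte_fin ltrD2r -!EFinD opprD opprK addrACA addNr addr0.
Qed.

Lemma ge0_lebesgue_integral_translation (a : R) (f : measurableTypeR R -> \bar R) :
  measurable_fun setT f -> (forall t, 0 <= f t)%E ->
  (\int[leb]_t f ((t : R) + a)%R = \int[leb]_t f t)%E.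
Proof.
have mphi : measurable_fun setT (fun t : measurableTypeR R => (t : R) + a : measurableTypeR R).
  by apply: measurable_funD => //; exact: measurable_cst.
move=> mf f0.
rewrite -[LHS](ge0_integral_pushforward mphi leb measurableT mf (fun x _ => f0 x)).
by apply: eq_measure_integral => A mA _; exact: lebesgue_measure_translation.
Qed.

(** Induction on the dimension: a section of a translated set is a translate of a section, which the
    induction hypothesis handles, and the outer integral is then translated in the first coordinate.
    This makes the mass of a mollifier independent of its centre. *)
Lemma lebesgue_rV_translation n (a : 'rV[R]_n) (A : set 'rV[R]_n) : measurable A ->
  lebesgue_rV R n ((fun x => x + a) @^-1` A) = lebesgue_rV R n A.
Proof.
elim: n a A => [|n IHn] a A mA.
  by congr (lebesgue_rV R 0 _); apply/seteqP; split => x /=; rewrite (_ : x + a = x)//;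
    apply/rowP => -[].
pose b := rV_uncons a.
have mB : measurable (@rV_cons R n @^-1` A).
  by rewrite -[X in measurable X]setTI; exact: measurable_rV_cons.
rewrite !lebesgue_rVS /= /product_measure1.
under eq_integral => t _.
  rewrite (_ : (_ \o _) t = (lebesgue_rV R n \o xsection (@rV_cons R n @^-1` A)) (t + b.1)).
    over.
  rewrite /= -[RHS](IHn b.2); last exact: measurable_xsection.
  congr (lebesgue_rV R n _); apply/seteqP; split => x;
    by rewrite /xsection/= !inE/= rV_consDr.
rewrite (@ge0_lebesgue_integral_translation b.1 (lebesgue_rV R n \o xsection (@rV_cons R n @^-1` A)))//.
exact: measurable_fun_xsection.
Qed.

Lemma ge0_lebesgue_rV_integral_translation n (a : 'rV[R]_n) (f : 'rV[R]_n -> \bar R) :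
  measurable_fun setT f -> (forall t, 0 <= f t)%E ->
  (\int[lebesgue_rV R n]_x f (x + a)%R = \int[lebesgue_rV R n]_x f x)%E.
Proof.
have mphi : measurable_fun setT (fun x : 'rV[R]_n => x + a).
  apply: measurable_fun_rVP => i; under eq_fun do rewrite mxE.
  by apply: measurable_funD; [exact: measurable_coord_rV|exact: measurable_cst].
move=> mf f0.
rewrite -[LHS](ge0_integral_pushforward mphi (lebesgue_rV R n) measurableT mf (fun x _ => f0 x)).
by apply: eq_measure_integral => A mA _; exact: lebesgue_rV_translation.
Qed.

End lebesgue_rV_theory.

(** * Density of continuous functions in L1 *)

Section L1_density.
Context (R : realType) (n : nat).
Local Notation mu := (lebesgue_rV R n).
Implicit Types (Q : set 'rV[R]_n) (f g h : 'rV[R]_n -> R).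

Lemma integrable_cst_lty d (T : measurableType d) (m : {measure set T -> \bar R})
    (D : set T) (M : R) : measurable D -> (m D < +oo)%E ->
  m.-integrable D (cst M%:E).
Proof.
move=> mD Doo; apply/integrableP; split; first exact: measurable_cst.
rewrite (eq_integral (cst `|M|%:E))// integral_cst// lte_mul_pinfty//.
Qed.

(** Extended-real valued, so that the triangle inequality holds for all measurable functions,
    integrable or not. *)
Definition L1dist Q f g : \bar R := (\int[mu]_(x in Q) `|f x - g x|%:E)%E.

Lemma L1dist_ge0 Q f g : (0 <= L1dist Q f g)%E.
Proof. by apply: integral_ge0 => x _; rewrite lee_fin. Qed.

Lemma measurable_EFin_normB Q f g : measurable_fun setT f -> measurable_fun setT g ->
  measurable_fun Q (fun x => `|f x - g x|%:E).
Proof.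
move=> mf mg; apply/measurable_EFinP; apply: measurable_funTS.
by apply: measurableT_comp => //; exact: measurable_funB.
Qed.

Lemma L1dist_triangle Q f g h : measurable Q ->
  measurable_fun setT f -> measurable_fun setT g -> measurable_fun setT h ->
  (L1dist Q f h <= L1dist Q f g + L1dist Q g h)%E.
Proof.
move=> mQ mf mg mh; rewrite -ge0_integralD//; try exact: measurable_EFin_normB.
apply: ge0_le_integral => //.
- exact: measurable_EFin_normB.
- by apply: emeasurable_funD; exact: measurable_EFin_normB.
- move=> x _; rewrite -EFinD lee_fin.
  by rewrite (_ : f x - h x = (f x - g x) + (g x - h x)) ?ler_normD//; ring.
Qed.

Lemma dominated_L1dist Q (f_ : nat -> 'rV[R]_n -> R) f M : measurable Q ->
  (mu Q < +oo)%E -> (forall k, measurable_fun setT (f_ k)) -> measurable_fun setT f ->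
  (forall k x, Q x -> `|f_ k x| <= M) ->
  (forall x, Q x -> f_ ^~ x @ \oo --> f x) ->
  (fun k => L1dist Q (f_ k) f) @ \oo --> 0%E.
Proof.
move=> mQ Qoo mf_ mf fM ff.
have [//|||||_ + _] := @dominated_convergence _ _ _ mu Q mQ
  (fun k => EFin \o f_ k) (EFin \o f) (cst M%:E).
- by move=> k; apply/measurable_EFinP; exact: measurable_funTS.
- by apply/measurable_EFinP; exact: measurable_funTS.
- by apply: aeW => x Qx; apply/cvg_EFin; [near=> k|exact: ff].
- exact: integrable_cst_lty.
- by apply: aeW => x k Qx; rewrite lee_fin; exact: fM.
- by [].
Unshelve. all: by end_near. Qed.

Definition continuous_approx Q f :=
  forall e, 0 < e -> exists2 g, continuous g & (L1dist Q f g < e%:E)%E.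

(** The constraint 0 <= g <= 1 is what makes the class stable under unions: it keeps the factors
    that multiply the errors at most 1. *)
Definition continuous_approx01 Q (A : set 'rV[R]_n) :=
  measurable A /\ forall e, 0 < e -> exists g,
    [/\ continuous g, forall x, 0 <= g x <= 1 & (L1dist Q \1_A g < e%:E)%E].

Section fixed_domain.
Variable Q : set 'rV[R]_n.
Hypotheses (mQ : measurable Q) (Qoo : (mu Q < +oo)%E).

Lemma continuous_approx01_lim (A_ : nat -> set 'rV[R]_n) A : measurable A ->
  (forall k, continuous_approx01 Q (A_ k)) ->
  (forall x, (\1_(A_ k) x : R) @[k --> \oo] --> (\1_A x : R)) -> continuous_approx01 Q A.
Proof.
move=> mA GA AA; split => // e e0.
have mAk k : measurable_fun setT (\1_(A_ k) : 'rV[R]_n -> R).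
  by have [mAk _] := GA k; exact: measurable_indic.
have : (fun k => L1dist Q \1_(A_ k) \1_A) @ \oo --> 0%:E.
  apply: (@dominated_L1dist _ _ _ 1) => //.
  by move=> k x _; rewrite indicE; case: (_ \in _); rewrite ?normr1 ?normr0.
move=> /fine_cvgP[[k0 _ fk] /cvgrPdist_lt /(_ (e / 2))].
rewrite divr_gt0// => /(_ isT)[k1 _ k1e].
pose k := maxn k0 k1.
have kfin := fk k (leq_maxl _ _); have /= := k1e k (leq_maxr _ _).
rewrite sub0r normrN ger0_norm ?fine_ge0 ?L1dist_ge0// => ke.
have [_ /(_ (e / 2))] := GA k; rewrite divr_gt0// => /(_ isT)[g [cg g01 Agk]].
exists g; split => //.
apply: le_lt_trans (L1dist_triangle mQ _ (mAk k) _) _ => //.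
- exact: continuous_measurable_rV.
rewrite [e]splitr EFinD lteD//.
rewrite /L1dist; under eq_integral do rewrite distrC.
by rewrite -[X in (X < _)%E](fineK kfin) lte_fin.
Qed.

Lemma continuous_approx01U (A B : set 'rV[R]_n) :
  continuous_approx01 Q A -> continuous_approx01 Q B ->
  continuous_approx01 Q (A `|` B).
Proof.
move=> [mA GA] [mB GB]; split; first exact: measurableU.
move=> e e0; have e20 : 0 < e / 2 by rewrite divr_gt0.
have [f [cf f01 Af]] := GA _ e20; have [g [cg g01 Bg]] := GB _ e20.
(* This is the formula for the indicator of a union, with f and g in place of the indicators; the
   error splits into those of f and g, each multiplied by a factor in [0, 1]. *)
pose h x := 1 - (1 - f x) * (1 - g x).
have ch : continuous h.
  move=> x; have c1 : {for x, continuous (fun=> 1 : R)} by exact: cst_continuous.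
  exact: continuousB c1 (continuousM (continuousB c1 (cf x)) (continuousB c1 (cg x))).
exists h; split => //.
  move=> x; have := f01 x; have := g01 x; rewrite /h.
  by move=> /andP[g0 g1] /andP[f0 f1]; apply/andP; split; nra.
rewrite [e]splitr EFinD; apply: le_lt_trans (lteD Af Bg).
have mi X : measurable X -> measurable_fun setT (\1_X : 'rV[R]_n -> R).
  by move=> mX; exact: measurable_indic.
have mf := continuous_measurable_rV cf; have mg := continuous_measurable_rV cg.
have mh := continuous_measurable_rV ch.
rewrite -ge0_integralD//; try (apply: measurable_EFin_normB => //; exact: mi).
apply: ge0_le_integral => //.
- by apply: measurable_EFin_normB => //; apply: mi; exact: measurableU.
- by apply: emeasurable_funD; apply: measurable_EFin_normB => //; exact: mi.
- move=> x _; rewrite -EFinD lee_fin.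
  have := f01 x; have := g01 x; rewrite /h.
  move=> /andP[g0 g1] /andP[f0 f1].
  have -> : (\1_(A `|` B) x : R) = 1 - (1 - \1_A x) * (1 - \1_B x).
    rewrite !indicE in_setU; case: (_ \in _); case: (_ \in _) => /=; ring.
  rewrite !indicE; set a := (_ \in A)%:R; set b := (_ \in B)%:R.
  have a01 : 0 <= a <= 1 by rewrite /a; case: (_ \in _); rewrite !(lexx,ler01).
  have b01 : 0 <= b <= 1 by rewrite /b; case: (_ \in _); rewrite !(lexx,ler01).
  rewrite (_ : 1 - _ - _ = (a - f x) * (1 - b) + (b - g x) * (1 - f x)); last by ring.
  move: a01 b01 => /andP[a0 a1] /andP[b0 b1].
  rewrite (le_trans (ler_normD _ _))// !normrM lerD// ler_piMr// ger0_norm; lra.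
Qed.

Lemma continuous_approx01C (A : set 'rV[R]_n) :
  continuous_approx01 Q A -> continuous_approx01 Q (~` A).
Proof.
move=> [mA GA]; split; first exact: measurableC.
move=> e e0; have [f [cf f01 Af]] := GA _ e0.
exists (fun x => 1 - f x); split => //.
- move=> x; have c1 : {for x, continuous (fun=> 1 : R)} by exact: cst_continuous.
  exact: continuousB c1 (cf x).
- by move=> x; have := f01 x; lra.
- apply: le_lt_trans Af; rewrite le_eqVlt; apply/orP; left; apply/eqP.
  apply: eq_integral => x _; congr EFin; rewrite -normrN; congr (`| _ |).
  by rewrite !indicE in_setC; case: (_ \in _) => /=; ring.
Qed.

Lemma continuous_approx01_0 : continuous_approx01 Q set0.
Proof.
split => // e e0; exists (cst 0); split => //.
- exact: cst_continuous.
- by move=> x; rewrite lexx ler01.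
- rewrite /L1dist (eq_integral (cst 0%E)) ?integral0//.
  by move=> x _; rewrite indic0 subrr normr0.
Qed.

(** A countable union is treated as the limit of finite unions: at each point the indicators of
    these are eventually constant, so bounded convergence applies. *)
Lemma continuous_approx01_sigma_algebra :
  sigma_algebra setT (continuous_approx01 Q).
Proof.
split.
- exact: continuous_approx01_0.
- by move=> A GA; rewrite setTD; exact: continuous_approx01C.
move=> F GF.
have mF k : measurable (F k) by have [] := GF k.
apply: (@continuous_approx01_lim (fun k => \big[setU/set0]_(i < k) F i)).
- exact: bigcupT_measurable.
- elim=> [|k IHk].
    by rewrite big_ord0; exact: continuous_approx01_0.
  by rewrite big_ord_recr/=; exact: continuous_approx01U.
- move=> x; apply: cvg_near_cst.
  have [[k _ Fk]|nF] := pselect ((\bigcup_k F k) x).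
    exists k.+1 => // m /= km; rewrite !indicE !mem_set//; first by exists k.
    by rewrite -bigcup_mkord; exists k.
  apply: nearW => m; rewrite !indicE !memNset//.
  by rewrite -bigcup_mkord => -[j _ Fj]; apply: nF; exists j.
Qed.

Lemma continuous_approx01_measurable A : measurable A -> continuous_approx01 Q A.
Proof.
apply: measurable_rV_ind; first exact: continuous_approx01_sigma_algebra.
move=> i B; have [G0 GC GU] := continuous_approx01_sigma_algebra.
pose S := [set B : set R | continuous_approx01 Q ((fun x : 'rV[R]_n => x 0 i) @^-1` B)].
move=> mB.
have {}mB : (@RGenOInfty.G R).-sigma.-measurable B by rewrite -RGenOInfty.measurableE.
apply: (mB S); split.
  split.
  - by rewrite /S/= preimage_set0.
  - by move=> C SC; rewrite /S/= setTD -preimage_setC; exact: continuous_approx01C.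
  - by move=> F SF; rewrite /S/= preimage_bigcup; exact: GU.
move=> _ [a ->]; rewrite /S/=.
have mA : measurable ((fun x : 'rV[R]_n => x 0 i) @^-1` `]a, +oo[).
  rewrite -[X in measurable X]setTI; apply: (measurable_coord_rV i) => //.
split => // e e0.
(* Ramps of slope k: they vanish for x_i <= a and equal 1 as soon as x_i - a >= 1/k, hence they
   converge pointwise to the indicator of the half-space. *)
pose g k (x : 'rV[R]_n) := Num.min 1 (Num.max 0 (k%:R * (x 0 i - a))).
have cg k : continuous (g k).
  move=> x; have cc (c : R) : {for x, continuous (fun=> c)} by exact: cst_continuous.
  have c1 : {for x, continuous (fun x : 'rV[R]_n => k%:R * (x 0 i - a))}.
    by apply: continuousM (cc _) (continuousB _ (cc _)); exact: coord_continuous.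
  exact: (continuous_min (cc 1) (continuous_max (cc 0) c1)).
have g01 k x : 0 <= g k x <= 1.
  by rewrite /g ge_min lexx /= le_min ler01 le_max lexx.
have mg k := continuous_measurable_rV (@cg k).
have : (fun k => L1dist Q (g k) \1_((fun x : 'rV[R]_n => x 0 i) @^-1` `]a, +oo[)) @ \oo --> 0%:E.
  apply: (@dominated_L1dist _ _ _ 1) => //.
    by move=> k x _; have /andP[? ?] := g01 k x; rewrite ger0_norm.
  move=> x _; apply: cvg_near_cst; rewrite indicE.
  have [ax|xa] := ltP a (x 0 i).
    rewrite mem_set/=; last by rewrite in_itv/= ax.
    have /ltr_add_invr[m] : 0 < x 0 i - a by rewrite subr_gt0.
    rewrite add0r => am; exists m.+1 => // k /= mk.
    rewrite /g; apply/min_idPl; rewrite le_max; apply/orP; right.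
    rewrite -ler_pdivrMr ?subr_gt0// mul1r (le_trans _ (_ : m.+1%:R <= _)) ?ler_nat//.
    by rewrite -[leRHS]invrK lef_pV2 ?posrE ?subr_gt0 ?invr_gt0// ltW.
  rewrite memNset/=; last by rewrite in_itv/= andbT; apply/negP; rewrite -leNgt.
  apply: nearW => k; rewrite /g; rewrite (max_idPl _) ?(min_idPr _)//.
  by rewrite mulr_ge0_le0// subr_le0.
move=> /fine_cvgP[[k0 _ fk] /cvgrPdist_lt /(_ e e0)[k1 _ k1e]].
pose k := maxn k0 k1.
have kfin := fk k (leq_maxl _ _); have /= := k1e k (leq_maxr _ _).
rewrite sub0r normrN ger0_norm ?fine_ge0 ?L1dist_ge0// => ke.
exists (g k); split => //.
rewrite /L1dist; under eq_integral do rewrite distrC.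
by rewrite -[X in (X < _)%E](fineK kfin) lte_fin.
Qed.

End fixed_domain.

Import HBSimple.

(** Simple functions are dense in L^1 and are finite combinations of indicators, to which the
    previous approximation applies term by term. *)
Lemma continuous_approx_integrable Q f : measurable Q -> (mu Q < +oo)%E ->
  measurable_fun setT f -> mu.-integrable Q (EFin \o f) -> continuous_approx Q f.
Proof.
move=> mQ Qoo mf intf.
have cst0 : continuous (fun _ : 'rV[R]_n => 0 : R) by exact: cst_continuous.
have approxD f1 f2 : measurable_fun setT f1 -> measurable_fun setT f2 ->
    continuous_approx Q f1 -> continuous_approx Q f2 ->
    continuous_approx Q (fun x => f1 x + f2 x).
  move=> mf1 mf2 G1 G2 e e0; have e20 : 0 < e / 2 by rewrite divr_gt0.
  have [g1 cg1 fg1] := G1 _ e20; have [g2 cg2 fg2] := G2 _ e20.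
  exists (fun x => g1 x + g2 x); first by move=> x; exact: (continuousD (cg1 x) (cg2 x)).
  rewrite [e]splitr EFinD; apply: le_lt_trans (lteD fg1 fg2).
  have mg1 := continuous_measurable_rV cg1; have mg2 := continuous_measurable_rV cg2.
  rewrite -ge0_integralD//; try exact: measurable_EFin_normB.
  apply: ge0_le_integral => //.
  - by apply: measurable_EFin_normB => //; exact: measurable_funD.
  - by apply: emeasurable_funD; exact: measurable_EFin_normB.
  - by move=> x _; rewrite -EFinD lee_fin opprD addrACA ler_normD.
have approxZ c A : measurable A -> continuous_approx Q (fun x => c * \1_A x).
  move=> mA e e0; have d0 : 0 < e / (`|c| + 1) by rewrite divr_gt0// ltr_wpDl.
  have [_ /(_ _ d0)[g [cg _ Ag]]] := continuous_approx01_measurable mQ Qoo mA.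
  exists (fun x => c * g x).
    by move=> x; apply: continuousM; [exact: cst_continuous|exact: cg].
  have mg := continuous_measurable_rV cg.
  have mA' : measurable_fun setT (\1_A : 'rV[R]_n -> R) by exact: measurable_indic.
  rewrite /L1dist (eq_integral (fun x => `|c|%:E * `|\1_A x - g x|%:E)%E); last first.
    by move=> x _; rewrite -EFinM -normrM mulrBr.
  rewrite ge0_integralZl//; last exact: measurable_EFin_normB.
  have d1 : (`|c|%:E * (e / (`|c| + 1))%:E < e%:E)%E.
    by rewrite -EFinM lte_fin mulrA ltr_pdivrMr ?ltr_wpDl// mulrC ltr_pM2l// ltrDl.
  by apply: le_lt_trans d1; apply: lee_wpmul2l => //; exact: ltW.
have [h [hi _ /fine_cvgP[[k0 _ fk] /cvgrPdist_lt hf]]] := approximation_sfun_integrable mQ intf.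
move=> e e0; have e20 : 0 < e / 2 by rewrite divr_gt0.
have [k1 _ k1e] := hf _ e20.
pose k := maxn k0 k1.
have kfin := fk k (leq_maxl _ _); have /= := k1e k (leq_maxr _ _).
rewrite sub0r normrN ger0_norm ?fine_ge0 ?integral_ge0// => ke.
have mh : measurable_fun setT (h k) by [].
have [g cg hg] : exists2 g, continuous g & (L1dist Q (h k) g < (e / 2)%:E)%E.
  suff : continuous_approx Q (h k) by exact.
  have -> : (h k : 'rV[R]_n -> R) = fun x => \sum_(r <- finmap.enum_fset (fset_set (range (h k)))) r * \1_(h k @^-1` [set r]) x.
    by apply/funext => x; rewrite fimfunE fsbig_finite.
  elim: (finmap.enum_fset _) => [|r s IHs].
    under eq_fun do rewrite big_nil.
    move=> d d0; exists (fun=> 0) => //.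
    by rewrite /L1dist (eq_integral (cst 0%E)) ?integral0// => x _; rewrite subrr normr0.
  under eq_fun do rewrite big_cons.
  apply: approxD => //.
  - by apply: measurable_funM => //; exact: measurable_indic.
  - apply: measurable_sum => r'; by apply: measurable_funM => //; exact: measurable_indic.
  - exact: approxZ.
exists g => //; apply: le_lt_trans (L1dist_triangle mQ mf mh (continuous_measurable_rV cg)) _.
rewrite [e]splitr EFinD lteD//.
by rewrite -[X in (X < _)%E](fineK kfin) lte_fin.
Qed.

End L1_density.

(** * Gradients *)

Section dotv_theory.
Context (R : realType) (n : nat).
Implicit Types v w g : 'rV[R]_n.

Lemma dotvC v w : dotv v w = dotv w v.
Proof. by apply: eq_bigr => i _; rewrite mulrC. Qed.

Lemma dotvDr g v w : dotv g (v + w) = dotv g v + dotv g w.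
Proof. by rewrite /dotv -big_split; apply: eq_bigr => i _; rewrite mxE mulrDr. Qed.

Lemma dotvDl g v w : dotv (v + w) g = dotv v g + dotv w g.
Proof. by rewrite dotvC dotvDr !(dotvC g). Qed.

Lemma dotvZr g a v : dotv g (a *: v) = a * dotv g v.
Proof. by rewrite /dotv mulr_sumr; apply: eq_bigr => i _; rewrite mxE mulrCA. Qed.

Lemma dotvZl g a v : dotv (a *: v) g = a * dotv v g.
Proof. by rewrite dotvC dotvZr dotvC. Qed.

Lemma dotvNr g v : dotv g (- v) = - dotv g v.
Proof. by rewrite -scaleN1r dotvZr mulN1r. Qed.

Lemma dotv0r g : dotv g 0 = 0.
Proof. by rewrite -(scale0r 0) dotvZr mul0r. Qed.

Lemma dotv_delta g i : dotv g (delta_mx 0 i) = g 0 i.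
Proof.
rewrite /dotv (bigD1 i)//= mxE !eqxx mulr1 big1 ?addr0// => j ji.
by rewrite mxE eqxx (negbTE ji) mulr0.
Qed.

Lemma dotv_le v w : `|dotv v w| <= n%:R * (`|v| * `|w|).
Proof.
rewrite (le_trans (ler_norm_sum _ _ _))// -[X in X%:R]card_ord.
rewrite mulr_natl -sumr_const ler_sum// => i _.
by rewrite normrM ler_pM// coord_le_norm.
Qed.

Lemma dotv_ge0 v : 0 <= dotv v v.
Proof. by apply: sumr_ge0 => i _; rewrite -expr2 sqr_ge0. Qed.

Lemma normsq_le_dotv v : `|v| ^+ 2 <= dotv v v.
Proof.
rewrite -(@sqr_sqrtr _ (dotv v v)) ?dotv_ge0// ler_pXn2r ?nnegrE ?sqrtr_ge0//.
apply: norm_rV_le => [|i]; first exact: sqrtr_ge0.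
rewrite -sqrtr_sqr ler_wsqrtr// /dotv (bigD1 i)//= -expr2 lerDl.
by apply: sumr_ge0 => j _; rewrite -expr2 sqr_ge0.
Qed.

Lemma continuous_dotv : continuous (fun x : 'rV[R]_n => dotv x x : R).
Proof.
apply: continuous_big => [x|i _ x]; first exact: add_continuous.
by apply: continuousM; exact: coord_continuous.
Qed.

Lemma dotv_is_linear g : linear (dotv g : 'rV[R]_n -> R^o).
Proof. by move=> a v w; rewrite dotvDr dotvZr. Qed.

HB.instance Definition _ g :=
  GRing.isLinear.Build R 'rV[R]_n R^o _ (dotv g : 'rV[R]_n -> R^o) (dotv_is_linear g).

End dotv_theory.

Section gradient.
Context (R : realType) (n : nat).
Implicit Types (f : 'rV[R]_n -> R) (x v g : 'rV[R]_n).

Lemma dotv_continuous g : continuous (dotv g : 'rV[R]_n -> R).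
Proof.
apply: continuous_big => [x|i _ x]; first exact: add_continuous.
by apply: continuousM; [exact: cst_continuous|exact: coord_continuous].
Qed.

(** The common differentiability criterion for bumps, shifted kernels and convolutions. A quadratic
    remainder passes through an integral, so it replaces differentiation under the integral sign. *)
Lemma differentiable_quadratic f x g C :
  (forall h, `|h| <= 1 -> `|f (x + h) - f x - dotv g h| <= C * `|h| ^+ 2) ->
  differentiable f x /\ grad f x = g.
Proof.
move=> fC.
have near0 (d : R) : 0 < d -> \forall h \near (0 : 'rV[R]_n), `|h| <= d.
  by move=> d0; apply: nbhs0_le.
have Cf : f \o shift x = cst (f x) + dotv g +o_ (0 : 'rV[R]_n) id.
  apply/eqaddoP => e e0; near=> h.
  have h1 : `|h| <= 1 by near: h; exact: near0.
  have := fC _ h1; move=> fh.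
  rewrite !fctE /= (addrC h x) opprD addrA (le_trans fh)// expr2 mulrA ler_wpM2r//.
  rewrite (@le_trans _ _ ((`|C| + 1) * `|h|))// ?ler_wpM2r ?(le_trans (ler_norm C)) ?lerDl//.
  by rewrite -ler_pdivlMl ?ltr_wpDl//; near: h; apply: near0; rewrite mulr_gt0 ?invr_gt0 ?ltr_wpDl.
have dg : 'd f x = dotv g :> ('rV[R]_n -> R^o).
  by apply: diff_unique Cf; exact: dotv_continuous.
have df : differentiable f x.
  by apply/diff_locallyP; rewrite dg; split => //; exact: dotv_continuous.
split => //; apply/rowP => i; rewrite mxE deriveE// dg dotv_delta.
by [].
Unshelve. all: by end_near. Qed.

Lemma derive_grad f x v : differentiable f x -> 'D_v f x = dotv (grad f x) v.
Proof.
move=> df; rewrite deriveE// [in LHS](row_sum_delta v) linear_sum/=.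
by apply: eq_bigr => i _; rewrite linearZ/= mxE deriveE// mulrC.
Qed.

Lemma grad_eq f x g : differentiable f x -> (forall v, 'd f x v = dotv g v) ->
  grad f x = g.
Proof. by move=> df dg; apply/rowP => i; rewrite mxE deriveE// dg dotv_delta. Qed.

Lemma diff_grad f x v : differentiable f x -> 'd f x v = dotv (grad f x) v.
Proof. by move=> df; rewrite -derive_grad// deriveE. Qed.

Lemma continuous_gradP f x : {for x, continuous (grad f)} <->
  (forall i, {for x, continuous (fun y => grad f y 0 i)}).
Proof.
split=> [cf i|cf].
  exact: (continuous_comp cf (@coord_continuous _ _ _ _ _ _)).
have nF : Filter (nbhs x) := nbhs_filter x.
apply/cvgrPdist_lt => e e0.
have : \forall y \near x, forall i, `|grad f x 0 i - grad f y 0 i| < e.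
  apply: (filter_forall (f := fun i y => `|grad f x 0 i - grad f y 0 i| < e) nF) => i.
  by have /cvgrPdist_lt/(_ e e0) := cf i.
apply: filterS => y fy; apply: norm_rV_lt => // i.
by have := fy i; rewrite !mxE.
Qed.

Lemma grad_comp f (F F' : R -> R) x : differentiable f x ->
  (forall t : R, is_derive t 1 F (F' t)) ->
  differentiable (F \o f) x /\ grad (F \o f) x = F' (f x) *: grad f x.
Proof.
move=> df dF.
have dFx : differentiable F (f x) by apply/derivable1_diffP; exact: ex_derive.
have dFf : differentiable (F \o f) x by exact: differentiable_comp.
split => //; apply: grad_eq => // v.
rewrite diff_comp//= diff_grad// dotvZl.
rewrite -[X in 'd F _ X]mulr1 -[X in 'd F _ X]/(_ *: (1 : R^o)) linearZ/=.
by rewrite -deriveE// derive_val /= mulrC.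
Qed.

Lemma gradM f1 f2 x : differentiable f1 x -> differentiable f2 x ->
  differentiable (fun y => f1 y * f2 y) x /\
  grad (fun y => f1 y * f2 y) x = f2 x *: grad f1 x + f1 x *: grad f2 x.
Proof.
move=> d1 d2; have d12 := differentiableM d1 d2; split => //.
apply: grad_eq => // v.
rewrite (@diffM _ _ f1 f2 x d1 d2) /= dotvDl !dotvZl addrC.
by congr (_ + _); rewrite -diff_grad.
Qed.

Lemma C1P f : C1_on setT f <->
  (forall x, differentiable f x) /\ (forall i, continuous (fun x => grad f x 0 i)).
Proof.
split=> [Cf|[df cf] x _].
  split=> [x|i x]; first by have [] := Cf x I.
  by have [_ /continuous_gradP] := Cf x I; exact.
by split; [exact: df|apply/continuous_gradP => i; exact: cf].
Qed.

Lemma C1_continuous f : C1_on setT f -> continuous f.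
Proof. by move=> /C1P[df _] x; exact: differentiable_continuous. Qed.

Lemma C1_comp f (F F' : R -> R) : C1_on setT f -> continuous F' ->
  (forall t : R, is_derive t 1 F (F' t)) -> C1_on setT (F \o f).
Proof.
move=> Cf cF' dF; have /C1P[df cgf] := Cf; apply/C1P; split => [x|i].
  by have [] := grad_comp (df x) dF.
rewrite (_ : (fun x => _) = (fun y => F' (f y) * grad f y 0 i)).
  move=> x; apply: continuousM; last exact: cgf.
  by apply: continuous_comp; [exact: differentiable_continuous|exact: cF'].
by apply/funext => y; have [_ ->] := grad_comp (df y) dF; rewrite mxE.
Qed.

Lemma C1M f1 f2 : C1_on setT f1 -> C1_on setT f2 -> C1_on setT (fun y => f1 y * f2 y).
Proof.
move=> C1 C2; have cf1 := C1_continuous C1; have cf2 := C1_continuous C2.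
have /C1P[d1 c1] := C1; have /C1P[d2 c2] := C2; apply/C1P; split => [x|i].
  by have [] := gradM (d1 x) (d2 x).
rewrite (_ : (fun x => _) = (fun y => f2 y * grad f1 y 0 i + f1 y * grad f2 y 0 i)).
  move=> x; exact: (continuousD (continuousM (cf2 x) (c1 i x)) (continuousM (cf1 x) (c2 i x))).
by apply/funext => y; have [_ ->] := gradM (d1 y) (d2 y); rewrite !mxE.
Qed.

End gradient.

(** * Quadratic bumps and their second-order expansion *)

Section bump.
Context (R : realType) (n : nat).
Implicit Types (x y h : 'rV[R]_n) (a b c : R).

Definition posp (s : R) : R := Num.max 0 s.

Lemma posp_ge0 s : 0 <= posp s. Proof. by rewrite le_max lexx. Qed.

Lemma ge0_posp s : 0 <= s -> posp s = s. Proof. by move=> s0; apply/max_idPr. Qed.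

Lemma le0_posp s : s <= 0 -> posp s = 0. Proof. by move=> s0; apply/max_idPl. Qed.

Lemma continuous_posp (T : topologicalType) (f : T -> R) : continuous f ->
  continuous (fun z => posp (f z)).
Proof.
move=> cf x; have c0 : {for x, continuous (fun=> 0 : R)} by exact: cst_continuous.
exact: (continuous_max c0 (cf x)).
Qed.

(** The squared positive part has the Lipschitz derivative [2 * posp s]; the four sign patterns of s
    and s + t give a remainder with constant 1. *)
Lemma posp_sqr_taylor s t :
  `|posp (s + t) ^+ 2 - posp s ^+ 2 - 2 * posp s * t| <= t ^+ 2.
Proof.
have [s0|s0] := leP 0 s; have [t0|t0] := leP 0 (s + t).
- by rewrite !ge0_posp// (_ : _ - _ = t ^+ 2) ?ger0_norm ?sqr_ge0//; ring.
- rewrite (ge0_posp s0) (le0_posp (ltW t0)) ler_norml; apply/andP; split; nra.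
- rewrite (ge0_posp t0) (le0_posp (ltW s0)) ler_norml; apply/andP; split; nra.
- by rewrite (le0_posp (ltW s0)) (le0_posp (ltW t0)) expr0n/= mulr0 mul0r !subr0 normr0 sqr_ge0.
Qed.

(* A compactly supported function of class C^1 whose gradient is explicit: there
   is no need for smooth mollifiers. *)
Definition bump a b x := posp (a - b * dotv x x) ^+ 2.

Definition bump_grad a b x : 'rV[R]_n := - (4 * b * posp (a - b * dotv x x)) *: x.

Lemma bump_ge0 a b x : 0 <= bump a b x. Proof. exact: sqr_ge0. Qed.

Lemma continuous_bump_base a b : continuous (fun x => posp (a - b * dotv x x)).
Proof.
apply: continuous_posp => x.
have cc (c : R) : {for x, continuous (fun=> c)} by exact: cst_continuous.
exact: (continuousB (cc a) (continuousM (cc b) (@continuous_dotv R n x))).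
Qed.

Lemma continuous_bump a b : continuous (bump a b).
Proof.
move=> x; exact: (continuousM (@continuous_bump_base a b x) (@continuous_bump_base a b x)).
Qed.

Lemma bump_taylor a b r : exists2 C, 0 <= C & forall x h, `|x| <= r -> `|h| <= 1 ->
  `|bump a b (x + h) - bump a b x - dotv (bump_grad a b x) h| <= C * `|h| ^+ 2.
Proof.
pose m : R := n%:R; pose B : R := `|a| + `|b| * (m * r ^+ 2).
have m0 : 0 <= m by rewrite ler0n.
have B0 : 0 <= B by rewrite addr_ge0// mulr_ge0// mulr_ge0// sqr_ge0.
(* The increment of a - b |x|^2 is t = - b (2 x.h + |h|^2). The second summand bounds t^2, using |h|
   <= 1; the first bounds the quadratic part of t, multiplied by 2 [posp s] <= 2 B. The factor m
   comes from comparing the dot product with the sup norm. *)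
exists (2 * B * (`|b| * m) + (`|b| * (2 * (m * `|r|) + m)) ^+ 2).
  by rewrite addr_ge0 ?sqr_ge0// !mulr_ge0.
move=> x h xr h1.
have x0 : 0 <= `|x| by []. have h0 : 0 <= `|h| by [].
pose s := a - b * dotv x x; pose t := - b * (2 * dotv x h + dotv h h).
have -> : bump a b (x + h) = posp (s + t) ^+ 2.
  rewrite /bump /s /t; congr (posp _ ^+ 2).
  by rewrite !dotvDr !dotvDl (dotvC h x); ring.
have -> : dotv (bump_grad a b x) h = 2 * posp s * t + 2 * posp s * (b * dotv h h).
  by rewrite /bump_grad dotvZl /t -/s; ring.
rewrite -/s /bump -/s opprD addrA (le_trans (ler_normB _ _))// [leRHS]mulrDl [leRHS]addrC lerD//; last first.
  have sB : posp s <= B.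
    rewrite /posp ge_max B0 /=.
    rewrite (le_trans (ler_norm _))// (le_trans (ler_normB _ _))// lerD2l normrM ler_wpM2l//.
    rewrite (le_trans (dotv_le _ _))// ler_wpM2l// expr2 ler_pM//.
  rewrite normrM ger0_norm ?mulr_ge0 ?posp_ge0// -!mulrA ler_wpM2l//.
  rewrite ler_pM ?posp_ge0// normrM ler_wpM2l//.
  by rewrite (le_trans (dotv_le _ _))// expr2.
rewrite (le_trans (posp_sqr_taylor _ _))// -exprMn -(real_normK (num_real t)).
rewrite ler_pXn2r ?nnegrE ?mulr_ge0 ?addr_ge0 ?mulr_ge0//.
have -> : `|t| = `|b| * `|2 * dotv x h + dotv h h| by rewrite /t normrM normrN.
rewrite -mulrA ler_wpM2l// (le_trans (ler_normD _ _))// [leRHS]mulrDl lerD//.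
  rewrite normrM ger0_norm// -!mulrA ler_wpM2l// (le_trans (dotv_le _ _))//.
  by rewrite ler_wpM2l// ler_wpM2r// (le_trans xr)// ler_norm.
by rewrite (le_trans (dotv_le _ _))// ler_wpM2l// ler_piMl.
Qed.

Lemma bump_differentiable a b x : differentiable (bump a b) x /\ grad (bump a b) x = bump_grad a b x.
Proof.
have [C C0 bC] := bump_taylor a b `|x|.
by apply: (differentiable_quadratic (C := C)) => h h1; exact: bC.
Qed.

Lemma continuous_bump_grad a b i : continuous (fun x => bump_grad a b x 0 i).
Proof.
rewrite (_ : (fun _ => _) = fun x => - (4 * b * posp (a - b * dotv x x)) * x 0 i); last first.
  by apply/funext => x; rewrite mxE.
move=> x.
have cc (c : R) : {for x, continuous (fun=> c)} by exact: cst_continuous.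
exact: (continuousM (continuousN (continuousM (cc _) (@continuous_bump_base a b x)))
  (@coord_continuous _ _ _ 0 i x)).
Qed.

Lemma bump_C1 a b : C1_on setT (bump a b).
Proof.
apply/C1P; split => [x|i]; first by have [] := bump_differentiable a b x.
rewrite (_ : (fun _ => _) = fun x => bump_grad a b x 0 i); first exact: continuous_bump_grad.
by apply/funext => x; have [_ ->] := bump_differentiable a b x.
Qed.

Lemma bump_eq0 a b x : 0 < b -> a <= b * `|x| ^+ 2 ->
  posp (a - b * dotv x x) = 0.
Proof.
move=> b0 ax; apply: le0_posp; rewrite subr_le0 (le_trans ax)//.
by rewrite ler_pM2l// normsq_le_dotv.
Qed.

End bump.

(** * Mollification *)

Section locally_integrable.
Context (R : realType) (n : nat).
Local Notation mu := (lebesgue_rV R n).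
Implicit Types (f g h : 'rV[R]_n -> R) (x y z : 'rV[R]_n).

Lemma Rintegral_sum_ord (m : nat) (h : 'I_m -> 'rV[R]_n -> R) :
  (forall i, mu.-integrable setT (EFin \o h i)) ->
  \int[mu]_x (\sum_(i < m) h i x) = \sum_(i < m) \int[mu]_x h i x.
Proof.
elim: m h => [|m IHm] h hi.
  by rewrite big_ord0; under eq_Rintegral do rewrite big_ord0; rewrite Rintegral_cst// mul0r.
rewrite big_ord_recr/= -IHm; last by move=> i; exact: hi.
rewrite -RintegralD//; first by apply: eq_Rintegral => x _; rewrite big_ord_recr.
have -> : EFin \o (fun x => \sum_(i < m) h (widen_ord (leqnSn m) i) x) =
  (fun x => \sum_(i < m) (h (widen_ord (leqnSn m) i) x)%:E)%E.
  by apply/funext => x /=; rewrite sumEFin.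
by apply: integrable_sum => // i _; exact: hi.
Qed.

Lemma continuous_subl g x : continuous g -> continuous (fun y => g (x - y)).
Proof.
move=> cg y; apply: (@continuous_comp _ _ _ (fun y => x - y) g); last exact: cg.
by apply: continuousB; [exact: cst_continuous|exact: cvg_id].
Qed.

Definition loc_integrable f := measurable_fun setT f /\
  forall r, mu.-integrable (cube n r) (EFin \o f).

Lemma continuous_loc_integrable f : continuous f -> loc_integrable f.
Proof.
move=> cf; have mf := continuous_measurable_rV cf; split => // r.
have /compact_bounded[M [_ KM]] : compact (f @` cube n r).
  apply: continuous_compact; last exact: compact_cube.
  by apply: continuous_subspaceT.
apply: (@le_integrable _ _ _ _ _ _ _ (cst (`|M| + 1)%:E)).
- exact: measurable_cube.
- by apply/measurable_EFinP; exact: measurable_funTS.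
- move=> x Qx /=; rewrite lee_fin [leRHS]ger0_norm ?addr_ge0//.
  apply: KM; last by exists x.
  by rewrite (le_lt_trans (ler_norm M))// ltrDl.
- by apply: integrable_cst_lty; [exact: measurable_cube|exact: lebesgue_rV_cube_fin].
Qed.

Lemma loc_integrableB f g : loc_integrable f -> loc_integrable g ->
  loc_integrable (fun x => f x - g x).
Proof.
move=> [mf fi] [mg gi]; split; first exact: measurable_funB.
move=> r; have := integrableB (measurable_cube n r) (fi r) (gi r).
by apply: eq_integrable; [exact: measurable_cube|].
Qed.

Lemma loc_integrable_norm f : loc_integrable f -> loc_integrable (fun x => `|f x|).
Proof.
move=> [mf fi]; split; first exact: measurableT_comp.
by move=> r; apply: integrable_norm => //; exact: fi.
Qed.

Lemma integrable_cutoff f g r M : loc_integrable f -> measurable_fun setT g ->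
  (forall x, `|g x| <= M) -> (forall x, ~ cube n r x -> g x = 0) ->
  mu.-integrable setT (EFin \o (fun x => g x * f x)).
Proof.
move=> [mf fi] mg gM g0.
have mQ := measurable_cube n r.
have : mu.-integrable setT ((fun x => M%:E * (f x)%:E)%E \_ (cube n r)).
  by apply/(integrable_mkcond _ mQ); apply: integrableZl => //; exact: fi.
apply: le_integrable => //.
  by apply/measurable_EFinP; exact: measurable_funM.
move=> x _ /=; rewrite patchE; case: ifPn => [_|/negP xQ].
  by rewrite -EFinM !lee_fin !normrM ler_wpM2r// (le_trans (gM x))// ler_norm.
by rewrite g0 ?mul0r// => Qx; apply: xQ; rewrite inE.
Qed.

Lemma integrable_bounded_cutoff g r M : measurable_fun setT g ->
  (forall x, `|g x| <= M) -> (forall x, ~ cube n r x -> g x = 0) ->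
  mu.-integrable setT (EFin \o g).
Proof.
move=> mg gM g0.
rewrite (_ : g = fun x => g x * cst 1 x); last by apply/funext => x; rewrite mulr1.
by apply: (integrable_cutoff _ mg gM g0); apply: continuous_loc_integrable; exact: cst_continuous.
Qed.

End locally_integrable.

Section mollifier.
Context (R : realType) (n : nat).
Local Notation mu := (lebesgue_rV R n).
Implicit Types (f g h : 'rV[R]_n -> R) (x y z : 'rV[R]_n) (e : R).

Definition moll_mass e := \int[mu]_y bump (e ^+ 2) 1 y.

Definition moll e x := (moll_mass e)^-1 * bump (e ^+ 2) 1 x.

Lemma bumpN a b x : bump a b (- x) = bump a b x.
Proof. by rewrite /bump dotvNr dotvC dotvNr opprK. Qed.

Lemma bump_out e x : 0 <= e -> ~ cube n e x -> posp (e ^+ 2 - 1 * dotv x x) = 0.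
Proof.
move=> e0 /negP; rewrite -ltNge => ex; apply: bump_eq0 => //.
by rewrite mul1r ler_pXn2r ?nnegrE// ltW.
Qed.

Lemma bump_le e x : bump (e ^+ 2) 1 x <= (e ^+ 2) ^+ 2.
Proof.
rewrite /bump ler_pXn2r ?nnegrE ?posp_ge0 ?sqr_ge0//.
by rewrite /posp ge_max sqr_ge0/= mul1r gerBl dotv_ge0.
Qed.

Lemma measurable_bump a b : measurable_fun setT (@bump R n a b).
Proof. by apply: continuous_measurable_rV; exact: continuous_bump. Qed.

Lemma integrable_bump e : 0 <= e -> mu.-integrable setT (EFin \o bump (e ^+ 2) 1).
Proof.
move=> e0; apply: (@integrable_bounded_cutoff _ _ _ e ((e ^+ 2) ^+ 2)).
- exact: measurable_bump.
- by move=> x; rewrite ger0_norm ?bump_ge0// bump_le.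
- by move=> x xe; rewrite /bump bump_out// expr0n.
Qed.

Lemma moll_mass_gt0 e : 0 < e -> 0 < moll_mass e.
Proof.
move=> e0; pose m : R := n%:R + 1.
have m0 : 0 < m by rewrite ltr_wpDl.
have m1 : 1 <= m by rewrite lerDr.
(* On this small cube |x|^2 <= n r^2 <= e^2 / 2 in the Euclidean norm, so the bump is at least (e^2
   / 2)^2 there. Taking m = n + 1 keeps the division meaningful for n = 0. *)
pose r := e / (2 * m).
have r0 : 0 < r by rewrite divr_gt0// mulr_gt0.
have mQ := measurable_cube n r.
have bQ x : cube n r x -> (e ^+ 2 / 2) ^+ 2 <= bump (e ^+ 2) 1 x.
  move=> xr; rewrite /bump ler_pXn2r ?nnegrE ?posp_ge0 ?divr_ge0 ?sqr_ge0//.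
  rewrite /posp le_max; apply/orP; right; rewrite mul1r.
  have : dotv x x <= n%:R * (r * r).
    by rewrite (le_trans (ler_norm _))// (le_trans (dotv_le _ _))// ler_wpM2l// ler_pM.
  have : n%:R * (r * r) <= e ^+ 2 / 2.
    have rr : 0 <= r * r by rewrite mulr_ge0// ltW.
    have : n%:R * (r * r) <= m * (r * r) by rewrite ler_wpM2r// lerDl.
    move/le_trans; apply.
    rewrite /r (_ : m * _ = e ^+ 2 / (4 * m)); last by field; rewrite gt_eqF.
    rewrite ler_wpM2l ?sqr_ge0// lef_pV2 ?posrE ?mulr_gt0//; lra.
  lra.
have : \int[mu]_x ((e ^+ 2 / 2) ^+ 2 * \1_(cube n r) x) <= moll_mass e.
  apply: le_Rintegral => //; last 2 first.
  - exact/integrable_bump/ltW.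
  - move=> x _; rewrite indicE; case: (boolP (x \in _)) => [/set_mem/bQ|_].
      by rewrite mulr1.
    by rewrite mulr0 bump_ge0.
  apply: (@integrable_bounded_cutoff _ _ _ r ((e ^+ 2 / 2) ^+ 2)).
  - by apply: measurable_funM => //; exact: measurable_indic.
  - move=> x; rewrite indicE; case: (_ \in _); last by rewrite mulr0 normr0 sqr_ge0.
    by rewrite mulr1 ger0_norm ?sqr_ge0.
  - by move=> x xr; rewrite indicE memNset// mulr0.
apply: lt_le_trans; rewrite RintegralZl//; last first.
  apply: (@integrable_bounded_cutoff _ _ _ r 1).
  - exact: measurable_indic.
  - by move=> x; rewrite indicE; case: (_ \in _); rewrite ?normr1 ?normr0.
  - by move=> x xr; rewrite indicE memNset.
rewrite /Rintegral (_ : (\int[mu]_x _)%E = ((2 * r) ^+ n)%:E) /=; last first.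
  by rewrite integral_indic// setIT; apply: lebesgue_rV_cube; exact: ltW.
by rewrite !mulr_gt0// ?divr_gt0// exprn_gt0// mulr_gt0.
Qed.

Lemma moll_ge0 e x : 0 < e -> 0 <= moll e x.
Proof. by move=> e0; rewrite mulr_ge0 ?bump_ge0// invr_ge0 ltW// moll_mass_gt0. Qed.

Lemma mollN e x : moll e (- x) = moll e x.
Proof. by rewrite /moll bumpN. Qed.

Lemma moll_out e x : 0 <= e -> ~ cube n e x -> moll e x = 0.
Proof. by move=> e0 ex; rewrite /moll /bump bump_out// expr0n mulr0. Qed.

Lemma continuous_moll e : continuous (moll e).
Proof.
move=> x; have cc (c : R) : {for x, continuous (fun=> c)} by exact: cst_continuous.
exact: (continuousM (cc _) (@continuous_bump R n _ _ x)).
Qed.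

Lemma moll_bound e : 0 < e -> exists2 M, 0 <= M & forall x, `|moll e x| <= M.
Proof.
move=> e0; exists ((moll_mass e)^-1 * (e ^+ 2) ^+ 2).
  by rewrite mulr_ge0 ?sqr_ge0// invr_ge0 ltW// moll_mass_gt0.
move=> x; rewrite ger0_norm ?moll_ge0//.
by rewrite ler_wpM2l ?bump_le// invr_ge0 ltW// moll_mass_gt0.
Qed.

Lemma measurable_moll_shift e x : measurable_fun setT (fun y => moll e (x - y)).
Proof.
by apply: continuous_measurable_rV; apply: continuous_subl; exact: continuous_moll.
Qed.

Lemma moll_shift_out e x y r : 0 <= e -> `|x| <= r -> ~ cube n (r + e) y ->
  moll e (x - y) = 0.
Proof.
move=> e0 xr yr; apply: moll_out => // xye; apply: yr.
rewrite /cube/= -[y](subKr x) (le_trans (ler_normB _ _))// lerD//.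
Qed.

Lemma integrable_moll_shift e x : 0 < e ->
  mu.-integrable setT (EFin \o (fun y => moll e (x - y))).
Proof.
move=> e0; have [M M0 eM] := moll_bound e0.
apply: (@integrable_bounded_cutoff _ _ _ (`|x| + e) M) => //.
- exact: measurable_moll_shift.
- by move=> y; apply: moll_shift_out => //; exact: ltW.
Qed.

(** Symmetry of the kernel turns the shift into a translation, which preserves the integral. The
    extended-real form is the one used after exchanging integrals. *)
Lemma integral_moll_shift e x : 0 < e ->
  (\int[mu]_y (moll e (x - y))%:E)%E = 1%E.
Proof.
move=> e0; have m0 := moll_mass_gt0 e0.
under eq_integral do rewrite -mollN opprB.
rewrite (@ge0_lebesgue_rV_integral_translation _ _ (- x) (fun y => (moll e y)%:E)); last 2 first.
- by apply/measurable_EFinP; apply: continuous_measurable_rV; exact: continuous_moll.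
- by move=> y; rewrite lee_fin moll_ge0.
rewrite -[LHS]fineK; last first.
  apply: integrable_fin_num => //; have := integrable_moll_shift 0 e0.
  by apply: eq_integrable => // y _ /=; rewrite sub0r mollN.
rewrite -[X in X%:E]/(\int[mu]_y (moll e y)) /moll RintegralZl//.
  by rewrite mulVf// gt_eqF.
by apply: integrable_bump; exact: ltW.
Qed.

Lemma Rintegral_moll_shift e x : 0 < e -> \int[mu]_y (moll e (x - y)) = 1.
Proof. by move=> e0; rewrite /Rintegral integral_moll_shift. Qed.

Definition conv e f x := \int[mu]_y (moll e (x - y) * f y).

Lemma integrable_conv e f x : 0 < e -> loc_integrable f ->
  mu.-integrable setT (EFin \o (fun y => moll e (x - y) * f y)).
Proof.
move=> e0 fi; have [M M0 eM] := moll_bound e0.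
apply: (@integrable_cutoff _ _ _ _ (`|x| + e) M) => //.
- exact: measurable_moll_shift.
- by move=> y; apply: moll_shift_out => //; exact: ltW.
Qed.

Lemma convB e f g x : 0 < e -> loc_integrable f -> loc_integrable g ->
  conv e (fun y => f y - g y) x = conv e f x - conv e g x.
Proof.
move=> e0 fi gi; rewrite /conv -RintegralB//; try exact: integrable_conv.
by under eq_Rintegral do rewrite mulrBr.
Qed.

Lemma ler_norm_conv e f x : 0 < e -> loc_integrable f ->
  `|conv e f x| <= conv e (fun y => `|f y|) x.
Proof.
move=> e0 fi; rewrite (le_trans (le_normr_Rintegral _ _))//; first exact: integrable_conv.
by rewrite le_eqVlt; apply/orP; left; apply/eqP; apply: eq_Rintegral => y _;
  rewrite normrM (ger0_norm (moll_ge0 _ _)).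
Qed.

End mollifier.

Section mollification.
Context (R : realType) (n : nat).
Local Notation mu := (lebesgue_rV R n).
Implicit Types (f g u : 'rV[R]_n -> R) (x y z : 'rV[R]_n) (e : R).

Definition moll_grad e z : 'rV[R]_n := (moll_mass n e)^-1 *: bump_grad (e ^+ 2) 1 z.

Lemma moll_grad_out e z : 0 <= e -> ~ cube n e z -> moll_grad e z = 0.
Proof. by move=> e0 ez; rewrite /moll_grad /bump_grad bump_out// mulr0 oppr0 scale0r scaler0. Qed.

Lemma continuous_moll_grad e i : continuous (fun z => moll_grad e z 0 i).
Proof.
rewrite (_ : (fun _ => _) = fun z => (moll_mass n e)^-1 * bump_grad (e ^+ 2) 1 z 0 i); last first.
  by apply/funext => z; rewrite mxE.
move=> z; have cc (c : R) : {for z, continuous (fun=> c)} by exact: cst_continuous.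
exact: (continuousM (cc _) (@continuous_bump_grad R n _ _ i z)).
Qed.

Lemma moll_grad_bound e i : 0 < e -> exists2 M, 0 <= M & forall z, `|moll_grad e z 0 i| <= M.
Proof.
move=> e0; have m0 := moll_mass_gt0 n e0.
have M0 : 0 <= (moll_mass n e)^-1 * (4 * e ^+ 2 * e).
  by rewrite !mulr_ge0// ?invr_ge0 ?(ltW m0) ?(ltW e0).
exists ((moll_mass n e)^-1 * (4 * e ^+ 2 * e)) => //.
move=> z; have [ez|ez] := pselect (cube n e z); last first.
  by rewrite moll_grad_out ?(ltW e0)// mxE normr0.
rewrite !mxE normrM ger0_norm ?invr_ge0 ?(ltW m0)// ler_wpM2l ?invr_ge0 ?(ltW m0)//.
rewrite normrM normrN ler_pM//; last exact: le_trans (coord_le_norm _ _) ez.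
rewrite mulr1 normrM ger0_norm// ler_wpM2l// ger0_norm ?posp_ge0//.
by rewrite /posp ge_max sqr_ge0/= mul1r gerBl dotv_ge0.
Qed.

Lemma moll_taylor e r : 0 < e -> exists2 C, 0 <= C & forall x h, `|x| <= r -> `|h| <= 1 ->
  `|moll e (x + h) - moll e x - dotv (moll_grad e x) h| <= C * `|h| ^+ 2.
Proof.
move=> e0; have m0 := moll_mass_gt0 n e0.
have [C C0 bC] := bump_taylor n (e ^+ 2) 1 r.
exists ((moll_mass n e)^-1 * C); first by rewrite mulr_ge0// invr_ge0 ltW.
move=> x h xr h1; rewrite /moll /moll_grad dotvZl -!mulrBr normrM.
by rewrite ger0_norm ?invr_ge0 ?(ltW m0)// -mulrA ler_wpM2l ?invr_ge0 ?(ltW m0)// bC.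
Qed.

Lemma integrable_moll_grad e f x i : 0 < e -> loc_integrable f ->
  mu.-integrable setT (EFin \o (fun y => moll_grad e (x - y) 0 i * f y)).
Proof.
move=> e0 fi; have [M M0 eM] := moll_grad_bound i e0.
apply: (@integrable_cutoff _ _ _ _ (`|x| + e) M) => //.
- apply: continuous_measurable_rV; apply: (@continuous_subl _ _ (fun z => moll_grad e z 0 i)).
  exact: continuous_moll_grad.
- move=> y yr; rewrite moll_grad_out ?mxE ?(ltW e0)// => xye; apply: yr.
  by rewrite /cube/= -[y](subKr x) (le_trans (ler_normB _ _))// lerD.
Qed.

(** The Taylor remainder of the kernel is integrated against f: it is at most C |h|^2 on a fixed
    cube and zero outside it. *)
Lemma conv_differentiable e f x : 0 < e -> loc_integrable f ->
  differentiable (conv e f) x /\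
  grad (conv e f) x = \row_i \int[mu]_y (moll_grad e (x - y) 0 i * f y).
Proof.
move=> e0 fi; set G := \row_i _.
(* For |h| <= 1 the kernels centred at x and at x + h both vanish outside the cube of radius r1. For
   y in this cube, |x - y| <= |x| + r1, which is the radius required for the Taylor constant. *)
pose r1 := `|x| + 1 + e.
have [C C0 mC] := moll_taylor (`|x| + r1) e0.
have mQ := measurable_cube n r1.
have C1 : mu.-integrable setT (EFin \o (fun y => C * \1_(cube n r1) y * `|f y|)).
  apply: (@integrable_cutoff _ _ _ _ r1 C).
  - exact: loc_integrable_norm.
  - by apply: measurable_funM => //; exact: measurable_indic.
  - move=> y; rewrite indicE; case: (_ \in _); last by rewrite mulr0 normr0.
    by rewrite mulr1 ger0_norm.
  - by move=> y yQ; rewrite indicE memNset// mulr0.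
apply: (@differentiable_quadratic _ _ _ _ _ (\int[mu]_y (C * \1_(cube n r1) y * `|f y|))).
move=> h h1.
pose k y := moll e (x + h - y) - moll e (x - y) - dotv (moll_grad e (x - y)) h.
have ci z := integrable_conv z e0 fi.
have di : mu.-integrable setT (EFin \o (fun y => dotv (moll_grad e (x - y)) h * f y)).
  have := @integrable_sum _ _ _ mu setT measurableT _ (index_enum 'I_n) xpredT
    (fun i y => (h 0 i * (moll_grad e (x - y) 0 i * f y))%:E).
  have : forall i, mu.-integrable setT (fun y => (h 0 i * (moll_grad e (x - y) 0 i * f y))%:E).
    by move=> i; have := integrableZl measurableT (h 0 i) (integrable_moll_grad x i e0 fi).
  move=> hi /(_ (fun i _ => hi i)); apply: eq_integrable => // y _.
  rewrite sumEFin /= /dotv mulr_suml; congr EFin; apply: eq_bigr => i _.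
  by rewrite mulrCA mulrA.
have -> : dotv G h = \int[mu]_y (dotv (moll_grad e (x - y)) h * f y).
  rewrite /dotv.
  transitivity (\int[mu]_y (\sum_(i < n) (h 0 i * (moll_grad e (x - y) 0 i * f y)))).
    rewrite Rintegral_sum_ord; last first.
      by move=> i; have := integrableZl measurableT (h 0 i) (integrable_moll_grad x i e0 fi).
    apply: eq_bigr => i _; rewrite RintegralZl//; last exact: integrable_moll_grad.
    by rewrite mxE mulrC.
  apply: eq_Rintegral => y _; rewrite mulr_suml; apply: eq_bigr => i _.
  by rewrite mulrCA mulrA.
have -> : conv e f (x + h) - conv e f x - \int[mu]_y (dotv (moll_grad e (x - y)) h * f y)
    = \int[mu]_y (k y * f y).
  rewrite /conv -RintegralB// -RintegralB//; last first.
    by have := integrableB measurableT (ci (x + h)) (ci x).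
  by apply: eq_Rintegral => y _; rewrite /k; ring.
have ki : mu.-integrable setT (EFin \o (fun y => k y * f y)).
  have := integrableB measurableT (integrableB measurableT (ci (x + h)) (ci x)) di.
  by apply: eq_integrable => // y _ /=; rewrite -!EFinB /k; congr EFin; ring.
rewrite (le_trans (le_normr_Rintegral _ _))//.
rewrite mulrC -RintegralZl//; apply: le_Rintegral => //.
- exact: integrable_norm.
- by have := integrableZl measurableT (`|h| ^+ 2) C1.
- move=> y _; rewrite normrM mulrA ler_wpM2r// [leRHS]mulrA [_ * C]mulrC.
  rewrite indicE; case: (boolP (y \in _)) => [/set_mem yQ|/negP yQ].
    rewrite mulr1 /k (_ : x + h - y = x - y + h); last by rewrite addrAC.
    apply: mC => //.
    by rewrite (le_trans (ler_normB _ _))// lerD2l.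
  have yQ' : ~ cube n r1 y by move=> yQ'; apply: yQ; rewrite inE.
  rewrite mulr0 /k (@moll_shift_out _ _ _ (x + h) y (`|x| + 1)) ?(ltW e0)//; last first.
    by rewrite (le_trans (ler_normD _ _))// lerD2l.
  have yQ2 : ~ cube n (`|x| + e) y by move=> yQ2; apply/yQ'/(cubeS _ yQ2); rewrite /r1; lra.
  rewrite (@moll_shift_out _ _ _ x y `|x|) ?(ltW e0)//.
  rewrite moll_grad_out ?(ltW e0)//; first by rewrite dotvC dotv0r !subr0 normr0.
  move=> xye; apply: yQ2.
  by rewrite /cube/= -[y](subKr x) (le_trans (ler_normB _ _))// lerD.
Qed.

Lemma moll_shift_C1c e x : 0 < e -> C1c (fun y => moll e (x - y)) /\
  forall y, grad (fun y => moll e (x - y)) y = - moll_grad e (x - y).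
Proof.
move=> e0.
have d y : differentiable (fun y => moll e (x - y)) y /\
    grad (fun y => moll e (x - y)) y = - moll_grad e (x - y).
  have [C C0 mC] := moll_taylor `|x - y| e0.
  apply: (@differentiable_quadratic _ _ _ _ _ C) => h h1.
  have := mC (x - y) (- h); rewrite normrN => /(_ (lexx _) h1).
  by rewrite dotvNr (dotvC (- _)) dotvNr (dotvC h) opprD addrA.
split; last by move=> y; have [] := d y.
split.
  apply/C1P; split => [y|i]; first by have [] := d y.
  rewrite (_ : (fun _ => _) = fun y => - moll_grad e (x - y) 0 i); last first.
    by apply/funext => y; have [_ ->] := d y; rewrite mxE.
  have cg := @continuous_subl _ _ (fun z => moll_grad e z 0 i) x (@continuous_moll_grad e i).
  by move=> y; exact: (continuousN (cg y)).
apply: (@subclosed_compact _ _ (cube n (`|x| + e))).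
- exact: closed_closure.
- exact: compact_cube.
- rewrite [X in _ `<=` X]((closure_id _).1 (closed_cube n (`|x| + e))).
  apply: closure_subset => y /eqP h; apply: contrapT => yr; apply: h.
  by apply: moll_shift_out yr => //; exact: ltW.
Qed.

(** The derivative falls on the kernel, and y -> [moll e (x - y)] is an admissible test function.
    Its gradient in y carries a minus sign that cancels the one in the definition of the weak
    gradient. *)
Lemma conv_weak_gradient e u (Du : 'rV[R]_n -> 'rV[R]_n) x : 0 < e -> loc_integrable u ->
  weak_gradient u Du -> grad (conv e u) x = \row_i conv e (fun y => Du y 0 i) x.
Proof.
move=> e0 ui wu; have [_ ->] := conv_differentiable x e0 ui.
apply/rowP => i; rewrite !mxE.
have [phic gphi] := moll_shift_C1c x e0.
have := wu _ i phic; under eq_Rintegral do rewrite gphi mxE.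
have -> : \int[mu]_y (u y * - moll_grad e (x - y) 0 i) =
    - \int[mu]_y (moll_grad e (x - y) 0 i * u y).
  rewrite -mulN1r -RintegralZl//; last exact: integrable_moll_grad.
  by apply: eq_Rintegral => y _; ring.
move=> /oppr_inj ->; apply: eq_Rintegral => y _; exact: mulrC.
Qed.

Lemma continuous_conv e f : 0 < e -> loc_integrable f -> continuous (conv e f).
Proof.
move=> e0 fi x; apply: differentiable_continuous.
by have [] := conv_differentiable x e0 fi.
Qed.

Lemma conv_C1 e u (Du : 'rV[R]_n -> 'rV[R]_n) : 0 < e -> loc_integrable u ->
  (forall i, loc_integrable (fun y => Du y 0 i)) -> weak_gradient u Du ->
  C1_on setT (conv e u).
Proof.
move=> e0 ui Dui wu; apply/C1P; split => [x|i].
  by have [] := conv_differentiable x e0 ui.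
rewrite (_ : (fun _ => _) = conv e (fun y => Du y 0 i)); first exact: continuous_conv.
by apply/funext => x; rewrite (conv_weak_gradient x e0 ui wu) mxE.
Qed.

(** A convolution is an average against a probability density supported within distance e, so almost
    everywhere bounds on the enlarged cube survive. *)
Lemma conv_sup e f x M r : 0 < e -> 0 <= M -> loc_integrable f -> `|x| <= r ->
  {ae mu, forall y, cube n (r + e) y -> `|f y| <= M} -> `|conv e f x| <= M.
Proof.
move=> e0 M0 fi xr fM.
rewrite (le_trans (ler_norm_conv _ _ _))//.
have ci := integrable_conv x e0 (loc_integrable_norm fi).
rewrite -[leRHS]mul1r -(Rintegral_moll_shift x e0) -RintegralZr//; last first.
  exact: integrable_moll_shift.
rewrite /conv /Rintegral fine_le ?integrable_fin_num//.
  by have := integrableZr measurableT M (integrable_moll_shift x e0).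
apply: ae_ge0_le_integral => //.
- by move=> y _; rewrite lee_fin mulr_ge0// moll_ge0.
- by case/integrableP : ci.
- by move=> y _; rewrite lee_fin mulr_ge0// moll_ge0.
- by apply/measurable_EFinP; apply: measurable_funM => //; exact: measurable_moll_shift.
- apply: filterS fM => y fM _; rewrite lee_fin.
  have [yr|yr] := pselect (cube n (r + e) y).
    by rewrite ler_wpM2l ?moll_ge0// fM.
  by rewrite (moll_shift_out _ xr yr) ?(ltW e0)// !mul0r.
Qed.

End mollification.

(** * Convergence of mollifications in L^1 and Jensen's inequality *)

Section mollification_L1.
Context (R : realType) (n : nat).
Local Notation mu := (lebesgue_rV R n).
Implicit Types (f g u : 'rV[R]_n -> R) (x y z : 'rV[R]_n) (e : R).

Lemma measurable_moll_sub e : measurable_fun setT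
  (fun xy : 'rV[R]_n * 'rV[R]_n => moll e (xy.1 - xy.2)).
Proof.
have mm : measurable_fun setT (@moll R n e).
  by apply: continuous_measurable_rV; exact: continuous_moll.
apply: (measurableT_comp mm).
apply: measurable_fun_rVP => i; under eq_fun do rewrite !mxE.
apply: measurable_funB.
- exact: measurableT_comp (measurable_coord_rV i) measurable_fst.
- exact: measurableT_comp (measurable_coord_rV i) measurable_snd.
Qed.

Lemma EFin_conv e f x : 0 < e -> loc_integrable f ->
  (conv e f x)%:E = (\int[mu]_y (moll e (x - y) * f y)%:E)%E.
Proof.
move=> e0 fi; rewrite /conv /Rintegral fineK//.
by apply: integrable_fin_num => //; exact: integrable_conv.
Qed.

(** Tonelli's theorem: for fixed y the kernel has mass at most 1 over x in the small cube, and it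
    vanishes there unless y lies in the enlarged one. The cut-off is written into the integrand so
    that both integrals run over the whole space. *)
Lemma conv_contraction e f r : 0 < e -> loc_integrable f ->
  (\int[mu]_(x in cube n r) `|conv e f x|%:E <=
   \int[mu]_(y in cube n (r + e)) `|f y|%:E)%E.
Proof.
move=> e0 fi; have ni := loc_integrable_norm fi; have [mf _] := fi.
have mQ := measurable_cube n r; have mQ' := measurable_cube n (r + e).
pose F (xy : 'rV[R]_n * 'rV[R]_n) : \bar R :=
  (\1_(cube n r) xy.1 * (moll e (xy.1 - xy.2) * `|f xy.2|))%:E.
have F0 xy : (0 <= F xy)%E by rewrite lee_fin mulr_ge0// mulr_ge0// moll_ge0.
have mF : measurable_fun setT F.
  apply/measurable_EFinP; apply: measurable_funM.
    by apply: measurableT_comp measurable_fst; exact: measurable_indic.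
  apply: measurable_funM; first exact: measurable_moll_sub.
  by apply: measurableT_comp => //; apply: measurableT_comp measurable_snd.
apply: (@le_trans _ _ (\int[mu]_x \int[mu]_y F (x, y)))%E.
  rewrite integral_mkcond; apply: ge0_le_integral => //.
  - by move=> x _; rewrite patchE; case: ifP.
  - apply/(measurable_restrictT _ mQ); apply/measurable_EFinP.
    apply: measurable_funTS; apply: measurableT_comp => //.
    by apply: continuous_measurable_rV; exact: continuous_conv.
  - exact: (@measurable_fun_fubini_tonelli_F _ _ 'rV[R]_n 'rV[R]_n R mu F mF F0).
  - move=> x _; rewrite patchE; case: ifPn => xQ; last by apply: integral_ge0.
    rewrite /F /=.
    under eq_integral do rewrite indicE xQ mul1r.
    by rewrite -EFin_conv// lee_fin ler_norm_conv.
rewrite (@fubini_tonelli _ _ 'rV[R]_n 'rV[R]_n R mu mu F mF F0).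
rewrite [leRHS]integral_mkcond; apply: ge0_le_integral => //.
- by move=> y _; apply: integral_ge0.
- exact: (@measurable_fun_fubini_tonelli_G _ _ 'rV[R]_n 'rV[R]_n R mu F mF F0).
- apply/(measurable_restrictT _ mQ'); apply/measurable_EFinP.
  by apply: measurable_funTS; apply: measurableT_comp.
move=> y _; rewrite patchE; case: ifPn => [yQ|/negP yQ].
  apply: (@le_trans _ _ (\int[mu]_x (`|f y|%:E * (moll e (y - x))%:E)))%E.
    apply: ge0_le_integral => //.
    - by apply: measurableT_comp mF _; exact: measurable_pair2.
    - by apply: measurable_funeM; apply/measurable_EFinP; exact: measurable_moll_shift.
    - move=> x _; rewrite /F/= -EFinM lee_fin -(mollN e (y - x)) opprB mulrC [leRHS]mulrC.
      rewrite indicE; case: (_ \in _); rewrite ?mulr1// mulr0.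
      by rewrite mulr_ge0// moll_ge0.
  rewrite ge0_integralZl//; last 2 first.
  - by apply/measurable_EFinP; exact: measurable_moll_shift.
  - by move=> x _; rewrite lee_fin moll_ge0.
  by rewrite integral_moll_shift// mule1.
rewrite (eq_integral (cst 0%E)) ?integral0// => x _.
rewrite /F/= indicE; case: (boolP (x \in _)) => [/set_mem xr|]; last by rewrite mul0r.
by rewrite (moll_shift_out (ltW e0) xr) ?mul0r ?mulr0// => yr; apply: yQ; rewrite inE.
Qed.

Definition scale (k : nat) : R := k.+1%:R^-1.

Lemma scale_gt0 k : 0 < scale k. Proof. by rewrite invr_gt0. Qed.

Lemma scale_le1 k : scale k <= 1. Proof. by rewrite invf_le1// ler1n. Qed.

Lemma conv_continuous_cvg g x : continuous g -> conv (scale k) g x @[k --> \oo] --> g x.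
Proof.
move=> cg; have gi := continuous_loc_integrable cg.
apply/cvgrPdist_le => d d0.
have /cvgrPdist_le/(_ d d0)/nbhs_ballP[r /= r0 rg] := cg x.
have /ltr_add_invr[k0] : 0 < r by [].
rewrite add0r => k0r; exists k0 => // k /= k0k.
have e0 := scale_gt0 k.
have er : scale k < r.
  by rewrite (le_lt_trans _ k0r)// lef_pV2 ?posrE// ler_nat ltnS.
have -> : g x - conv (scale k) g x = \int[mu]_y (moll (scale k) (x - y) * (g x - g y)).
  have E : g x = \int[mu]_y (moll (scale k) (x - y) * g x).
    rewrite RintegralZr ?Rintegral_moll_shift ?mul1r//; exact: integrable_moll_shift.
  rewrite [X in X - _]E /conv -RintegralB//; last 2 first.
  - by have := integrableZr measurableT (g x) (integrable_moll_shift x e0).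
  - exact: integrable_conv.
  by apply: eq_Rintegral => y _; rewrite mulrBr.
have gxi : loc_integrable (fun y => g x - g y).
  by apply: loc_integrableB => //; apply: continuous_loc_integrable; exact: cst_continuous.
have mi := integrable_conv x e0 gxi.
rewrite (le_trans (le_normr_Rintegral _ _))//.
rewrite -[leRHS]mul1r -(Rintegral_moll_shift x e0) -RintegralZr//; last exact: integrable_moll_shift.
apply: le_Rintegral => //.
- exact: integrable_norm.
- by have := integrableZr measurableT d (integrable_moll_shift x e0).
move=> y _; rewrite normrM (ger0_norm (moll_ge0 _ e0)).
have [xy|xy] := pselect (cube n (scale k) (x - y)); last by rewrite moll_out ?(ltW e0)// !mul0r.
rewrite ler_wpM2l ?moll_ge0//; apply: rg; rewrite -ball_normE /ball_/=.
exact: le_lt_trans xy er.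
Qed.

Lemma L1dist_subset (A B : set 'rV[R]_n) f g : measurable A -> measurable B ->
  measurable_fun setT f -> measurable_fun setT g -> A `<=` B ->
  (L1dist A f g <= L1dist B f g)%E.
Proof.
by move=> mA mB mf mg AB; apply: ge0_subset_integral => //; exact: measurable_EFin_normB.
Qed.

(** Three-term argument: f is close to a continuous g on the cube of radius r + 1, mollification
    does not increase that error, and for g itself bounded convergence applies. The margin 1 is
    enough because every [scale] is at most 1. *)
Lemma conv_L1 f r d : loc_integrable f -> 0 < d ->
  \forall k \near \oo, (L1dist (cube n r) (conv (scale k) f) f <= d%:E)%E.
Proof.
move=> fi d0; have [mf fri] := fi.
have mQ := measurable_cube n r; have mQ' := measurable_cube n (r + 1).
have mc k (h : 'rV[R]_n -> R) : loc_integrable h -> measurable_fun setT (conv (scale k) h).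
  move=> hi; apply: continuous_measurable_rV; apply: continuous_conv => //; exact: scale_gt0.
have d30 : 0 < d / 3 by rewrite divr_gt0.
have [g cg fg] := continuous_approx_integrable mQ' (lebesgue_rV_cube_fin n (r + 1)) mf (fri _) d30.
have gi := continuous_loc_integrable cg; have mg := continuous_measurable_rV cg.
have : (fun k => L1dist (cube n r) (conv (scale k) g) g) @ \oo --> 0%E.
  have [M gM] : exists M, forall x, cube n (r + 1) x -> `|g x| <= M.
    have /compact_bounded[M [_ KM]] : compact (g @` cube n (r + 1)).
      apply: continuous_compact; last exact: compact_cube.
      exact: continuous_subspaceT.
    exists (`|M| + 1) => x xQ; apply: KM; last by exists x.
    by rewrite (le_lt_trans (ler_norm M))// ltrDl.
  apply: (@dominated_L1dist _ _ _ _ _ `|M|) => //.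
  - exact: lebesgue_rV_cube_fin.
  - by move=> k; exact: mc.
  - move=> k x xr; apply: (@conv_sup _ _ _ _ _ _ r) => //; first exact: scale_gt0.
    apply: aeW => y yr; rewrite (le_trans (gM y _)) ?ler_norm//.
    by apply: cubeS yr; rewrite lerD2l scale_le1.
  - by move=> x _; exact: conv_continuous_cvg.
move=> /fine_cvgP[fk /cvgrPdist_lt /(_ _ d30) gk].
apply: filterS2 fk gk => k fk; rewrite sub0r normrN ger0_norm ?fine_ge0 ?L1dist_ge0// => gk.
rewrite (le_trans (L1dist_triangle mQ (mc k _ fi) (mc k _ gi) mf))//.
rewrite (_ : d%:E = (d / 3)%:E + ((d / 3)%:E + (d / 3)%:E))%E; last by rewrite -!EFinD; congr EFin; lra.
apply: leeD.
  rewrite (le_trans _ (ltW fg))//.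
  have fgi := loc_integrableB fi gi.
  have := conv_contraction r (scale_gt0 k) fgi.
  under [leLHS]eq_integral do rewrite (convB _ (scale_gt0 k))//.
  move=> /le_trans; apply; apply: ge0_subset_integral => //.
  - exact: measurable_cube.
  - exact: measurable_EFin_normB.
  - by apply: cubeS; rewrite lerD2l scale_le1.
rewrite (le_trans (L1dist_triangle mQ (mc k _ gi) mg mf))// leeD//.
  by rewrite -[X in (X <= _)%E](fineK fk) lee_fin ltW.
rewrite (le_trans _ (ltW fg))//.
rewrite /L1dist; under eq_integral do rewrite distrC.
by apply: L1dist_subset => //; apply: cubeS; rewrite lerDl.
Qed.

(** The graph of the p-th power lies above its tangent at A. This is Young's inequality with
    exponents p and p / (p - 1), applied to a and A^(p - 1). *)
Lemma powR_tangent (p : R) (A a : R) : 1 < p -> 0 < A -> 0 <= a ->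
  A `^ p + p * A `^ (p - 1) * (a - A) <= a `^ p.
Proof.
move=> p1 A0 a0; have p0 : 0 < p by lra.
have q0 : 0 < p / (p - 1) by rewrite divr_gt0//; lra.
have pq : p^-1 + (p / (p - 1))^-1 = 1 by field; rewrite !gt_eqF//; lra.
have := conjugate_powR a0 (powR_ge0 A (p - 1)) p0 q0 pq.
rewrite -powRrM (_ : (p - 1) * (p / (p - 1)) = p); last by field; rewrite gt_eqF//; lra.
move=> h.
have AA : A * A `^ (p - 1) = A `^ p by rewrite mulr_powRB1// ltW.
move: h; rewrite invf_div => h.
have : p * (a * A `^ (p - 1)) <= a `^ p + (p - 1) * A `^ p.
  rewrite -ler_pdivlMl// (le_trans h)// le_eqVlt; apply/orP; left; apply/eqP.
  by field; rewrite gt_eqF.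
by rewrite -AA; lra.
Qed.

(** Jensen's inequality: the tangent inequality at A, the average of |f|, is integrated against the
    kernel, and the linear term drops out. The case A = 0 is immediate and is treated apart since
    the tangent is taken at a positive point. *)
Lemma conv_powR e f x p : 0 < e -> 1 < p -> loc_integrable f ->
  loc_integrable (fun y => `|f y| `^ p) ->
  `|conv e f x| `^ p <= conv e (fun y => `|f y| `^ p) x.
Proof.
move=> e0 p1 fi fpi; have ni := loc_integrable_norm fi.
have p0 : 0 < p by lra.
pose A := conv e (fun y => `|f y|) x.
have A0 : 0 <= A by apply: Rintegral_ge0 => y _; rewrite mulr_ge0// moll_ge0.
apply: (@le_trans _ _ (A `^ p)).
  by apply: ge0_ler_powR; rewrite ?nnegrE ?ler_norm_conv// ltW.
have [A00|An0] := eqVneq A 0.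
  rewrite A00 powR0 ?gt_eqF//; apply: Rintegral_ge0 => y _.
  by rewrite mulr_ge0 ?moll_ge0// powR_ge0.
have {An0}A0 : 0 < A by rewrite lt_neqAle eq_sym An0.
have ci := integrable_conv x e0 ni; have cpi := integrable_conv x e0 fpi.
have mi := integrable_moll_shift x e0.
pose c := p * A `^ (p - 1).
have E : A `^ p = \int[mu]_y (moll e (x - y) * (A `^ p - c * A) + c * (moll e (x - y) * `|f y|)).
  rewrite RintegralD//; last 2 first.
  - by have := integrableZr measurableT (A `^ p - c * A) mi.
  - by have := integrableZl measurableT c ci.
  rewrite RintegralZr// Rintegral_moll_shift// mul1r RintegralZl//.
  rewrite -[X in c * X]/A; ring.
rewrite E; apply: le_Rintegral => //.
  have := integrableD measurableT (integrableZr measurableT (A `^ p - c * A) mi) (integrableZl measurableT c ci).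
  by [].
move=> y _; have := powR_tangent p1 A0 (normr_ge0 (f y)); rewrite -/c => h.
rewrite [X in _ + X]mulrCA -mulrDr ler_wpM2l ?moll_ge0//; lra.
Qed.

End mollification_L1.

(** * Almost everywhere approximation under an integrable majorant *)

Section ae_approximation.
Context (R : realType) (n : nat).
Local Notation mu := (lebesgue_rV R n).

(** Scales are chosen so that the L^1 errors at rank k add up to at most 2^-(k+1) over the finite
    family. The sum over k of the errors is then integrable, so it is finite almost everywhere,
    which yields convergence and domination together, with the same scales for every member of the
    family. *)
Lemma ae_conv_dominated (I : finType) (f : I -> 'rV[R]_n -> R) r :
  (forall i, loc_integrable (f i)) ->
  exists e : nat -> R, exists G : 'rV[R]_n -> R,
  [/\ forall k, 0 < e k <= 1,
      measurable_fun setT G, mu.-integrable (cube n r) (EFin \o G) &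
      {ae mu, forall x, cube n r x -> forall i,
        conv (e k) (f i) x @[k --> \oo] --> f i x /\
        forall k, `|conv (e k) (f i) x| <= G x}].
Proof.
move=> fi; have mQ := measurable_cube n r (R := R).
pose m : R := #|I|%:R + 1.
have m0 : 0 < m by rewrite ltr_wpDl.
have dk0 k : 0 < ((2 ^ k.+1)%:R)^-1 / m :> R.
  by rewrite divr_gt0// invr_gt0 ltr0n expn_gt0.
have /choice[j jP] : forall k, exists j, forall i,
    (L1dist (cube n r) (conv (scale R j) (f i)) (f i) <= (((2 ^ k.+1)%:R)^-1 / m)%:E)%E.
  move=> k.
  have : \forall j \near \oo, forall i,
      (L1dist (cube n r) (conv (scale R j) (f i)) (f i) <= (((2 ^ k.+1)%:R)^-1 / m)%:E)%E.
    apply: filter_forall => i; exact: conv_L1.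
  by move=> /filter_ex.
pose e k := scale R (j k).
have e01 k : 0 < e k <= 1 by rewrite scale_gt0 scale_le1.
have e0 k : 0 < e k by case/andP: (e01 k).
pose D k x : R := \sum_i `|conv (e k) (f i) x - f i x|.
have D0 k x : 0 <= D k x by exact: sumr_ge0.
have mfi i : measurable_fun setT (f i) by have [] := fi i.
have mci k i : measurable_fun setT (conv (e k) (f i)).
  by apply: continuous_measurable_rV; apply: continuous_conv.
have mD k : measurable_fun setT (D k).
  apply: measurable_sum => i; apply: measurableT_comp => //; exact: measurable_funB.
have intD k : (\int[mu]_(x in cube n r) (D k x)%:E <= (1 / (2 ^ k.+1)%:R)%:E)%E.
  under eq_integral do rewrite /D -sumEFin.
  rewrite ge0_integral_sum//; last by move=> i; exact: measurable_EFin_normB.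
  apply: (@le_trans _ _ (\sum_(i : I) (((2 ^ k.+1)%:R)^-1 / m)%:E)%E).
    by apply: lee_sum => i _; exact: jP.
  rewrite sumEFin lee_fin (_ : \sum_(i : I) _ = #|I|%:R * (((2 ^ k.+1)%:R)^-1 / m)); last first.
    by rewrite sumr_const mulr_natl.
  rewrite mul1r mulrCA; apply: ler_piMr; first by rewrite invr_ge0.
  by rewrite ler_pdivrMr// mul1r lerDl.
pose S x := (\sum_(k <oo) (D k x)%:E)%E.
have S0 x : (0 <= S x)%E by apply: nneseries_ge0 => k _ _; rewrite lee_fin.
have mS : measurable_fun setT S.
  apply: ge0_emeasurable_sum => [k x _ _|k _]; first by rewrite lee_fin.
  exact/measurable_EFinP.
have intS : mu.-integrable (cube n r) S.
  apply/integrableP; split; first exact: measurable_funTS.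
  under eq_integral do rewrite gee0_abs//.
  rewrite integral_nneseries//; last 2 first.
  - by move=> k; apply: measurable_funTS; exact/measurable_EFinP.
  - by move=> k x _; rewrite lee_fin.
  apply: (@le_lt_trans _ _ (\sum_(k <oo) (1 / (2 ^ k.+1)%:R)%:E)%E).
    by apply: lee_nneseries => // k _ _; apply: integral_ge0 => x _; rewrite lee_fin.
  by rewrite (le_lt_trans (epsilon_trick0 _ ler01))// ltry.
(* Each mollification differs from f i by at most the total error S. The real part is meaningful
   where S is finite, that is, almost everywhere on the cube. *)
pose G x := \sum_i `|f i x| + fine (S x).
have mG : measurable_fun setT G.
  apply: measurable_funD; last exact: measurableT_comp.
  by apply: measurable_sum => i; exact: measurableT_comp.
exists e, G; split => //.
  have intF : mu.-integrable (cube n r) (EFin \o (fun x => \sum_i `|f i x|)).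
    have := @integrable_sum _ _ _ mu (cube n r) mQ _ (index_enum I) xpredT (fun i x => (`|f i x|)%:E).
    move=> /(_ (fun i _ => integrable_norm ((fi i).2 r))).
    by apply: eq_integrable => // x _; rewrite sumEFin.
  have intS' : mu.-integrable (cube n r) (EFin \o (fine \o S)).
    apply: le_integrable intS => //.
      by apply: measurable_funTS; apply/measurable_EFinP; exact: measurableT_comp.
    move=> x _ /=; rewrite [leRHS]gee0_abs//.
    by have := S0 x; case: (S x) => [s||]//= s0; rewrite ?normr0 ?leey// ger0_norm.
  have := integrableD mQ intF intS'.
  by apply: eq_integrable => // x _ /=; rewrite -EFinD.
have := integrable_ae mQ intS; apply: filterS => x Sx Qx i.
have {}Sx := Sx Qx.
have Dle k : D k x <= fine (S x).
  rewrite -lee_fin fineK//.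
  have := @nneseries_lim_ge R (fun k => (D k x)%:E) xpredT 0%N k.+1.
  move=> /(_ (fun k _ _ => D0 k x)); apply: le_trans.
  by rewrite sumEFin lee_fin big_nat_recr//= lerDr sumr_ge0.
have Dcvg : D k x @[k --> \oo] --> 0.
  apply: cvg_series_cvg_0; apply: nondecreasing_is_cvgn.
    by apply: nondecreasing_series => k _ _; exact: D0.
  exists (fine (S x)) => _ [k _ <-]; rewrite -lee_fin fineK//.
  have := @nneseries_lim_ge R (fun k => (D k x)%:E) xpredT 0%N k.
  by move=> /(_ (fun k _ _ => D0 k x)); apply: le_trans; rewrite sumEFin.
have cD k : `|conv (e k) (f i) x - f i x| <= D k x.
  by rewrite /D (bigD1 i)//= lerDl; exact: sumr_ge0.
split; last first.
  move=> k; rewrite -[X in `|X|](subrK (f i x)) (le_trans (ler_normD _ _))// addrC lerD//.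
    by rewrite (bigD1 i)//= lerDl; exact: sumr_ge0.
  exact: le_trans (cD k) (Dle k).
apply/cvgrPdist_lt => d d0; have /cvgrPdist_lt/(_ d d0) := Dcvg.
apply: filterS => k; rewrite sub0r normrN ger0_norm// => Dd.
by rewrite distrC (le_lt_trans (cD k)).
Qed.

(* Convergence almost everywhere with an integrable dominating function, along a
   subsequence, replaces convergence in W^{1,p}. *)
Lemma sobolev_approximation (p M r : R) (u : 'rV[R]_n -> R) (Du : 'rV[R]_n -> 'rV[R]_n) :
  1 < p -> 0 <= M -> loc_integrable u -> (forall i, loc_integrable (fun x => Du x 0 i)) ->
  (forall i, loc_integrable (fun x => `|Du x 0 i| `^ p)) -> weak_gradient u Du ->
  {ae mu, forall x, cube n (r + 1) x -> `|u x| <= M} ->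
  exists v : nat -> 'rV[R]_n -> R, exists G : 'rV[R]_n -> R,
  [/\ forall k, C1_on setT (v k), forall k x, cube n r x -> `|v k x| <= M,
      measurable_fun setT G, mu.-integrable (cube n r) (EFin \o G) &
      {ae mu, forall x, cube n r x ->
        [/\ v k x @[k --> \oo] --> u x,
            forall i, grad (v k) x 0 i @[k --> \oo] --> Du x 0 i &
            forall k i, `|grad (v k) x 0 i| `^ p <= G x]}].
Proof.
move=> p1 M0 ui Dui Dpi wu uM.
(* The p-th powers join the family only for their majorant: by Jensen's inequality their
   mollifications dominate the p-th powers of the gradients of the mollified u. *)
pose f (s : unit + ('I_n + 'I_n)) : 'rV[R]_n -> R := match s with
  | inl _ => u | inr (inl i) => fun x => Du x 0 i
  | inr (inr i) => fun x => `|Du x 0 i| `^ p end.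
have fi s : loc_integrable (f s) by case: s => [_|[i|i]] /=.
have [e [G [e01 mG iG aeG]]] := ae_conv_dominated r fi.
have e0 k : 0 < e k by case/andP: (e01 k).
have gE k x i : grad (conv (e k) u) x 0 i = conv (e k) (fun y => Du y 0 i) x.
  by rewrite (conv_weak_gradient x (e0 k) ui wu) mxE.
exists (fun k => conv (e k) u), G; split => //.
- by move=> k; exact: conv_C1 (e0 k) ui Dui wu.
- move=> k x xr; apply: (conv_sup (e0 k) M0 ui xr).
  apply: filterS uM => y uM yr; apply: uM; apply: cubeS yr.
  by rewrite lerD2l; case/andP: (e01 k).
apply: filterS aeG => x aeG Qx; have {}aeG := aeG Qx; split.
- exact: (aeG (inl tt)).1.
- move=> i; under eq_fun do rewrite gE; exact: (aeG (inr (inl i))).1.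
- move=> k i; rewrite gE (le_trans (conv_powR x (e0 k) p1 (Dui i) (Dpi i)))//.
  by rewrite (le_trans (ler_norm _))//; exact: (aeG (inr (inr i))).2 k.
Qed.

End ae_approximation.

(** * Finsler norms *)

Section homogeneous.
Context (R : realType) (n : nat).
Implicit Types (f : 'rV[R]_n -> R) (x v w : 'rV[R]_n).

(** For functions affine along a line, which is how homogeneity is turned into identities for
    derivatives. *)
Lemma derive_near_cst f x v (c : R) : differentiable f x ->
  (\forall t \near (0 : R), f (t *: v + x) = f x + t * c) -> dotv (grad f x) v = c.
Proof.
move=> df fc; rewrite -derive_grad//; apply: cvg_lim => //.
apply: cvg_near_cst.
have h0 : \forall t \near (0 : R)^', t != 0 by exact: nbhs_dnbhs_neq.
have fc' : \forall t \near (0 : R)^', f (t *: v + x) = f x + t * c.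
  exact: nbhs_dnbhs fc.
apply: filterS2 h0 fc' => t t0 /= ->.
by rewrite addrAC subrr add0r /GRing.scale/= mulrA mulVf// mul1r.
Qed.

Lemma near_scale_pos : \forall t \near (0 : R), 0 < t + 1.
Proof.
exists 1 => //= t; rewrite /ball_/= sub0r normrN => /ltr_normlP[]; lra.
Qed.

Lemma nbhs_neq0 x : x != 0 -> \forall y \near x, y != 0.
Proof.
move=> x0; have nF : Filter (nbhs x) := nbhs_filter x.
have nx : {for x, continuous (fun y : 'rV[R]_n => `|y|)} by exact: norm_continuous.
have : \forall y \near x, 0 < `|y| by apply: (cvgr_gt _ nx); rewrite normr_gt0.
by apply: filterS => y; rewrite normr_gt0.
Qed.

Lemma scaleD1 x (t : R) : t *: x + x = (t + 1) *: x.
Proof. by rewrite scalerDl scale1r. Qed.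

(** Chain rule for y -> t y. The factor d is t for H, of degree 1, and 1 for its partial
    derivatives, of degree 0. *)
Lemma homogeneous_grad f (d : R) x (t : R) : 0 < t ->
  (forall y, y != 0 -> f (t *: y) = d * f y) -> x != 0 ->
  differentiable f x -> differentiable f (t *: x) ->
  forall v, t * dotv (grad f (t *: x)) v = d * dotv (grad f x) v.
Proof.
move=> t0 ft x0 dfx dftx v.
have lin : differentiable ( *:%R t : 'rV[R]_n -> 'rV[R]_n) x.
  by apply: linear_differentiable; exact: scaler_continuous.
have E1 : 'd (f \o *:%R t) x v = t * dotv (grad f (t *: x)) v.
  rewrite diff_comp//= diff_grad// diff_lin//=; last exact: scaler_continuous.
  by rewrite dotvZr.
have dc : differentiable (f \o *:%R t) x by exact: differentiable_comp.
rewrite -E1 -deriveE//.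
have dZ : differentiable (fun y => d * f y) x.
  by apply: differentiableZ.
have <- : 'D_v (fun y => d * f y) x = d * dotv (grad f x) v.
  rewrite deriveE// (_ : (fun y => d * f y) = d \*: f)// diffZ//.
  by rewrite /= diff_grad.
apply: near_eq_derive.
by apply: filterS (nbhs_neq0 x0) => y y0; rewrite /= ft.
Qed.

Lemma homogeneous_grad_coord f (d : R) x (t : R) j : 0 < t ->
  (forall y, y != 0 -> f (t *: y) = d * f y) -> x != 0 ->
  differentiable f x -> differentiable f (t *: x) ->
  t * grad f (t *: x) 0 j = d * grad f x 0 j.
Proof. by move=> *; rewrite -!dotv_delta; exact: homogeneous_grad. Qed.

End homogeneous.

Section finsler.
Context (R : realType) (n : nat) (H : 'rV[R]_n -> R).
Hypotheses (normH : is_norm H) (C2H : C2_on [set x | x != 0] H).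
Implicit Types (x y v w : 'rV[R]_n).

Lemma finsler_ge0 x : 0 <= H x. Proof. by have [h _ _ _] := normH; exact: h. Qed.

Lemma finslerZ t x : H (t *: x) = `|t| * H x.
Proof. by have [_ _ h _] := normH; exact: h. Qed.

Lemma finsler_triangle x y : H (x + y) <= H x + H y.
Proof. by have [_ _ _ h] := normH; exact: h. Qed.

Lemma finsler0 : H 0 = 0.
Proof. by rewrite -(scale0r 0) finslerZ normr0 mul0r. Qed.

Lemma finslerN x : H (- x) = H x.
Proof. by rewrite -scaleN1r finslerZ normrN normr1 mul1r. Qed.

Lemma finsler_dist x y : `|H (x + y) - H y| <= H x.
Proof.
rewrite ler_norml; apply/andP; split.
  have := finsler_triangle (- x) (x + y); rewrite addKr finslerN; lra.
by rewrite lerBlDr finsler_triangle.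
Qed.

Definition finsler_bound := \sum_(i < n) H (delta_mx 0 i).

Lemma finsler_bound_ge0 : 0 <= finsler_bound.
Proof. by apply: sumr_ge0 => i _; exact: finsler_ge0. Qed.

Lemma finsler_le x : H x <= finsler_bound * `|x|.
Proof.
rewrite [in leLHS](row_sum_delta x) /finsler_bound mulr_suml.
elim/big_ind2 : _ => [|a b c d ab cd|i _]; first by rewrite finsler0.
  by rewrite (le_trans (finsler_triangle _ _))// lerD.
by rewrite finslerZ mulrC ler_wpM2l ?finsler_ge0// coord_le_norm.
Qed.

Lemma continuous_finsler : continuous H.
Proof.
move=> x; have nF : Filter (nbhs x) := nbhs_filter x.
apply/cvgrPdist_le => e e0.
have B0 : 0 < finsler_bound + 1 by rewrite ltr_wpDl// finsler_bound_ge0.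
have : \forall y \near x, `|x - y| <= e / (finsler_bound + 1).
  have idx : {for x, continuous (@idfun 'rV[R]_n)} by exact: cvg_id.
  by have /cvgrPdist_le := idx; apply; rewrite divr_gt0.
apply: filterS => y xy.
rewrite -{1}(subrK y x) (le_trans (finsler_dist _ _))// (le_trans (finsler_le _))//.
rewrite (@le_trans _ _ ((finsler_bound + 1) * `|x - y|))//.
  by rewrite ler_wpM2r// lerDl.
by rewrite mulrC -ler_pdivlMr.
Qed.

Lemma finsler_differentiable x : x != 0 -> differentiable H x.
Proof. by move=> x0; have [C1 _] := C2H; have [] := C1 _ x0. Qed.

Lemma finsler_grad_differentiable i x : x != 0 ->
  differentiable (fun y => grad H y 0 i) x.
Proof. by move=> x0; have [_ C1] := C2H; have [] := C1 i _ x0. Qed.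

Lemma finsler_grad_continuous i x : x != 0 ->
  {for x, continuous (fun y => grad H y 0 i)}.
Proof. by move=> x0; apply: differentiable_continuous; exact: finsler_grad_differentiable. Qed.

Lemma hessE x i j : hess H x i j = grad (fun y => grad H y 0 i) x 0 j.
Proof. by rewrite [LHS]mxE [RHS]mxE. Qed.

Lemma finsler_hess_continuous i j x : x != 0 ->
  {for x, continuous (fun y => hess H y i j)}.
Proof.
move=> x0; have [_ C1] := C2H; have [_ /continuous_gradP/(_ j)] := C1 i _ x0.
by under [X in _ -> {for _, continuous X}]eq_fun do rewrite hessE.
Qed.

(** The triangle inequality bounds every difference quotient in the direction v by H(v), and the
    bound passes to the limit. *)
Lemma finsler_grad_le x v : x != 0 -> `|dotv (grad H x) v| <= H v.
Proof.
move=> x0; have dH := finsler_differentiable x0.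
have dv : derivable H x v by exact: diff_derivable.
have q : \forall t \near (0 : R)^', `|t^-1 *: ((H \o shift x) (t *: v) - H x)| <= H v.
  have : \forall t \near (0 : R)^', t != 0 by exact: nbhs_dnbhs_neq.
  apply: filterS => t t0 /=; rewrite normrM normfV ler_pdivrMl ?normr_gt0//.
  by rewrite (le_trans (finsler_dist _ _))// finslerZ.
rewrite -derive_grad// ler_norml; apply/andP; split.
- by apply: limr_ge => //; apply: filterS q => t; rewrite ler_norml => /andP[].
- by apply: limr_le => //; apply: filterS q => t; rewrite ler_norml => /andP[].
Qed.

Lemma finsler_euler x : x != 0 -> dotv (grad H x) x = H x.
Proof.
move=> x0; apply: derive_near_cst; first exact: finsler_differentiable.
apply: filterS (@near_scale_pos R) => t t0.
by rewrite scaleD1 finslerZ gtr0_norm// mulrDl mul1r addrC.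
Qed.

Lemma finsler_grad_scale x t : 0 < t -> x != 0 -> grad H (t *: x) = grad H x.
Proof.
move=> t0 x0; apply/rowP => i; rewrite -!dotv_delta.
apply: (mulfI (lt0r_neq0 t0)); apply: homogeneous_grad => //.
- by move=> y _; rewrite finslerZ gtr0_norm.
- exact: finsler_differentiable.
- by apply: finsler_differentiable; rewrite scaler_eq0 gt_eqF.
Qed.

Definition hess_form x v w := dotv (v *m hess H x) w.

Lemma hess_formE x v w :
  hess_form x v w = \sum_i v 0 i * dotv (grad (fun y => grad H y 0 i) x) w.
Proof.
rewrite /hess_form /dotv.
under eq_bigr do rewrite mxE mulr_suml.
rewrite exchange_big; apply: eq_bigr => i _ /=; rewrite mulr_sumr.
by apply: eq_bigr => j _; rewrite hessE mulrA.
Qed.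

Lemma hess_formDl x v v' w : hess_form x (v + v') w = hess_form x v w + hess_form x v' w.
Proof. by rewrite /hess_form mulmxDl dotvDl. Qed.

Lemma hess_formDr x v w w' : hess_form x v (w + w') = hess_form x v w + hess_form x v w'.
Proof. exact: dotvDr. Qed.

Lemma hess_formZl x a v w : hess_form x (a *: v) w = a * hess_form x v w.
Proof. by rewrite /hess_form -scalemxAl dotvZl. Qed.

Lemma hess_formZr x a v w : hess_form x v (a *: w) = a * hess_form x v w.
Proof. exact: dotvZr. Qed.

Lemma hess_form_radial_r x v : x != 0 -> hess_form x v x = 0.
Proof.
move=> x0; rewrite hess_formE big1// => i _.
rewrite (@derive_near_cst _ _ _ _ _ 0) ?mulr0//; first exact: finsler_grad_differentiable.
apply: filterS (@near_scale_pos R) => t t0.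
by rewrite scaleD1 finsler_grad_scale// mulr0 addr0.
Qed.

(** Differentiating Euler's identity <grad H(y), y> = H(y) in the direction w produces <grad H(x),
    w> on both sides, so the Hessian term vanishes. This gives the left kernel without going through
    symmetry of the matrix. *)
Lemma hess_form_radial_l x w : x != 0 -> hess_form x x w = 0.
Proof.
move=> x0; have dH := finsler_differentiable x0.
have dg i : derivable (fun y => grad H y 0 i) x w.
  by apply: diff_derivable; exact: finsler_grad_differentiable.
have dc i : differentiable (fun y : 'rV[R]_n => y 0 i) x by exact: differentiable_coord.
have E : 'D_w (\sum_(i < n) (fun y => grad H y 0 i) * (fun y : 'rV[R]_n => y 0 i)) x = 'D_w H x.
  apply: near_eq_derive; apply: filterS (nbhs_neq0 x0) => y y0.
  by rewrite fct_sumE -[RHS]finsler_euler.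
move: E; rewrite derive_sum; last by move=> i; apply: derivableM => //; exact: diff_derivable.
rewrite (derive_grad w dH) => E.
have Ei i : 'D_w ((fun y => grad H y 0 i) * (fun y : 'rV[R]_n => y 0 i)) x =
    grad H x 0 i * w 0 i + x 0 i * dotv (grad (fun y => grad H y 0 i) x) w.
  rewrite deriveM//; last exact: diff_derivable.
  rewrite (derive_grad w (finsler_grad_differentiable i x0)).
  have -> : 'D_w (fun y : 'rV[R]_n => y 0 i) x = w 0 i.
    rewrite derive_grad//; apply: derive_near_cst => //.
    by apply: filterS (@near_scale_pos R) => t _; rewrite !mxE addrC.
  by [].
move: E; under eq_bigr do rewrite Ei.
by rewrite big_split/= -hess_formE -/(dotv _ _) => /(canRL (addKr _)); rewrite addNr.
Qed.

Lemma finsler_hess_scale x t i j : 0 < t -> x != 0 ->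
  t * hess H (t *: x) i j = hess H x i j.
Proof.
move=> t0 x0; have tx0 : t *: x != 0 by rewrite scaler_eq0 negb_or gt_eqF.
have E : forall y, y != 0 -> grad H (t *: y) 0 i = 1 * grad H y 0 i.
  by move=> y y0; rewrite finsler_grad_scale// mul1r.
transitivity (t * grad (fun y => grad H y 0 i) (t *: x) 0 j).
  by congr (_ * _); exact: hessE.
transitivity (1 * grad (fun y => grad H y 0 i) x 0 j).
  2: by rewrite mul1r; exact/esym/hessE.
exact: homogeneous_grad_coord t0 E x0 (finsler_grad_differentiable i x0)
  (finsler_grad_differentiable i tx0).
Qed.

(** The entries of the Hessian are bounded on the unit sphere of the sup norm by compactness, and
    homogeneity of degree -1 extends the bound: the factor H(x) compensates the singularity at the
    origin. *)
Lemma finsler_hess_bound : exists2 C, 0 <= C &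
  forall x v, x != 0 -> H x * `|hess_form x v v| <= C * `|v| ^+ 2.
Proof.
pose S : set 'rV[R]_n := [set x | `|x| = 1].
have S0 x : S x -> x != 0 by move=> Sx; rewrite -normr_eq0 Sx oner_eq0.
have cS : compact S.
  apply: bounded_closed_compact.
    exists 1; split; first exact: num_real.
    by move=> M M1 x /= ->; exact: ltW.
  rewrite (_ : S = (fun x : 'rV[R]_n => `|x|) @^-1` [set 1])//.
  by apply: closed_comp => [x _|]; [exact: norm_continuous|exact: closed_eq].
have bij i j : exists M, forall x, S x -> `|hess H x i j| <= M.
  have /compact_bounded[M [_ KM]] : compact ((fun x => hess H x i j) @` S).
    apply: continuous_compact => //.
    by apply: continuous_in_subspaceT => x /set_mem Sx; apply: finsler_hess_continuous; exact: S0.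
  exists (`|M| + 1) => x xS; apply: KM; last by exists x.
  by rewrite (le_lt_trans (ler_norm M))// ltrDl.
have [M hM] : exists M : 'I_n * 'I_n -> R, forall ij x, S x -> `|hess H x ij.1 ij.2| <= M ij.
  have /choice[M hM] := fun ij : 'I_n * 'I_n => bij ij.1 ij.2.
  by exists M.
pose C1 := \sum_i \sum_j `|M (i, j)|.
have C10 : 0 <= C1 by do 2! apply: sumr_ge0 => ? _.
exists (finsler_bound * C1); first by rewrite mulr_ge0// finsler_bound_ge0.
move=> x v x0; have nx0 : 0 < `|x| by rewrite normr_gt0.
have hx i j : `|x| * `|hess H x i j| <= `|M (i, j)|.
  have Sx : S (`|x|^-1 *: x) by rewrite /S/= normrZ normfV normr_id mulVf// gt_eqF.
  rewrite -[X in X * _]normr_id -normrM -[X in hess H X](scalerKV (lt0r_neq0 nx0)).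
  rewrite finsler_hess_scale//; last exact: S0.
  by rewrite (le_trans (hM (i, j) _ Sx))// ler_norm.
rewrite (@le_trans _ _ (finsler_bound * `|x| * `|hess_form x v v|))//.
  by rewrite ler_wpM2r// finsler_le.
rewrite -!mulrA ler_wpM2l ?finsler_bound_ge0// hess_formE.
rewrite (le_trans (ler_wpM2l (ltW nx0) (ler_norm_sum _ _ _)))// mulr_sumr /C1 mulr_suml.
apply: ler_sum => i _; rewrite normrM mulrCA /dotv mulr_suml.
rewrite (le_trans (ler_wpM2l (normr_ge0 _) (ler_wpM2l (ltW nx0) (ler_norm_sum _ _ _))))//.
rewrite !mulr_sumr; apply: ler_sum => j _.
rewrite normrM -hessE.
rewrite (_ : _ * (_ * _) = (`|x| * `|hess H x i j|) * (`|v 0 i| * `|v 0 j|)); last by ring.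
by rewrite expr2 ler_pM ?mulr_ge0// ler_pM// coord_le_norm.
Qed.

(** The default value of a derivative of H at 0 is harmless for measurability: it concerns a single
    point, which is a measurable set. *)
Lemma measurable_fun_neq0 (g : 'rV[R]_n -> R) :
  (forall x, x != 0 -> {for x, continuous g}) -> measurable_fun setT g.
Proof.
move=> cg.
have o0 : open [set x : 'rV[R]_n | x != 0].
  by rewrite openE => x /= x0; rewrite /interior/=; exact: nbhs_neq0.
have m0 := measurable_open_rV o0.
rewrite (_ : setT = [set x : 'rV[R]_n | x != 0] `|` ~` [set x : 'rV[R]_n | x != 0]); last by rewrite setUv.
apply/measurable_funU => //; first exact: measurableC.
split; first by apply: open_continuous_measurable_rV => // x /set_mem; exact: cg.
apply: (eq_measurable_fun (cst (g 0))) => [x /set_mem/= /negP|].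
  by rewrite negbK => /eqP ->.
by apply: measurable_cst.
Qed.

End finsler.

(** * Exponents and Young inequalities *)

Section exponents.
Context (R : realType).
Implicit Types (a b g n p q s t : R).

(* G0 is the larger root of (p - 1) ((g + 1) / 2)^2 = g q. *)
Lemma gamma_exists n p q (G0 := (2 * q - (p - 1) + 2 * Num.sqrt (q * (q - p + 1))) / (p - 1)) :
  2 <= p -> p - 1 < q -> n * (q - p + 1) < p * (q + G0) ->
  exists g, [/\ 1 < g, (p - 1) * ((g + 1) / 2) ^+ 2 < g * q &
                n * (q - p + 1) < p * (q + g)].
Proof.
move=> p2 pq; rewrite /G0; set S := Num.sqrt _ => nG.
have s0 : 0 < q - p + 1 by lra.
have q0 : 0 < q by lra.
have S0 : 0 < S by rewrite sqrtr_gt0 mulr_gt0.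
have SE : S ^+ 2 = q * (q - p + 1) by rewrite sqr_sqrtr// mulr_ge0// ltW.
have Ss : q - p + 1 < S.
  rewrite -(@ltr_pXn2r _ 2) ?nnegrE ?ltW// SE expr2 ltr_pM2r//; lra.
have p10 : 0 < p - 1 by lra.
set Gm := (2 * q - (p - 1) + 2 * S) / (p - 1).
have GmE : (p - 1) * Gm = 2 * q - (p - 1) + 2 * S by rewrite /Gm mulrC divfK// gt_eqF.
have Gm1 : 1 < Gm by rewrite ltr_pdivlMr// mul1r; lra.
(* The admissible g are those strictly between g0 and the root [Gm]; the midpoint is taken. *)
pose g0 := Num.max 1 (n * (q - p + 1) / p - q).
have p0 : 0 < p by lra.
have g0G : g0 < Gm by rewrite gt_max Gm1/= ltrBlDr ltr_pdivrMr// (mulrC _ p) (addrC _ q).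
have g01 : 1 <= g0 by rewrite le_max lexx.
have g0n : n * (q - p + 1) / p - q <= g0 by rewrite le_max lexx orbT.
exists ((g0 + Gm) / 2); split; first lra.
  set g := (g0 + Gm) / 2.
  have g1 : 1 < g by rewrite /g; lra.
  have gG : g < Gm by rewrite /g; lra.
  (* With G = (p - 1) g, completing the square gives 4 (p - 1) (g q - (p - 1) ((g + 1) / 2)^2) = (2
     S)^2 - (G - (2 q - (p - 1)))^2. The lower half of the bound on G follows from g > 1 and S > q -
     p + 1. *)
  pose G := (p - 1) * g.
  have h1 : G < 2 * q - (p - 1) + 2 * S by rewrite -GmE ltr_pM2l.
  have h2 : p - 1 < G by rewrite /G -[ltLHS]mulr1 ltr_pM2l.
  have h3 : (G - (2 * q - (p - 1))) ^+ 2 < (2 * S) ^+ 2.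
    by rewrite -ltr_sqrt ?exprn_gt0 ?mulr_gt0// !sqrtr_sqr (gtr0_norm (x := 2 * S)) ?mulr_gt0// ltr_norml; apply/andP; split; lra.
  rewrite -subr_gt0 -(pmulr_rgt0 _ p10) -(pmulr_rgt0 _ (ltr0n R 4)).
  rewrite (_ : _ * _ = (2 * S) ^+ 2 - (G - (2 * q - (p - 1))) ^+ 2) ?subr_gt0//.
  by rewrite (_ : (2 * S) ^+ 2 = 4 * (q * (q - p + 1))) /G; [field|rewrite -SE; ring].
have : n * (q - p + 1) / p < (g0 + Gm) / 2 + q by lra.
by rewrite ltr_pdivrMr// (mulrC _ p) (addrC _ q).
Qed.

(** For small N the estimate S > q - p + 1 for the square root is already enough. For large N the
    square root is isolated and the inequality squared; q < q_c then says that s = q - p + 1 lies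
    below the larger root of the resulting quadratic. *)
Lemma exponent_gap (N : nat) p q (G0 := (2 * q - (p - 1) + 2 * Num.sqrt (q * (q - p + 1))) / (p - 1)) :
  (2 <= N)%N -> 2 <= p ->
  (if N%:R <= p * (p + 3) / (p - 1) then p - 1 < q else p - 1 < q < q_c N p) ->
  p - 1 < q /\ N%:R * (q - p + 1) < p * (q + G0).
Proof.
move=> N2 p2 H; have pq : p - 1 < q by move: H; case: ifP => // _ /andP[].
split => //; rewrite /G0; set S := Num.sqrt _.
have s0 : 0 < q - p + 1 by lra.
have q0 : 0 < q by lra.
have S0 : 0 < S by rewrite sqrtr_gt0 mulr_gt0.
have SE : S ^+ 2 = q * (q - p + 1) by rewrite sqr_sqrtr// mulr_ge0// ltW.
have Ss : q - p + 1 < S.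
  rewrite -(@ltr_pXn2r _ 2) ?nnegrE ?ltW// SE expr2 ltr_pM2r//; lra.
have p10 : 0 < p - 1 by lra.
have N2R : 2 <= N%:R :> R by rewrite ler_nat.
rewrite -(ltr_pM2l p10) (_ : (p - 1) * (p * _) = p * ((p + 1) * q - (p - 1) + 2 * S)); last first.
  by field; rewrite gt_eqF.
move: H; rewrite /q_c; set n : R := N%:R; case: (leP n (p * (p + 3) / (p - 1))) => [nle _|nlt].
  have nle' : n * (p - 1) <= p * (p + 3) by rewrite -ler_pdivlMr.
  have h1 : (p - 1) * (n * (q - p + 1)) <= p * (p + 3) * (q - p + 1).
    by rewrite mulrA ler_pM2r// mulrC.
  have h2 : 0 < p * (p - 1) by rewrite mulr_gt0//; lra.
  have h3 : p * (q - p + 1) < p * S by rewrite ltr_pM2l//; lra.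
  nra.
move=> /andP[_].
have nlt' : p * (p + 3) < n * (p - 1) by rewrite -ltr_pdivrMr.
have np : p < n by rewrite -(ltr_pM2r p10); nra.
pose D := (n - p) * ((p - 1) * n - p * (p + 3)).
have D0 : 0 < D by rewrite mulr_gt0 ?subr_gt0// (mulrC (p - 1)).
rewrite -/D ltr_pdivlMr//; set k := Num.sqrt _ => qD.
have kE : k ^+ 2 = (p - 1) * (n - 1) by rewrite sqr_sqrtr// mulr_ge0//; lra.
have k0 : 0 <= k by exact: sqrtr_ge0.
pose s := q - p + 1; pose a := (p - 1) * n - p * (p + 1).
have a2p : 2 * p < a by rewrite /a; lra.
have sD : s * D < p ^+ 2 * (a + 2 + 2 * k).
  rewrite /s (_ : _ * D = q * D - (p - 1) * D); last by ring.
  by rewrite ltrBlDr; apply: lt_le_trans qD _; rewrite le_eqVlt /D /a; apply/orP; left; apply/eqP; ring.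
(* The claim with everything but the square root moved to the left. If the left-hand side is
   nonpositive nothing remains to prove; otherwise both sides may be squared. *)
suff main : a * s - p ^+ 2 * (p - 1) < 2 * p * S.
  have -> : (p - 1) * (n * (q - p + 1)) = a * s + p * (p + 1) * s by rewrite /a /s; ring.
  rewrite [ltRHS](_ : _ = 2 * p * S + (p * (p + 1) * s + p ^+ 2 * (p - 1))); last by rewrite /s; ring.
  lra.
have p0 : 0 < p by lra.
have pS : 0 < 2 * p * S by rewrite !mulr_gt0.
have [asb|asb] := leP (a * s) (p ^+ 2 * (p - 1)); first lra.
rewrite -(@ltr_pXn2r _ 2) ?nnegrE//; [|lra|exact: ltW].
have a0 : 0 < a by lra.
have s0' : 0 < s by [].
(* T completes the square: the roots of the squared inequality are the s with T equal to plus or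
   minus 2 p^2 k, the positive sign corresponding to q = q_c. *)
pose T := D * s - p ^+ 2 * (a + 2).
have Tup : T < 2 * p ^+ 2 * k by rewrite /T; nra.
have aD : (p - 1) * D = a ^+ 2 - 4 * p ^+ 2 by rewrite /D /a; ring.
have kp : 1 + p <= k.
  rewrite -(@ler_pXn2r _ 2) ?nnegrE//; last lra.
  by rewrite kE; move: a2p; rewrite /a; lra.
(* Positivity of the side that was squared puts s above the smaller root; the margin comes from k >=
   1 + p and a > 2 p. *)
have Tlo : - (2 * p ^+ 2 * k) < T.
  have h : a * (D * s) > p ^+ 2 * (a ^+ 2 - 4 * p ^+ 2).
    by rewrite -aD; have := asb; rewrite -(ltr_pM2l D0) => asb'; lra.
  rewrite -(ltr_pM2l a0) /T.
  have : p ^+ 2 * (a * (1 + p)) <= p ^+ 2 * (a * k) by rewrite ler_pM2l ?exprn_gt0// ler_pM2l.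
  have : p ^+ 2 * p * (2 * p) <= p ^+ 2 * p * a by rewrite ler_pM2l ?mulr_gt0 ?exprn_gt0// ltW.
  move: h; lra.
have T2 : T ^+ 2 < (2 * p ^+ 2 * k) ^+ 2.
  have := mulr_gt0 (_ : 0 < 2 * p ^+ 2 * k - T) (_ : 0 < 2 * p ^+ 2 * k + T).
  by rewrite subr_gt0 -ltrBlDl sub0r => /(_ Tup Tlo); lra.
rewrite -subr_gt0 -(pmulr_rgt0 _ D0).
have -> : D * ((2 * p * S) ^+ 2 - (a * s - p ^+ 2 * (p - 1)) ^+ 2) =
    (p - 1) * ((2 * p ^+ 2 * k) ^+ 2 - T ^+ 2).
  have SE' : S ^+ 2 = (s + p - 1) * s by rewrite SE /s; ring.
  have -> : (2 * p * S) ^+ 2 = 4 * p ^+ 2 * ((s + p - 1) * s) by rewrite -SE'; ring.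
  have -> : (2 * p ^+ 2 * k) ^+ 2 = 4 * p ^+ 4 * ((p - 1) * (n - 1)) by rewrite -kE; ring.
  by rewrite /T /D /a; ring.
by rewrite mulr_gt0// subr_gt0.
Qed.

End exponents.

Section young.
Context (R : realType).
Implicit Types (a b c g p q t : R).

Lemma powR_mul2 a p : 0 <= a -> 2 <= p -> a `^ (p - 2) * a ^+ 2 = a `^ p.
Proof.
move=> a0 p2; rewrite -powR_mulrn// -powRD ?subrK//.
by apply/implyP => /eqP; lra.
Qed.

(** To be read with a = H(Du), b = |u| and t = |grad z| / z: these are the two error terms left by
    the tests, each divided by z^2. The exponent r is the one dictated by scaling. *)
Lemma young_scaling p q g (r := p * (q + g) / (q - p + 1)) (eps : R) :
  2 <= p -> p - 1 < q -> 1 < g -> 0 < eps ->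
  exists2 C, 0 <= C & forall a b t, 0 <= a -> 0 <= b -> 0 <= t ->
    let E := eps * (a `^ p * b `^ (g - 1) + b `^ (q + g)) + C * t `^ r in
    a `^ (p - 1) * b `^ g * t <= E /\ a `^ (p - 2) * b `^ (g + 1) * t ^+ 2 <= E.
Proof.
move=> p2 pq g1 e0.
have s0 : 0 < q - p + 1 by lra.
have p0 : 0 < p by lra.
pose d := Num.min 1 eps.
have d0 : 0 < d by rewrite lt_min ltr01.
have d1 : d <= 1 by rewrite ge_min lexx.
have de : d <= eps by rewrite ge_min lexx orbT.
pose K := d `^ (1 - p).
have K0 : 0 < K by exact: powR_gt0.
(* Replacing a by b t / d costs at most K = d^(1 - p) in both terms, since d <= 1; h is the solution
   of K h^p = eps, so that the case t <= h b^th costs exactly eps. *)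
pose h := (eps / K) `^ p^-1.
have h0 : 0 < h by rewrite powR_gt0// divr_gt0.
have hp : K * h `^ p = eps.
  by rewrite /h -powRrM mulVf ?gt_eqF// powRr1 ?divr_ge0 ?ltW// mulrC divfK// gt_eqF.
pose th := (q - p + 1) / p.
have th0 : 0 < th by rewrite divr_gt0.
pose m := (p - 1 + g) / th.
exists (K * h `^ (- m)); first by rewrite mulr_ge0 ?powR_ge0// ltW.
move=> a b t a0 b0 t0 E.
have bg : b `^ g = b * b `^ (g - 1) by rewrite mulr_powRB1//; lra.
have bg1 : b `^ (g + 1) = b ^+ 2 * b `^ (g - 1).
  rewrite -{1}(_ : (g + 1 - 1) + 1 = g + 1); last by ring.
  rewrite [LHS](_ : _ = b * b `^ (g + 1 - 1)).
    by rewrite addrK bg expr2 mulrA.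
  by rewrite mulr_powRB1//; [rewrite subrK|lra].
have P0 (x y : R) : 0 <= x `^ y by exact: powR_ge0.
have X0 : 0 <= a `^ p * b `^ (g - 1) by rewrite mulr_ge0.
have C0 : 0 <= K * h `^ (- m) * t `^ r by rewrite !mulr_ge0// ltW.
have EX : eps * (a `^ p * b `^ (g - 1)) <= E.
  by rewrite /E mulrDr -addrA lerDl addr_ge0// mulr_ge0// ltW.
(* If b t <= d a the first term of E dominates; otherwise the powers of a are
   traded for powers of b t, and t is compared with h b^th, where th is the
   exponent that balances b^(p - 1 + g) t^p with b^(q + g) and with t^r. *)
have [bta|abt] := leP (b * t) (d * a).
  split; apply: le_trans EX.
    rewrite bg (_ : _ * t = a `^ (p - 1) * b `^ (g - 1) * (b * t)); last by ring.
    rewrite (@le_trans _ _ (a `^ (p - 1) * b `^ (g - 1) * (d * a)))//.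
      by rewrite ler_wpM2l// mulr_ge0.
    rewrite (_ : _ * (d * a) = d * ((a * a `^ (p - 1)) * b `^ (g - 1))); last by ring.
    by rewrite mulr_powRB1// ler_wpM2r.
  rewrite bg1 (_ : _ * t ^+ 2 = a `^ (p - 2) * b `^ (g - 1) * (b * t) ^+ 2); last by ring.
  rewrite (@le_trans _ _ (a `^ (p - 2) * b `^ (g - 1) * (d * a) ^+ 2))//.
    by rewrite ler_wpM2l ?mulr_ge0// ler_pXn2r ?nnegrE ?mulr_ge0// ltW.
  rewrite (_ : _ * (d * a) ^+ 2 = d ^+ 2 * ((a `^ (p - 2) * a ^+ 2) * b `^ (g - 1))); last by ring.
  by rewrite powR_mul2// ler_wpM2r// expr2 (le_trans _ de)// ler_piMl// ltW.
have bt0 : 0 <= b * t by rewrite mulr_ge0.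
have aE : a <= d^-1 * (b * t) by rewrite -ler_pdivrMl ?invr_gt0// invrK ltW.
pose Z := b `^ (p - 1 + g) * t `^ p.
have bnd1 : a `^ (p - 1) * b `^ g * t <= K * Z.
  rewrite (@le_trans _ _ ((d^-1 * (b * t)) `^ (p - 1) * b `^ g * t))//.
    rewrite ler_wpM2r// ler_wpM2r// ge0_ler_powR ?nnegrE ?mulr_ge0 ?invr_ge0 ?(ltW d0)//; lra.
  rewrite !powRM ?invr_ge0 ?(ltW d0)// -powR_inv1 ?(ltW d0)// -powRrM.
  rewrite (_ : -1 * (p - 1) = 1 - p); last by ring.
  rewrite /Z /K [b `^ (_ + g)]powRD; last by apply/implyP => /eqP; lra.
  rewrite -(mulr_powRB1 t0 p0); rewrite le_eqVlt; apply/orP; left; apply/eqP; ring.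
have bnd2 : a `^ (p - 2) * b `^ (g + 1) * t ^+ 2 <= K * Z.
  rewrite (@le_trans _ _ ((d^-1 * (b * t)) `^ (p - 2) * b `^ (g + 1) * t ^+ 2))//.
    rewrite ler_wpM2r ?sqr_ge0// ler_wpM2r// ge0_ler_powR ?nnegrE ?mulr_ge0 ?invr_ge0 ?(ltW d0)//; lra.
  rewrite !powRM ?invr_ge0 ?(ltW d0)// -powR_inv1 ?(ltW d0)// -powRrM.
  rewrite (_ : -1 * (p - 2) = 2 - p); last by ring.
  rewrite /Z (_ : p - 1 + g = (p - 2) + (g + 1)); last by ring.
  rewrite [b `^ (_ + (g + 1))]powRD; last by apply/implyP => /eqP; lra.
  rewrite -(powR_mul2 t0 p2).
  rewrite (_ : _ * t ^+ 2 = d `^ (2 - p) * (b `^ (p - 2) * b `^ (g + 1) * (t `^ (p - 2) * t ^+ 2))); last by ring.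
  rewrite ler_wpM2r ?mulr_ge0 ?sqr_ge0//.
  by apply: ger_powR; [rewrite d0 d1|lra].
suff KZ : K * Z <= E by split; [exact: le_trans bnd1 KZ|exact: le_trans bnd2 KZ].
have [tb|bt] := leP t (h * b `^ th).
  have tp : t `^ p <= h `^ p * b `^ (q - p + 1).
    rewrite (@le_trans _ _ ((h * b `^ th) `^ p))//.
      by rewrite ge0_ler_powR ?nnegrE ?mulr_ge0// ltW.
    by rewrite powRM ?(ltW h0)// -powRrM /th divfK// gt_eqF.
  rewrite (@le_trans _ _ (eps * b `^ (q + g)))//; last first.
    by rewrite /E mulrDr -addrA addrCA lerDl addr_ge0// mulr_ge0// ltW.
  rewrite (_ : q + g = (p - 1 + g) + (q - p + 1)); last by ring.
  rewrite powRD; last by apply/implyP => /eqP; lra.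
  rewrite -hp /Z (_ : K * h `^ p * _ = K * (b `^ (p - 1 + g) * (h `^ p * b `^ (q - p + 1)))); last by ring.
  by rewrite ler_wpM2l ?(ltW K0)// ler_wpM2l.
have bm : b `^ (p - 1 + g) <= h `^ (- m) * t `^ m.
  have -> : h `^ (- m) * t `^ m = (h^-1 * t) `^ m.
    have hi : 0 <= h^-1 by rewrite invr_ge0 ltW.
    rewrite [RHS](powRM _ hi t0); congr (_ * _).
    by rewrite -(powR_inv1 (ltW h0)) -powRrM mulN1r.
  have -> : b `^ (p - 1 + g) = (b `^ th) `^ m.
    by rewrite -powRrM /m mulrC divfK// gt_eqF.
  rewrite ge0_ler_powR ?nnegrE ?mulr_ge0 ?invr_ge0 ?(ltW h0)//.
  - lra.
  - exact: ltW.
  - by rewrite -ler_pdivrMl ?invr_gt0// invrK ltW.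
rewrite (@le_trans _ _ (K * h `^ (- m) * t `^ r))//; last first.
  by rewrite /E lerDr mulr_ge0 ?(ltW e0)// addr_ge0.
rewrite -mulrA ler_wpM2l ?(ltW K0)// /Z (_ : r = m + p); last first.
  by rewrite /r /m /th; field; rewrite !gt_eqF.
rewrite [t `^ (m + p)]powRD; last first.
  apply/implyP => /eqP mp; have : 0 < m by rewrite divr_gt0//; lra.
  lra.
by rewrite mulrA ler_wpM2r.
Qed.

End young.

(** The quantifiers matter: eps is fixed before C, and C' depends on neither X, Y nor W, so the
    final estimate is uniform in the cut-off. *)
Lemma absorption (R : realType) (A k g q : R) : 0 <= A -> 0 <= k -> 0 < g -> 0 < q -> k < g * q ->
  exists2 eps, 0 < eps & forall C, 0 <= C -> exists2 C', 0 <= C' &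
    forall X Y W, 0 <= X -> 0 <= Y -> 0 <= W ->
      g * Y <= X + A * (eps * (X + Y) + C * W) ->
      q * X <= k * Y + A * (eps * (X + Y) + C * W) -> X <= C' * W.
Proof.
move=> A0 k0 g0 q0 kgq.
(* Eliminating Y leaves X with the coefficient (g - eta)(q - eta) - (k + eta)(1 + eta) = g q - k -
   eta (q + g + k + 1); this eta keeps half of g q - k. *)
pose eta := (g * q - k) / (2 * (q + g + k + 1)).
have D0 : 0 < q + g + k + 1 by lra.
have eta0 : 0 < eta by rewrite divr_gt0 ?subr_gt0// mulr_gt0.
have etaE : eta * (q + g + k + 1) = (g * q - k) / 2 by rewrite /eta; field; rewrite gt_eqF.
have etag : eta < g.
  rewrite /eta ltr_pdivrMr ?mulr_gt0//.
  have : 0 < g * g by rewrite mulr_gt0.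
  have : 0 <= g * k by rewrite mulr_ge0// ltW.
  have : 0 < g * q by rewrite mulr_gt0.
  lra.
exists (eta / (A + 1)); first by rewrite divr_gt0// ltr_wpDl.
move=> C C0; exists (2 * (k + g) * (A * C) / (g * q - k)).
  by rewrite divr_ge0 ?subr_ge0 ?(ltW kgq)// !mulr_ge0// addr_ge0// ltW.
move=> X Y W X0 Y0 W0.
have AE : A * (eta / (A + 1)) <= eta.
  by rewrite mulrA ler_pdivrMr ?ltr_wpDl// mulrC ler_pM2l// lerDl.
have -> : A * (eta / (A + 1) * (X + Y) + C * W) = A * (eta / (A + 1)) * (X + Y) + A * C * W by ring.
set V := A * C * W.
have V0 : 0 <= V by rewrite !mulr_ge0.
have h : A * (eta / (A + 1)) * (X + Y) <= eta * (X + Y) by rewrite ler_wpM2r// addr_ge0.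
move=> h1 h2.
have h1' : (g - eta) * Y <= (1 + eta) * X + V by lra.
have h2' : (q - eta) * X <= (k + eta) * Y + V by lra.
have h3 : (g - eta) * ((q - eta) * X) <= (k + eta) * ((1 + eta) * X + V) + (g - eta) * V.
  rewrite (@le_trans _ _ ((g - eta) * ((k + eta) * Y + V)))//.
    by rewrite ler_wpM2l// subr_ge0 ltW.
  rewrite mulrDr lerD2r mulrCA ler_wpM2l//; lra.
have h4 : (g * q - k) / 2 * X <= (k + g) * V.
  have -> : (g * q - k) / 2 * X = (g * q - k) * X - eta * (q + g + k + 1) * X by rewrite etaE; field.
  move: h3; lra.
rewrite mulrAC ler_pdivlMr ?subr_gt0//.
rewrite (_ : 2 * (k + g) * (A * C) * W = 2 * ((k + g) * V)); last by rewrite /V; ring.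
lra.
Qed.

(** * Signed powers and cut-offs *)

Section signed_power.
Context (R : realType).
Implicit Types (c s t x : R).

Lemma continuous_norm_powR c : 0 < c -> continuous (fun t : R => `|t| `^ c).
Proof.
move=> c0 t; have [->|t0] := eqVneq t 0.
  apply/cvgrPdist_le => e e0; rewrite normr0 powR0 ?gt_eqF//.
  have d0 : 0 < e `^ c^-1 by exact: powR_gt0.
  exists (e `^ c^-1) => //= y; rewrite /ball_/= !sub0r !normrN => yd.
  rewrite ger0_norm ?powR_ge0//.
  rewrite (@le_trans _ _ ((e `^ c^-1) `^ c))//.
    by rewrite ge0_ler_powR ?nnegrE ?(ltW c0) ?(ltW d0)// ltW.
  by rewrite -powRrM mulVf ?gt_eqF// powRr1// ltW.
have nt0 : 0 < `|t| by rewrite normr_gt0.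
apply: (@continuous_comp _ _ _ (fun t : R => `|t|) (fun t => t `^ c)).
  exact: norm_continuous.
apply: differentiable_continuous; apply/derivable1_diffP; apply: derivable_powR.
by rewrite in_itv/= nt0.
Qed.

Definition spow s t : R := `|t| `^ (s - 1) * t.

Lemma is_derive_powR s x : 0 < x -> is_derive x 1 (fun y : R => y `^ s) (s * x `^ (s - 1)).
Proof.
move=> x0; have xI : x \in `]0, +oo[ by rewrite in_itv/= x0.
apply: DeriveDef; first exact: derivable_powR.
by rewrite -derive1E powR_derive1.
Qed.

(** Positive t is the rule for [powR], negative t follows by oddness, and at 0 the difference
    quotient is |h|^(s - 1), which tends to 0 because s > 1. The derivative is continuous, so
    composition preserves the class C^1. *)
Lemma is_derive_spow s t : 1 < s -> is_derive t 1 (spow s) (s * `|t| `^ (s - 1)).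
Proof.
move=> s1; have s0 : 0 < s by lra.
have pos x : 0 < x -> is_derive x 1 (spow s) (s * `|x| `^ (s - 1)).
  move=> x0; rewrite gtr0_norm//.
  apply: near_eq_is_derive (is_derive_powR s x0); near=> y.
  have y0 : 0 < y by near: y; exact: lt_nbhsr.
  by rewrite /spow gtr0_norm// mulrC mulr_powRB1// ltW.
have [t0|t0|->] := ltgtP t 0; [|exact: pos|].
- have := pos (- t); rewrite oppr_gt0 normrN => /(_ t0) dt.
  have -> : spow s = (fun y => - spow s (- y)).
    by apply/funext => y; rewrite /spow normrN mulrN opprK.
  have d1 : is_derive t 1 (-%R : R -> R) (-1) by exact: is_deriveNid.
  have d2 : is_derive t 1 (spow s \o -%R) (s * `|t| `^ (s - 1) * -1) by exact: is_derive1_comp.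
  have := is_deriveN d2; rewrite mulrN1 opprK; exact.
- have q : h^-1 *: ((spow s \o shift 0) (h *: (1 : R)) - spow s 0) @[h --> (0 : R)^'] --> (0 : R).
    have c : `|h| `^ (s - 1) @[h --> (0 : R)^'] --> (0 : R).
      have s10 : 0 < s - 1 by lra.
      have c0 : `|h| `^ (s - 1) @[h --> (0 : R)] --> `|0 : R| `^ (s - 1).
        exact: (@continuous_norm_powR (s - 1) s10 0).
      by move: c0; rewrite normr0 powR0 ?gt_eqF//; exact: cvg_within_filter.
    apply: cvg_trans c; apply: near_eq_cvg.
    have : \forall h \near (0 : R)^', h != 0 by exact: nbhs_dnbhs_neq.
    apply: filterS => h h0; rewrite /spow /= mulr0 subr0 addr0 /GRing.scale/= mulr1.
    by rewrite mulrCA mulVf// mulr1.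
  apply: DeriveDef; first by apply/cvg_ex; exists 0.
  rewrite normr0 powR0 ?subr_eq0 ?gt_eqF// mulr0; exact: cvg_lim q.
Unshelve. all: by end_near. Qed.

Lemma continuous_spow s : 1 < s -> continuous (spow s).
Proof.
move=> s1 t; apply: differentiable_continuous; apply/derivable1_diffP.
by have [] := is_derive_spow t s1.
Qed.

Lemma continuous_spow_derivative s : 1 < s -> continuous (fun t => s * `|t| `^ (s - 1)).
Proof.
move=> s1 t; have s0 : 0 < s - 1 by lra.
have cc : continuous (fun _ : R => s) by exact: cst_continuous.
exact: (continuousM (cc t) (@continuous_norm_powR (s - 1) s0 t)).
Qed.

Lemma norm_spow s t : 0 < s -> `|spow s t| = `|t| `^ s.
Proof.
by move=> s0; rewrite normrM ger0_norm ?powR_ge0// mulrC mulr_powRB1.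
Qed.

Lemma spow_sqr s t : 0 < s -> spow s t ^+ 2 = `|t| `^ (2 * s).
Proof.
move=> s0; rewrite -real_normK ?num_real// norm_spow// -powR_mulrn ?powR_ge0//.
by rewrite -powRrM mulrC.
Qed.

End signed_power.

Section cutoff.
Context (R : realType) (n : nat).
Implicit Types (x : 'rV[R]_n).

Lemma is_derive_exprn (k : nat) (t : R) :
  is_derive t 1 (fun y : R => y ^+ k) (k%:R * t ^+ k.-1).
Proof.
apply: DeriveDef; first exact: exprn_derivable.
by rewrite exp_derive /GRing.scale/= mulr1.
Qed.

(* z = s^(2 m) with m >= r, where s^2 is a bump: the ratio |grad z| / z blows up
   like 1 / s at the edge of the support, and z^2 = s^(4 m) absorbs s^(-r). *)
Lemma cutoff_exists (r : R) : 0 < r -> exists2 K, 0 <= K & forall rho : R, 0 < rho ->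
  exists z : 'rV[R]_n -> R,
  [/\ C1_on setT z, forall x, 0 <= z x <= K,
      forall x, n%:R * `|x| ^+ 2 <= rho ^+ 2 -> 1 <= z x,
      forall x, ~ cube n (2 * rho) x -> z x = 0 /\ grad z x = 0 &
      forall x, exists2 t, 0 <= t &
        `|grad z x| <= z x * t /\ z x ^+ 2 * t `^ r <= K * rho `^ (- r)].
Proof.
move=> r0; have [k kr] : exists k : nat, r <= k.+1%:R.
  exists (Num.Def.archi_bound r); rewrite (le_trans (ltW (archi_boundP (ltW r0))))//.
  by rewrite ler_nat.
pose m := k.+1.
have m1 : 1 <= m%:R :> R by rewrite ler1n.
pose A : R := (8 * m%:R) `^ r * 2 ^+ (4 * m).
have A0 : 0 <= A by rewrite mulr_ge0 ?powR_ge0// exprn_ge0.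
have B0 : 0 <= 4 ^+ m :> R by rewrite exprn_ge0.
exists (4 ^+ m + A); first by rewrite addr_ge0.
move=> rho rho0.
pose s x := posp (2 - rho ^- 2 * dotv x x).
have s0 x : 0 <= s x by exact: posp_ge0.
have ri0 : 0 < rho ^- 2 by rewrite invr_gt0 exprn_gt0.
have s2 x : s x <= 2.
  by rewrite /s /posp ge_max ler0n/= gerBl mulr_ge0 ?dotv_ge0// ltW.
pose z := (fun t : R => t ^+ m) \o @bump R n 2 (rho ^- 2).
have zE x : z x = (s x) ^+ (2 * m) by rewrite /z/= /bump -/(s x) -exprM.
have gz x : grad z x = (m%:R * (s x ^+ 2) ^+ k) *: bump_grad 2 (rho ^- 2) x.
  have [db gb] := bump_differentiable 2 (rho ^- 2) x.
  by have [_ ->] := grad_comp db (is_derive_exprn m); rewrite gb.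
exists z; split.
- apply: (C1_comp (F' := fun t => m%:R * t ^+ k)).
  + exact: bump_C1.
  + have cc : continuous (fun _ : R => m%:R : R) by exact: cst_continuous.
    by move=> t; exact: (continuousM (cc t) (@exprn_continuous _ k t)).
  + exact: is_derive_exprn.
- move=> x; rewrite zE exprn_ge0//= (le_trans _ (_ : 4 ^+ m <= _)) ?lerDl//.
  by rewrite exprM ler_pXn2r ?nnegrE ?exprn_ge0// (_ : 4 = 2 ^+ 2) ?ler_pXn2r ?nnegrE//; ring.
- move=> x xr; have d1 : rho ^- 2 * dotv x x <= 1.
    rewrite ler_pdivrMl ?exprn_gt0// mulr1 (le_trans _ xr)//.
    by rewrite (le_trans (ler_norm _))// expr2 dotv_le.
  by rewrite zE exprn_ege1// /s ge0_posp; lra.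
- move=> x xr.
  have sx : s x = 0.
    apply: bump_eq0 => //; rewrite ler_pdivlMl ?exprn_gt0//.
    have {}xr : 2 * rho < `|x| by rewrite ltNge; apply/negP.
    by nra.
  by rewrite gz zE /bump_grad -/(s x) sx !mulr0 expr0n/= oppr0 scale0r scaler0.
- move=> x; have [sx|sx] := eqVneq (s x) 0.
    exists 0 => //; rewrite gz zE /bump_grad -/(s x) sx !mulr0 oppr0 scale0r scaler0 normr0.
    by rewrite !expr0n/= mul0r mulr_ge0 ?powR_ge0// addr_ge0.
  have {sx}sx : 0 < s x by rewrite lt_neqAle eq_sym sx s0.
  have xr : `|x| <= 2 * rho.
    have : 0 < 2 - rho ^- 2 * dotv x x.
      by move: sx; rewrite /s /posp lt_max ltxx.
    rewrite subr_gt0 ltr_pdivrMl ?exprn_gt0// => dx.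
    have := normsq_le_dotv x; have := normr_ge0 x; move: dx rho0; nra.
  (* By the chain rule |grad z| = 4 m s^(2 m - 1) |x| / rho^2, and |x| <= 2 rho on the support;
     dividing by z = s^(2 m) leaves this quotient. *)
  pose t := 8 * m%:R / (rho * s x).
  have t0 : 0 < t by rewrite divr_gt0 ?mulr_gt0// ltr0n.
  exists t; first exact: ltW.
  split.
    rewrite gz zE [`|_ *: bump_grad _ _ _|]normrZ /bump_grad -/(s x) [`|_ *: x|]normrZ normrN.
    rewrite (ger0_norm (_ : 0 <= m%:R * _)); last by rewrite mulr_ge0// exprn_ge0// exprn_ge0.
    rewrite (ger0_norm (_ : 0 <= 4 * _ * _)); last by rewrite mulr_ge0// mulr_ge0// ltW.
    have -> : s x ^+ (2 * m) * t = m%:R * (s x ^+ 2) ^+ k * (4 * rho ^- 2 * s x * (2 * rho)).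
      rewrite /t exprM (exprSr _ k); move: (s x ^+ 2 ^+ k) (m%:R : R) => P M; field.
      by rewrite !gt_eqF.
    rewrite ler_wpM2l//; first by rewrite mulr_ge0// exprn_ge0// exprn_ge0.
    by rewrite ler_wpM2l// mulr_ge0// mulr_ge0// ltW.
  rewrite zE -exprM (_ : (2 * m * 2 = 4 * m)%N); last by rewrite mulnAC.
  have -> : t `^ r = (8 * m%:R) `^ r * (rho `^ (- r) * s x `^ (- r)).
    have rs0 : 0 <= rho * s x by rewrite mulr_ge0 ?(ltW rho0) ?(ltW sx).
    rewrite /t [LHS]powRM ?invr_ge0// ?mulr_ge0//; congr (_ * _).
    by rewrite -(powR_inv1 rs0) -powRrM mulN1r powRM ?(ltW rho0) ?(ltW sx).
  rewrite [leLHS]mulrCA [X in _ * X <= _]mulrCA [leLHS]mulrCA.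
  (* The exponent 4 m - r is nonnegative because r <= m, so s <= 2 gives a bound that does not
     degenerate where s tends to 0. *)
  have sb : s x ^+ (4 * m) * s x `^ (- r) <= 2 ^+ (4 * m).
    rewrite -powR_mulrn ?(ltW sx)// -powRD ?(gt_eqF sx) ?implybT//.
    have rm : 0 <= (4 * m)%:R - r.
      rewrite natrM subr_ge0 (le_trans kr)// -/m; lra.
    rewrite (le_trans (ge0_ler_powR rm _ _ (s2 x))) ?nnegrE ?(ltW sx)//.
    rewrite -powR_mulrn//; apply: ler_powR; [lra|by rewrite gerBl ltW].
  rewrite [leLHS]mulrC ler_wpM2r ?powR_ge0//.
  rewrite (le_trans (ler_wpM2l (powR_ge0 _ _) sb))// /A lerDr.
  by rewrite exprn_ge0.
Qed.

End cutoff.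

(** * Test functions built from the solution *)

Section integration_on_cubes.
Context (R : realType) (n : nat).
Local Notation mu := (lebesgue_rV R n).
Implicit Types (f g : 'rV[R]_n -> R) (D : set 'rV[R]_n).

Lemma dominated_Rintegral D (f_ : nat -> 'rV[R]_n -> R) f g : measurable D ->
  (forall k, measurable_fun setT (f_ k)) -> measurable_fun setT f ->
  mu.-integrable D (EFin \o g) ->
  {ae mu, forall x, D x -> f_ k x @[k --> \oo] --> f x} ->
  {ae mu, forall x, D x -> forall k, `|f_ k x| <= g x} ->
  mu.-integrable D (EFin \o f) /\
  \int[mu]_(x in D) f_ k x @[k --> \oo] --> \int[mu]_(x in D) f x.
Proof.
move=> mD mf_ mf gi ff fg.
have [| | | |fi _ fl] := @dominated_convergence _ _ R mu D mD
  (fun k => EFin \o f_ k) (EFin \o f) (EFin \o g) _ _ _ gi _.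
- by move=> k; apply/measurable_EFinP; exact: measurable_funTS.
- by apply/measurable_EFinP; exact: measurable_funTS.
- by apply: filterS ff => x /[apply] fx; apply/fine_cvgP; split => //; exact: nearW.
- by apply: filterS fg => x fx k Dx; rewrite lee_fin fx.
split=> //; apply: fine_cvg; rewrite fineK//.
exact: integrable_fin_num.
Qed.

(** Obtained as dominated convergence for a constant sequence, which accepts a bound that holds only
    almost everywhere. *)
Lemma ae_le_integrable D f g : measurable D -> measurable_fun setT f ->
  mu.-integrable D (EFin \o g) -> {ae mu, forall x, D x -> `|f x| <= g x} ->
  mu.-integrable D (EFin \o f).
Proof.
move=> mD mf gi fg.
have [||] := @dominated_Rintegral D (fun=> f) f g mD (fun=> mf) mf gi.
- by apply: aeW => x _; exact: cvg_cst.
- by apply: filterS fg => x /[apply].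
- by [].
Qed.

Lemma ae_bounded_integrable r f (M : R) : measurable_fun setT f ->
  {ae mu, forall x, cube n r x -> `|f x| <= M} ->
  mu.-integrable (cube n r) (EFin \o f).
Proof.
move=> mf; apply: ae_le_integrable => //; first exact: measurable_cube.
by apply: integrable_cst_lty; [exact: measurable_cube|exact: lebesgue_rV_cube_fin].
Qed.

Lemma Rintegral_support D f : measurable D -> (forall x, ~ D x -> f x = 0) ->
  \int[mu]_x f x = \int[mu]_(x in D) f x.
Proof.
move=> mD f0; rewrite /Rintegral [in RHS]integral_mkcond; congr fine.
apply: eq_integral => x _; rewrite patchE; case: ifPn => //.
by rewrite notin_setE => /f0 ->.
Qed.

Lemma integrable_EFinD D f g : measurable D -> mu.-integrable D (EFin \o f) ->
  mu.-integrable D (EFin \o g) -> mu.-integrable D (EFin \o (fun x => f x + g x)).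
Proof.
move=> mD fi gi; have := integrableD mD fi gi; exact: eq_integrable.
Qed.

Lemma integrable_EFinZ D f (a : R) : measurable D -> mu.-integrable D (EFin \o f) ->
  mu.-integrable D (EFin \o (fun x => a * f x)).
Proof.
move=> mD fi; have := integrableZl mD a fi; exact: eq_integrable.
Qed.

Lemma measurable_norm_powR p f : measurable_fun setT f ->
  measurable_fun setT (fun x => `|f x| `^ p).
Proof.
by move=> mf; apply: (measurableT_comp (measurable_powR p)); exact: measurableT_comp.
Qed.

Lemma Lp_loc_integrable_powR p f : Lp_loc p f -> loc_integrable (fun x => `|f x| `^ p).
Proof.
move=> [mf fi]; split; first by apply: measurable_norm_powR.
by move=> r; apply: fi; exact: compact_cube.
Qed.

Lemma Lp_loc_integrable p f : 1 <= p -> Lp_loc p f -> loc_integrable f.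
Proof.
move=> p1 fp; have [mf _] := fp; have [_ fi] := Lp_loc_integrable_powR fp; split => // r.
have mQ := measurable_cube n r.
apply: (@ae_le_integrable _ _ (fun x => 1 + `|f x| `^ p)) => //.
  apply: integrable_EFinD => //.
  by apply: integrable_cst_lty => //; exact: lebesgue_rV_cube_fin.
apply: aeW => x _; have [f1|f1] := leP `|f x| 1.
  by rewrite (le_trans f1)// lerDl powR_ge0.
rewrite (@le_trans _ _ (`|f x| `^ p))//; last by rewrite lerDr.
by rewrite -{1}[`|f x|]powRr1// ler_powR// ltW.
Qed.

Lemma measurable_norm_rV (F : 'rV[R]_n -> 'rV[R]_n) : measurable_fun setT F ->
  measurable_fun setT (fun x => `|F x|).
Proof.
move=> mF; apply: (@measurableT_comp _ _ _ _ _ _ (fun y : 'rV[R]_n => `|y|)) => //.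
by apply: continuous_measurable_rV; exact: norm_continuous.
Qed.

Lemma norm_rV_powR_le (p : R) (x : 'rV[R]_n) (G : R) : 0 < p -> 0 <= G ->
  (forall i, `|x 0 i| `^ p <= G) -> `|x| `^ p <= G.
Proof.
move=> p0 G0 xG; have : `|x| <= G `^ p^-1.
  apply: norm_rV_le => [|i]; first exact: powR_ge0.
  rewrite -[`|x 0 i|]powRr1// -(mulfV (lt0r_neq0 p0)) powRrM.
  by rewrite ge0_ler_powR ?invr_ge0 ?(ltW p0) ?nnegrE ?powR_ge0.
move=> /(ge0_ler_powR (ltW p0)); rewrite !nnegrE normr_ge0 powR_ge0 => /(_ isT isT).
by rewrite -powRrM mulVf ?gt_eqF// powRr1.
Qed.

Lemma norm_powR_integrable p (F : 'rV[R]_n -> 'rV[R]_n) : 0 < p ->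
  (forall i, Lp_loc p (fun x => F x 0 i)) ->
  loc_integrable (fun x => `|F x| `^ p).
Proof.
move=> p0 Fp; have mF : measurable_fun setT F.
  by apply: measurable_fun_rVP => i; have [] := Fp i.
split; first by apply: (measurableT_comp (measurable_powR p)); exact: measurable_norm_rV.
move=> r; have mQ := measurable_cube n r.
apply: (@ae_le_integrable _ _ (fun x => \sum_(i < n) `|F x 0 i| `^ p)) => //.
- by apply: (measurableT_comp (measurable_powR p)); exact: measurable_norm_rV.
- rewrite (_ : EFin \o _ = (fun x => \sum_(i < n) (`|F x 0 i| `^ p)%:E)%E).
    apply: integrable_sum => // i _.
    by have [_] := Lp_loc_integrable_powR (Fp i); exact.
  by apply/funext => x /=; rewrite sumEFin.
- apply: aeW => x _; rewrite ger0_norm ?powR_ge0//.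
  apply: norm_rV_powR_le => // [|i]; first by apply: sumr_ge0 => i _; exact: powR_ge0.
  by rewrite (bigD1 i)//= lerDl; apply: sumr_ge0 => j _; exact: powR_ge0.
Qed.

End integration_on_cubes.

Section test_functions.
Context (R : realType) (n : nat) (p s : R).
Context (u : 'rV[R]_n -> R) (Du : 'rV[R]_n -> 'rV[R]_n) (z : 'rV[R]_n -> R) (r : R).
Local Notation mu := (lebesgue_rV R n).
Hypotheses (p2 : 2 <= p) (s1 : 1 < s).
Hypotheses (Wu : W1p_loc p u Du) (Lu : Linfty_loc u).
Hypotheses (C1z : C1_on setT z)
  (z0 : forall x, ~ cube n r x -> z x = 0 /\ grad z x = 0).

(** The gradient that the chain rule predicts for [spow s u * z], with the weak gradient of u in
    place of a classical one. *)
Definition test_grad x : 'rV[R]_n :=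
  z x *: ((s * `|u x| `^ (s - 1)) *: Du x) + spow s (u x) *: grad z x.

Let mQ := measurable_cube n r.

Lemma test_gradE x i : test_grad x 0 i =
  z x * ((s * `|u x| `^ (s - 1)) * Du x 0 i) + spow s (u x) * grad z x 0 i.
Proof. by rewrite /test_grad !mxE. Qed.

Lemma C1_bounded f r' : C1_on setT f -> exists2 K, 0 <= K &
  forall x : 'rV[R]_n, cube n r' x -> `|f x| <= K /\ `|grad f x| <= K.
Proof.
move=> C1f; have bd (f' : 'rV[R]_n -> R) : continuous f' ->
    exists2 K, 0 <= K & forall x, cube n r' x -> `|f' x| <= K.
  move=> cf; have /compact_bounded[M [_ KM]] : compact (f' @` cube n r').
    apply: continuous_compact; last exact: compact_cube.
    exact: continuous_subspaceT.
  exists (`|M| + 1) => [|x Qx]; first by rewrite addr_ge0.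
  by apply: KM; [rewrite (le_lt_trans (ler_norm M))// ltrDl|exists x].
have [K K0 fK] := bd _ (C1_continuous C1f).
have /C1P[_ cg] := C1f.
have /choice[L hL] : forall i, exists L, 0 <= L /\ forall x, cube n r' x -> `|grad f x 0 i| <= L.
  by move=> i; have [L ? ?] := bd _ (cg i); exists L.
have L0 : 0 <= \sum_i L i by apply: sumr_ge0 => i _; have [] := hL i.
exists (K + \sum_i L i) => [|x Qx]; first by rewrite addr_ge0.
split; first by rewrite (le_trans (fK x Qx))// lerDl.
rewrite (@le_trans _ _ (\sum_i L i)) ?lerDr//.
apply: norm_rV_le => // i; have [_ /(_ x Qx) h] := hL i; rewrite (le_trans h)//.
by rewrite (bigD1 i)//= lerDl; apply: sumr_ge0 => j _; have [] := hL j.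
Qed.

Lemma measurable_test_grad : measurable_fun setT test_grad.
Proof.
have [[mu_ _] Dup _] := Wu; have mz := continuous_measurable_rV (C1_continuous C1z).
have /C1P[_ cg] := C1z.
apply: measurable_fun_rVP => i; under eq_fun do rewrite test_gradE.
apply: measurable_funD; apply: measurable_funM => //.
- apply: measurable_funM; last by have [] := Dup i.
  by apply: measurable_funM => //; exact: measurable_norm_powR.
- by apply: measurable_funM => //; exact: measurable_norm_powR.
- exact: continuous_measurable_rV.
Qed.

(** The signed power is applied to mollifications of u, which are C^1 and share the bound M of u on
    the cube of radius r + 1. Hence |v|^(s - 1) stays bounded and the gradients inherit the majorant
    found for those of the mollifications. *)
Lemma test_approximation : exists (f : nat -> 'rV[R]_n -> R) (K : R) G,
  [/\ forall k, C1c (f k),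
      forall k x, `|f k x| <= K,
      forall k x, ~ cube n r x -> f k x = 0 /\ grad (f k) x = 0,
      mu.-integrable (cube n r) (EFin \o G) &
      {ae mu, forall x, cube n r x ->
        [/\ f k x @[k --> \oo] --> spow s (u x) * z x,
            forall i, grad (f k) x 0 i @[k --> \oo] --> test_grad x 0 i &
            forall k, `|grad (f k) x| `^ p <= G x]}].
Proof.
have [up Dup wu] := Wu.
have p1 : 1 < p by rewrite (lt_le_trans _ p2)// ltr1n.
have p0 : 0 < p by exact: lt_trans p1.
have [mu_ /(_ _ (@compact_cube _ n (r + 1)))[M0 uM0]] := Lu.
pose M := Num.max M0 0.
have M_ge0 : 0 <= M by rewrite le_max lexx orbT.
have uM : {ae mu, forall x, cube n (r + 1) x -> `|u x| <= M}.
  by apply: filterS uM0 => x /[apply] h; rewrite le_max h.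
have [v [G [C1v vM mG iG lim]]] := sobolev_approximation p1 M_ge0
  (Lp_loc_integrable (ltW p1) up) (fun i => Lp_loc_integrable (ltW p1) (Dup i))
  (fun i => Lp_loc_integrable_powR (Dup i)) wu uM.
have [K K0 zK] := @C1_bounded z r C1z.
pose f k x := (spow s \o v k) x * z x.
have s0 : 0 < s by exact: lt_trans s1.
have C1f k : C1_on setT (f k).
  have d : forall t : R, is_derive t 1 (spow s) (s * `|t| `^ (s - 1)) by move=> t; exact: is_derive_spow.
  have C1s := @C1_comp _ _ _ _ _ (C1v k) (@continuous_spow_derivative _ s s1) d.
  exact: (@C1M _ _ _ _ C1s C1z).
have gf k x : grad (f k) x = z x *: ((s * `|v k x| `^ (s - 1)) *: grad (v k) x)
    + spow s (v k x) *: grad z x.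
  have [dv _] := C1v k x I; have [dz _] := C1z I (x := x).
  have [dc gc] := grad_comp dv (fun t : R => is_derive_spow t s1).
  by have [_ ->] := gradM dc dz; rewrite gc.
have gfi k x i : grad (f k) x 0 i = z x * ((s * `|v k x| `^ (s - 1)) * grad (v k) x 0 i)
    + spow s (v k x) * grad z x 0 i by rewrite gf !mxE.
have f0 k x : ~ cube n r x -> f k x = 0 /\ grad (f k) x = 0.
  by move=> /z0[zx gzx]; rewrite gf /f zx gzx mulr0 scale0r scaler0 addr0.
have vs k x c : 0 <= c -> cube n r x -> `|v k x| `^ c <= M `^ c.
  by move=> c0 Qx; rewrite ge0_ler_powR ?nnegrE// vM.
pose K1 := K * (s * M `^ (s - 1)).
have K10 : 0 <= K1 by rewrite !mulr_ge0 ?powR_ge0// ltW.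
pose K2 := M `^ s * K.
have K20 : 0 <= K2 by rewrite mulr_ge0 ?powR_ge0.
(* The gradient is at most K1 |grad v_k| + K2, hence at most twice the larger term; raising to the
   power p gives this majorant. *)
exists f, K2, (fun x => 2 `^ p * (K1 `^ p * `|G x| + K2 `^ p)); split; last 2 first.
- apply: integrable_EFinZ => //; apply: integrable_EFinD => //.
    by apply: integrable_EFinZ => //; apply: integrable_norm.
  by apply: integrable_cst_lty => //; exact: lebesgue_rV_cube_fin.
- apply: filterS lim => x limx Qx; have [vu gvu gvG] := limx Qx.
  have cs : spow s (v k x) @[k --> \oo] --> spow s (u x).
    by apply: continuous_cvg vu; exact: continuous_spow.
  split.
  + by apply: cvgM => //; exact: cvg_cst.
  + move=> i; under eq_fun do rewrite gfi.
    rewrite test_gradE; apply: cvgD; last by apply: cvgM => //; exact: cvg_cst.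
    apply: cvgM; first exact: cvg_cst.
    apply: cvgM; last exact: gvu.
    by apply: (@continuous_cvg _ _ _ _ _ _ (fun t : R => s * `|t| `^ (s - 1))) vu;
      exact: continuous_spow_derivative.
  + move=> k; rewrite gf.
    have [zx gzx] := zK x Qx.
    have gG : `|grad (v k) x| `^ p <= `|G x|.
      by apply: norm_rV_powR_le => // i; rewrite (le_trans (gvG k i))// ler_norm.
    have b1 : `|z x *: ((s * `|v k x| `^ (s - 1)) *: grad (v k) x)| <= K1 * `|grad (v k) x|.
      rewrite scalerA normrZ ler_wpM2r// normrM ler_pM//.
      rewrite ger0_norm ?mulr_ge0 ?powR_ge0 ?(ltW s0)// ler_wpM2l ?(ltW s0)//.
      by apply: vs => //; rewrite subr_ge0 ltW.
    have b2 : `|spow s (v k x) *: grad z x| <= K2.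
      by rewrite normrZ norm_spow// ler_pM ?powR_ge0//; apply: vs => //; exact: ltW.
    rewrite (@le_trans _ _ ((2 * Num.max (K1 * `|grad (v k) x|) K2) `^ p))//.
      rewrite ge0_ler_powR ?nnegrE ?mulr_ge0 ?le_max ?K20 ?orbT ?(ltW p0)//.
      rewrite (le_trans (ler_normD _ _))// mulr2n mulrDl !mul1r.
      by rewrite lerD// le_max ?b1 ?b2 ?orbT.
    rewrite powRM ?le_max ?K20 ?orbT// ler_wpM2l ?powR_ge0//.
    rewrite maxEle; case: ifPn => _; first by rewrite lerDr mulr_ge0 ?powR_ge0.
    rewrite powRM// (@le_trans _ _ (K1 `^ p * `|G x|))//; first by rewrite ler_wpM2l ?powR_ge0.
    by rewrite lerDl powR_ge0.
- move=> k; split; first exact: C1f.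
  apply: (subclosed_compact _ (@compact_cube R n r)); first exact: closed_closure.
  rewrite [X in _ `<=` X](closure_id (cube n r)).1; last exact: closed_cube.
  apply: closure_subset => x /= fx.
  by apply: contrapT => /(f0 k)[fx0 _]; rewrite fx0 eqxx in fx.
- move=> k x; have [Qx|Qx] := pselect (cube n r x).
    by rewrite normrM norm_spow// ler_pM ?powR_ge0//; [apply: vs => //; exact: ltW|have [] := zK x Qx].
  by have [-> _] := f0 k x Qx; rewrite normr0.
- exact: f0.
Qed.

End test_functions.

Section growth.
Context (R : realType) (n : nat).
Implicit Types (V : nat -> 'rV[R]_n) (v : 'rV[R]_n).

Lemma cvg_rV V v : (forall i, V k 0 i @[k --> \oo] --> v 0 i) -> V k @[k --> \oo] --> v.
Proof.
move=> Vv; apply/cvgrPdist_lt => e e0.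
have : \forall k \near \oo, forall i, `|v 0 i - V k 0 i| < e.
  by apply: filter_forall => i; have /cvgrPdist_lt := Vv i; exact.
by apply: filterS => k vk; apply: norm_rV_lt => // i; rewrite !mxE.
Qed.

(** The larger of a and b absorbs the other one. *)
Lemma powR_mixed_le (a b c d : R) : 0 <= a -> 0 <= b -> 0 <= c -> 0 <= d ->
  0 < c + d -> a `^ c * b `^ d <= a `^ (c + d) + b `^ (c + d).
Proof.
move=> a0 b0 c0 d0 cd.
have D t : t `^ (c + d) = t `^ c * t `^ d by rewrite powRD// gt_eqF.
have [ab|/ltW ba] := leP a b.
  apply: (@le_trans _ _ (b `^ (c + d))); last by rewrite lerDr powR_ge0.
  by rewrite D ler_wpM2r ?powR_ge0// ge0_ler_powR ?nnegrE.
apply: (@le_trans _ _ (a `^ (c + d))); last by rewrite lerDl powR_ge0.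
by rewrite D ler_wpM2l ?powR_ge0// ge0_ler_powR ?nnegrE.
Qed.

End growth.

(** * Growth, continuity and measurability of the three gradient integrands *)

Section integrands.
Context (R : realType) (n : nat) (H : 'rV[R]_n -> R) (p : R).
Hypotheses (p2 : 2 <= p) (normH : is_norm H) (C2H : C2_on [set x | x != 0] H).
Implicit Types (xi v : 'rV[R]_n).

Definition flux xi v : R := H xi `^ (p - 1) * dotv (grad H xi) v.

Definition stab_grad xi v : R := if xi == 0 then 0 else
  (p - 1) * H xi `^ (p - 2) * dotv (grad H xi) v ^+ 2.

Definition stab_hess xi v : R := if xi == 0 then 0 else
  H xi `^ (p - 1) * hess_form H xi v v.

Let p1 : 0 < p - 1. Proof. by rewrite subr_gt0 (lt_le_trans _ p2)// ltr1n. Qed.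
Let p2' : 0 <= p - 2. Proof. by rewrite subr_ge0. Qed.

Let B := finsler_bound H.
Let B0 : 0 <= B. Proof. exact: finsler_bound_ge0. Qed.

Let HpB xi c : 0 <= c -> H xi `^ c <= B `^ c * `|xi| `^ c.
Proof.
move=> c0; rewrite -powRM// ge0_ler_powR ?nnegrE ?mulr_ge0 ?(finsler_ge0 normH)//.
exact: finsler_le.
Qed.

Let dotB xi v : xi != 0 -> `|dotv (grad H xi) v| <= B * `|v|.
Proof. by move=> x0; rewrite (le_trans (finsler_grad_le normH C2H v x0))// finsler_le. Qed.

Lemma flux_le xi v : `|flux xi v| <= (B `^ (p - 1) * B) * (`|xi| `^ p + `|v| `^ p).
Proof.
have C0 : 0 <= B `^ (p - 1) * B by rewrite mulr_ge0 ?powR_ge0.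
have [->|x0] := eqVneq xi 0.
  rewrite /flux finsler0// powR0 ?gt_eqF// mul0r normr0 mulr_ge0// addr_ge0// powR_ge0//.
have := @powR_mixed_le R `|xi| `|v| (p - 1) 1 (normr_ge0 _) (normr_ge0 _) (ltW p1) ler01.
rewrite subrK powRr1// => /(_ (lt_le_trans (ltr0Sn _ 1) p2)) h.
rewrite /flux normrM ger0_norm ?powR_ge0// (le_trans (ler_pM _ _ (HpB xi (ltW p1)) (dotB v x0)))// ?powR_ge0//.
by rewrite mulrACA ler_wpM2l.
Qed.

Let mixed2 xi v : `|xi| `^ (p - 2) * `|v| ^+ 2 <= `|xi| `^ p + `|v| `^ p.
Proof.
have := @powR_mixed_le R `|xi| `|v| (p - 2) 2 (normr_ge0 _) (normr_ge0 _) p2' (ler0n _ 2).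
by rewrite subrK powR_mulrn//; apply; rewrite (lt_le_trans _ p2).
Qed.

Lemma stab_grad_le xi v :
  `|stab_grad xi v| <= ((p - 1) * B `^ (p - 2) * B ^+ 2) * (`|xi| `^ p + `|v| `^ p).
Proof.
have p10 := ltW p1.
have C0 : 0 <= (p - 1) * B `^ (p - 2) * B ^+ 2 by rewrite !mulr_ge0 ?powR_ge0.
rewrite /stab_grad; case: ifPn => [_|x0].
  by rewrite normr0 mulr_ge0// addr_ge0 ?powR_ge0.
apply: le_trans (ler_wpM2l C0 (mixed2 xi v)).
rewrite normrM ger0_norm ?mulr_ge0 ?powR_ge0// mulrACA ler_pM ?mulr_ge0 ?powR_ge0//.
  by rewrite -mulrA ler_wpM2l// HpB.
rewrite normrX -exprMn ler_pXn2r ?nnegrE ?mulr_ge0//; exact: dotB.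
Qed.

(** H times the Hessian is bounded, so H^(p - 1) D^2 H grows like H^(p - 2). The first bound keeps H
    and serves the pointwise energy estimate; the second has p-growth and serves dominated
    convergence. *)
Lemma stab_hess_le : exists2 C, 0 <= C & forall xi v,
  (`|stab_hess xi v| <= C * (H xi `^ (p - 2) * `|v| ^+ 2)) /\
  `|stab_hess xi v| <= (C * B `^ (p - 2)) * (`|xi| `^ p + `|v| `^ p).
Proof.
have [C C0 hC] := finsler_hess_bound normH C2H; exists C => // xi v.
have h1 : `|stab_hess xi v| <= C * (H xi `^ (p - 2) * `|v| ^+ 2).
  rewrite /stab_hess; case: ifPn => [_|x0].
    by rewrite normr0 !mulr_ge0 ?powR_ge0.
  rewrite normrM ger0_norm ?powR_ge0//.
  have -> : H xi `^ (p - 1) = H xi `^ (p - 2) * H xi.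
    rewrite -(mulr_powRB1 (finsler_ge0 normH xi) p1) mulrC; congr (_ `^ _ * _); ring.
  by rewrite -mulrA [leRHS]mulrCA ler_wpM2l ?powR_ge0// hC.
split=> //; rewrite (le_trans h1)// -mulrA ler_wpM2l//.
apply: le_trans (ler_wpM2l (powR_ge0 B (p - 2)) (mixed2 xi v)).
by rewrite [leRHS]mulrA ler_wpM2r// HpB.
Qed.

Lemma flux0 xi : flux xi 0 = 0.
Proof. by rewrite /flux dotv0r mulr0. Qed.

Lemma stab_grad0 xi : stab_grad xi 0 = 0.
Proof. by rewrite /stab_grad dotv0r expr0n/= mulr0 if_same. Qed.

Lemma stab_hess0 xi : stab_hess xi 0 = 0.
Proof. by rewrite /stab_hess /hess_form dotv0r mulr0 if_same. Qed.

Lemma continuous_flux xi : continuous (flux xi).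
Proof.
have cc (c : R) : continuous (fun _ : 'rV[R]_n => c) by exact: cst_continuous.
by move=> v; exact: (continuousM (cc _ v) (@dotv_continuous R n (grad H xi) v)).
Qed.

Lemma continuous_stab_grad xi : continuous (stab_grad xi).
Proof.
have cc (c : R) : continuous (fun _ : 'rV[R]_n => c) by exact: cst_continuous.
pose c := if xi == 0 then 0 else (p - 1) * H xi `^ (p - 2).
have -> : stab_grad xi = fun v => c * (dotv (grad H xi) v * dotv (grad H xi) v).
  by apply/funext => v; rewrite /stab_grad /c; case: ifP => _; rewrite ?mul0r.
move=> v; have cd := @dotv_continuous R n (grad H xi) v.
exact: (continuousM (cc _ v) (continuousM cd cd)).
Qed.

Lemma continuous_stab_hess xi : continuous (stab_hess xi).
Proof.
have cc (c : R) : continuous (fun _ : 'rV[R]_n => c) by exact: cst_continuous.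
pose c := if xi == 0 then 0 else H xi `^ (p - 1).
have -> : stab_hess xi =
    fun v => c * \sum_j dotv (col j (hess H xi))^T v * v 0 j.
  apply/funext => v; transitivity (c * hess_form H xi v v).
    by rewrite /stab_hess /c; case: ifP => _; rewrite ?mul0r.
  congr (_ * _); apply: eq_bigr => j _; congr (_ * _); rewrite mxE.
  by apply: eq_bigr => i _; rewrite [in RHS]mxE [in RHS]mxE mulrC.
have cs : continuous (fun v : 'rV[R]_n => \sum_j dotv (col j (hess H xi))^T v * v 0 j : R).
  apply: continuous_big => [x|j _ x]; first exact: add_continuous.
  by apply: continuousM; [exact: dotv_continuous|exact: coord_continuous].
by move=> v; exact: (continuousM (cc c v) (cs v)).
Qed.

Section measurability.
Context (X V : 'rV[R]_n -> 'rV[R]_n).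
Hypotheses (mX : measurable_fun setT X) (mV : measurable_fun setT V).

Let mcomp (g : 'rV[R]_n -> R) : (forall x, x != 0 -> {for x, continuous g}) ->
  measurable_fun setT (fun x => g (X x)).
Proof. by move=> /measurable_fun_neq0 mg; exact: (measurableT_comp mg mX). Qed.

Let mVi i : measurable_fun setT (fun x => V x 0 i).
Proof. exact: (measurableT_comp (measurable_coord_rV i) mV). Qed.

Let mH c : measurable_fun setT (fun x => H (X x) `^ c).
Proof.
apply: (measurableT_comp (measurable_powR c)); apply: mcomp => x _.
exact: continuous_finsler.
Qed.

Let mdot : measurable_fun setT (fun x => dotv (grad H (X x)) (V x)).
Proof.
rewrite /dotv; apply: measurable_sum => i; apply: measurable_funM => //.
by apply: (mcomp (g := fun y => grad H y 0 i)) => x x0; exact: finsler_grad_continuous.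
Qed.

Let mneq0 : measurable_fun setT (fun x => (X x != 0)%:R : R).
Proof.
apply: (mcomp (g := fun y => (y != 0)%:R)) => x x0.
have nF : Filter (nbhs x) := nbhs_filter x.
apply: cvg_near_cst; apply: filterS (nbhs_neq0 x0) => y y0.
by rewrite y0 x0.
Qed.

Lemma measurable_flux : measurable_fun setT (fun x => flux (X x) (V x)).
Proof. exact: measurable_funM. Qed.

Lemma measurable_stab_grad : measurable_fun setT (fun x => stab_grad (X x) (V x)).
Proof.
rewrite (_ : (fun x => _) = fun x => (X x != 0)%:R *
  ((p - 1) * H (X x) `^ (p - 2) * dotv (grad H (X x)) (V x) ^+ 2)).
  apply: measurable_funM => //; apply: measurable_funM; last exact: measurable_funX.
  exact: measurable_funM.
by apply/funext => x; rewrite /stab_grad; case: eqP => _; rewrite ?mul0r ?mul1r.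
Qed.

Lemma measurable_stab_hess : measurable_fun setT (fun x => stab_hess (X x) (V x)).
Proof.
rewrite (_ : (fun x => _) = fun x => (X x != 0)%:R *
  (H (X x) `^ (p - 1) * hess_form H (X x) (V x) (V x))).
  apply: measurable_funM => //; apply: measurable_funM => //.
  rewrite /hess_form /dotv; apply: measurable_sum => j; apply: measurable_funM => //.
  under eq_fun do rewrite mxE.
  apply: measurable_sum => i; apply: measurable_funM => //.
  by apply: (mcomp (g := fun y => hess H y i j)) => x x0; exact: finsler_hess_continuous.
by apply/funext => x; rewrite /stab_hess; case: eqP => _; rewrite ?mul0r ?mul1r.
Qed.

End measurability.

End integrands.

(** * Passage to the limit in the tested equation and in the stability inequality *)

Section passage_to_the_limit.
Context (R : realType) (n : nat) (p s : R).
Context (u : 'rV[R]_n -> R) (Du : 'rV[R]_n -> 'rV[R]_n) (z : 'rV[R]_n -> R) (r : R).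
Local Notation mu := (lebesgue_rV R n).
Hypotheses (p2 : 2 <= p).
Hypotheses (Wu : W1p_loc p u Du) (Lu : Linfty_loc u).
Hypotheses (C1z : C1_on setT z)
  (z0 : forall x, ~ cube n r x -> z x = 0 /\ grad z x = 0).

Let mQ := measurable_cube n r.

Local Notation V := (test_grad s u Du z).

Let mDu : measurable_fun setT Du.
Proof. by have [_ Dup _] := Wu; apply: measurable_fun_rVP => i; have [] := Dup i. Qed.

Let mV : measurable_fun setT V. Proof. exact: measurable_test_grad Wu C1z. Qed.

Variables (f : nat -> 'rV[R]_n -> R) (K : R) (G : 'rV[R]_n -> R).
Hypotheses (C1f : forall k, C1c (f k)) (fK : forall k x, `|f k x| <= K)
  (f0 : forall k x, ~ cube n r x -> f k x = 0 /\ grad (f k) x = 0)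
  (iG : mu.-integrable (cube n r) (EFin \o G))
  (lim : {ae mu, forall x, cube n r x ->
        [/\ f k x @[k --> \oo] --> spow s (u x) * z x,
            forall i, grad (f k) x 0 i @[k --> \oo] --> V x 0 i &
            forall k, `|grad (f k) x| `^ p <= G x]}).

Let mgf k : measurable_fun setT (grad (f k)).
Proof.
have [/C1P[_ cg] _] := C1f k.
by apply: measurable_fun_rVP => i; exact: continuous_measurable_rV.
Qed.

(** Stated for an abstract integrand because it serves [flux], [stab_grad] and [stab_hess] alike:
    growth of order p gives the majorant C (|Du|^p + G), and vanishing at 0 confines the integral to
    the cube. *)
Lemma gradient_term_limit (Phi : 'rV[R]_n -> 'rV[R]_n -> R) (C : R) :
  (forall W, measurable_fun setT W -> measurable_fun setT (fun x => Phi (Du x) (W x))) ->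
  (forall xi, continuous (Phi xi)) -> (forall xi, Phi xi 0 = 0) -> 0 <= C ->
  (forall xi v, `|Phi xi v| <= C * (`|xi| `^ p + `|v| `^ p)) ->
  mu.-integrable (cube n r) (EFin \o (fun x => Phi (Du x) (V x))) /\
  \int[mu]_x Phi (Du x) (grad (f k) x) @[k --> \oo] -->
    \int[mu]_(x in cube n r) Phi (Du x) (V x).
Proof.
move=> mPhi cPhi Phi0 C0 PhiC; have p0 : 0 < p by exact: lt_le_trans p2.
have E k : \int[mu]_x Phi (Du x) (grad (f k) x) =
    \int[mu]_(x in cube n r) Phi (Du x) (grad (f k) x).
  by apply: (@Rintegral_support _ _ (cube n r) (fun x => Phi (Du x) (grad (f k) x))) => // x /(f0 k)[_ ->].
rewrite (eq_cvg \oo _ E).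
apply: (dominated_Rintegral (g := fun x => C * (`|Du x| `^ p + G x))) => //.
- by move=> k; exact: mPhi.
- exact: mPhi.
- apply: integrable_EFinZ => //; apply: integrable_EFinD => //.
  by have [_ Dup _] := Wu; have [_] := norm_powR_integrable p0 Dup; exact.
- apply: filterS lim => x limx Qx; have [_ gfV _] := limx Qx.
  by apply: (@continuous_cvg _ _ _ _ _ _ (Phi (Du x))); [exact: cPhi|exact: cvg_rV].
- apply: filterS lim => x limx Qx k; have [_ _ gG] := limx Qx.
  by rewrite (le_trans (PhiC _ _))// ler_wpM2l// lerD2l.
Qed.

(** Here theta is the identity for the equation and the square for the stability form. *)
Lemma zero_order_term_limit (g : 'rV[R]_n -> R) (theta : R -> R) (M L : R) :
  measurable_fun setT g -> {ae mu, forall x, cube n r x -> `|g x| <= M} ->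
  continuous theta -> theta 0 = 0 -> (forall t, `|t| <= K -> `|theta t| <= L) ->
  mu.-integrable (cube n r) (EFin \o (fun x => g x * theta (spow s (u x) * z x))) /\
  \int[mu]_x (g x * theta (f k x)) @[k --> \oo] -->
    \int[mu]_(x in cube n r) (g x * theta (spow s (u x) * z x)).
Proof.
move=> mg gM ct t0 tL.
have mt : measurable_fun setT theta by exact: continuous_measurable_fun.
have E k : \int[mu]_x (g x * theta (f k x)) =
    \int[mu]_(x in cube n r) (g x * theta (f k x)).
  by apply: (@Rintegral_support _ _ (cube n r) (fun x => g x * theta (f k x))) => // x /(f0 k)[-> _]; rewrite t0 mulr0.
rewrite (eq_cvg \oo _ E).
have [[mu_ _] _ _] := Wu.
apply: (dominated_Rintegral (g := cst (M * L))) => //.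
- move=> k; apply: measurable_funM => //; apply: measurableT_comp => //.
  by apply: continuous_measurable_rV; apply: C1_continuous; have [] := C1f k.
- apply: measurable_funM => //; apply: measurableT_comp => //.
  apply: measurable_funM; last exact: continuous_measurable_rV (C1_continuous C1z).
  by apply: measurable_funM => //; exact: measurable_norm_powR.
- by apply: integrable_cst_lty => //; exact: lebesgue_rV_cube_fin.
- apply: filterS lim => x limx Qx; have [fu _ _] := limx Qx.
  by apply: cvgM; [exact: cvg_cst|apply: continuous_cvg fu; exact: ct].
- apply: filterS gM => x gMx Qx k.
  by rewrite normrM ler_pM//; [exact: gMx|exact: tL].
Qed.

End passage_to_the_limit.

Section test_identities.
Context (R : realType) (n : nat) (p q s : R) (H : 'rV[R]_n -> R).
Context (u : 'rV[R]_n -> R) (Du : 'rV[R]_n -> 'rV[R]_n) (z : 'rV[R]_n -> R) (r : R).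
Local Notation mu := (lebesgue_rV R n).
Hypotheses (p2 : 2 <= p) (pq : p - 1 < q) (s1 : 1 < s).
Hypotheses (normH : is_norm H) (C2H : C2_on [set x | x != 0] H).
Hypotheses (usol : weak_solution H p q u Du).
Hypotheses (C1z : C1_on setT z)
  (z0 : forall x, ~ cube n r x -> z x = 0 /\ grad z x = 0).

Local Notation V := (test_grad s u Du z).

Let Wu : W1p_loc p u Du. Proof. by have [] := usol. Qed.
Let Lu : Linfty_loc u. Proof. by have [] := usol. Qed.

Let mDu : measurable_fun setT Du.
Proof. by have [_ Dup _] := Wu; apply: measurable_fun_rVP => i; have [] := Dup i. Qed.

Let q0 : 0 < q - 1.
Proof. by rewrite subr_gt0 (le_lt_trans _ pq)// lerBrDr. Qed.

Let mgu : measurable_fun setT (fun x => `|u x| `^ (q - 1)).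
Proof. by have [mu_ _] := Lu; exact: measurable_norm_powR. Qed.

Lemma bounded_on_cube r' : exists2 M, 0 <= M &
  {ae mu, forall x, cube n r' x -> `|u x| <= M}.
Proof.
have [_ /(_ _ (@compact_cube _ n r'))[M0 uM0]] := Lu.
exists (Num.max M0 0); first by rewrite le_max lexx orbT.
by apply: filterS uM0 => x h Qx; rewrite le_max h.
Qed.

Lemma weak_solution_test :
  mu.-integrable (cube n r) (EFin \o (fun x => flux H p (Du x) (V x))) /\
  \int[mu]_(x in cube n r) flux H p (Du x) (V x) =
  \int[mu]_(x in cube n r) (`|u x| `^ (q - 1) * u x * (spow s (u x) * z x)).
Proof.
have [f [K [G [C1f fK f0 iG lim]]]] := test_approximation p2 s1 Wu Lu C1z z0.
have [M M0 uM] := bounded_on_cube r.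
have B0 : 0 <= finsler_bound H by exact: finsler_bound_ge0.
have C0 : 0 <= finsler_bound H `^ (p - 1) * finsler_bound H by rewrite mulr_ge0 ?powR_ge0.
have [iflux l1] := gradient_term_limit p2 Wu C1z C1f f0 iG lim
  (fun W mW => @measurable_flux _ _ H p normH C2H _ _ mDu mW) (@continuous_flux _ _ H p) (flux0 H p) C0 (flux_le p2 normH C2H).
have gM : {ae mu, forall x, cube n r x -> `| `|u x| `^ (q - 1) * u x| <= M `^ (q - 1) * M}.
  apply: filterS uM => x uMx Qx.
  rewrite normrM ger0_norm ?powR_ge0// ler_pM ?powR_ge0// ?uMx//.
  by rewrite ge0_ler_powR ?nnegrE ?uMx// ltW.
have mg : measurable_fun setT (fun x => `|u x| `^ (q - 1) * u x).
  by apply: measurable_funM => //; have [] := Lu.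
have [iz l2] := zero_order_term_limit Wu C1z C1f fK f0 lim mg gM (fun t => cvg_id) erefl
  (fun t => id).
have E k : \int[mu]_x flux H p (Du x) (grad (f k) x) =
    \int[mu]_x (`|u x| `^ (q - 1) * u x * f k x).
  by have [_ _ /(_ _ (C1f k))] := usol; exact.
split=> //; move: l1; rewrite (eq_cvg \oo _ E) => l1.
exact: (cvg_unique (@Rhausdorff R) l1 l2).
Qed.

Lemma stable_test : stable H p q u Du ->
  [/\ mu.-integrable (cube n r) (EFin \o (fun x => stab_grad H p (Du x) (V x))),
      mu.-integrable (cube n r) (EFin \o (fun x => stab_hess H p (Du x) (V x))) &
  \int[mu]_(x in cube n r) (q * `|u x| `^ (q - 1) * (spow s (u x) * z x) ^+ 2) <=
  \int[mu]_(x in cube n r) stab_grad H p (Du x) (V x) +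
  \int[mu]_(x in cube n r) stab_hess H p (Du x) (V x)].
Proof.
move=> stabu.
have [f [K [G [C1f fK f0 iG lim]]]] := test_approximation p2 s1 Wu Lu C1z z0.
have [M M0 uM] := bounded_on_cube r.
have B0 : 0 <= finsler_bound H by exact: finsler_bound_ge0.
have D0 : 0 <= (p - 1) * finsler_bound H `^ (p - 2) * finsler_bound H ^+ 2.
  by rewrite !mulr_ge0 ?powR_ge0// subr_ge0 (le_trans _ p2)// ler1n.
have [ig lg] := gradient_term_limit p2 Wu C1z C1f f0 iG lim
  (fun W mW => @measurable_stab_grad _ _ H p normH C2H _ _ mDu mW) (@continuous_stab_grad _ _ H p) (stab_grad0 H p)
  D0 (stab_grad_le p2 normH C2H).
have [C C0 hC] := stab_hess_le p2 normH C2H.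
have E0 : 0 <= C * finsler_bound H `^ (p - 2) by rewrite mulr_ge0 ?powR_ge0.
have [ih lh] := gradient_term_limit p2 Wu C1z C1f f0 iG lim
  (fun W mW => @measurable_stab_hess _ _ H p normH C2H _ _ mDu mW) (@continuous_stab_hess _ _ H p) (stab_hess0 H p)
  E0 (fun xi v => (hC xi v).2).
have q_ge0 : 0 <= q by rewrite (le_trans _ (ltW (lt_trans q0 _)))// ltrBlDr ltrDl.
have gM : {ae mu, forall x, cube n r x -> `|q * `|u x| `^ (q - 1)| <= q * M `^ (q - 1)}.
  apply: filterS uM => x uMx Qx.
  rewrite normrM (ger0_norm q_ge0) (ger0_norm (powR_ge0 _ _)) ler_wpM2l//.
  by rewrite ge0_ler_powR ?nnegrE ?uMx// ltW.
have mg : measurable_fun setT (fun x => q * `|u x| `^ (q - 1)) by exact: measurable_funM.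
have csq : continuous (fun t : R => t ^+ 2) by exact: exprn_continuous.
have [|iz lz] := zero_order_term_limit (L := K ^+ 2) Wu C1z C1f fK f0 lim mg gM csq (expr0n _ 2).
  by move=> t tK; rewrite normrX ler_pXn2r ?nnegrE// (le_trans _ tK).
split=> //; rewrite -subr_ge0.
(* The three limits combine into that of the stability form along the admissible functions f k,
   which is nonnegative for each k. *)
have l := cvgB (cvgD lg lh) lz; 
have {}l := l eventually_filter eventually_filter.
rewrite -(cvg_lim (@Rhausdorff R) l); apply: limr_ge; first by apply/cvg_ex; eexists; exact: l.
by apply: nearW => k; exact: stabu (C1f k).
Qed.

End test_identities.

(** * Energy estimates *)

Section pointwise_estimates.
Context (R : realType) (n : nat) (H : 'rV[R]_n -> R) (p g : R).
Hypotheses (p2 : 2 <= p) (g1 : 1 < g).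
Hypotheses (normH : is_norm H) (C2H : C2_on [set x | x != 0] H).
Context (xi w : 'rV[R]_n) (u z t E : R).
Hypotheses (z0 : 0 <= z) (t0 : 0 <= t) (wz : `|w| <= z * t).
Hypotheses (E1 : H xi `^ (p - 1) * `|u| `^ g * t <= E)
  (E2 : H xi `^ (p - 2) * `|u| `^ (g + 1) * t ^+ 2 <= E).

Let B := finsler_bound H.
Let B0 : 0 <= B. Proof. exact: finsler_bound_ge0. Qed.
Let a := H xi.
Let b := `|u|.
Let a0 : 0 <= a. Proof. exact: finsler_ge0. Qed.
Let p1 : 0 < p - 1. Proof. by rewrite subr_gt0 (lt_le_trans _ p2)// ltr1n. Qed.
Let p0 : 0 < p. Proof. exact: lt_le_trans p2. Qed.
Let g0 : 0 < g. Proof. exact: lt_trans g1. Qed.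
Let E0 : 0 <= E.
Proof. by rewrite (le_trans _ E1)// !mulr_ge0 ?powR_ge0. Qed.

Let ap : a `^ (p - 1) * a = a `^ p.
Proof. by rewrite mulrC mulr_powRB1. Qed.

Let ap2 : a `^ (p - 2) * a = a `^ (p - 1).
Proof.
rewrite -(mulr_powRB1 a0 p1) mulrC; congr (_ * _ `^ _).
by rewrite -addrA -opprD.
Qed.

Let dB : xi != 0 -> `|dotv (grad H xi) w| <= B * (z * t).
Proof.
move=> x0; rewrite (le_trans (finsler_grad_le normH C2H w x0))//.
by rewrite (le_trans (finsler_le normH w))// ler_wpM2l.
Qed.

(** The second argument of [flux] is the test gradient for the exponent g and the cut-off z^2.
    Euler's identity produces the main term from the part along xi, and the part along w is the
    error controlled by E. At xi = 0 the left-hand side is nonpositive. *)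
Lemma flux_test_ge :
  g * (a `^ p * b `^ (g - 1) * z ^+ 2) - 2 * B * (z ^+ 2 * E) <=
  flux H p xi ((z * z) *: ((g * b `^ (g - 1)) *: xi) + spow g u *: (z *: w + z *: w)).
Proof.
have [xi0|x0] := eqVneq xi 0.
  have aa : a = 0 by rewrite /a xi0 finsler0.
  rewrite /flux -/a aa !powR0 ?gt_eqF// !mul0r mulr0 sub0r oppr_le0.
  by rewrite !mulr_ge0// exprn_ge0.
rewrite /flux dotvDr !dotvZr dotvDr !dotvZr finsler_euler// -/a.
set d := dotv _ w; have dd : `|d| <= B * (z * t) := dB x0.
have -> : a `^ (p - 1) * (z * z * (g * b `^ (g - 1) * a) + spow g u * (z * d + z * d)) =
  g * (a `^ p * b `^ (g - 1) * z ^+ 2) + 2 * z * (a `^ (p - 1) * spow g u * d).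
  by rewrite -ap; ring.
have h : `|a `^ (p - 1) * spow g u * d| <= B * z * E.
  rewrite normrM [`|_ * spow _ _|]normrM norm_spow// (ger0_norm (powR_ge0 _ _)) -/b.
  rewrite (le_trans (ler_wpM2l _ dd)) ?mulr_ge0 ?powR_ge0//.
  rewrite [leLHS](_ : _ = B * z * (a `^ (p - 1) * b `^ g * t)); last by ring.
  by rewrite ler_wpM2l// mulr_ge0.
move: h => /ler_normlP[h _]; rewrite lerD2l.
have := ler_wpM2l (mulr_ge0 (ler0n R 2) z0) h.
rewrite mulrN (_ : 2 * z * (B * z * E) = 2 * B * (z ^+ 2 * E)); last by ring.
by rewrite lerNl.
Qed.

(** With this exponent the square of [spow al u] has degree g + 1, so both tests produce the same
    densities |u|^(q + g) and H(Du)^p |u|^(g - 1). *)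
Let al := (g + 1) / 2.
Let al1 : 1 < al. Proof. by rewrite ltr_pdivlMr// mul1r ltrD2r. Qed.
Let al0 : 0 < al. Proof. exact: lt_trans al1. Qed.

Let b_sq : (b `^ (al - 1)) ^+ 2 = b `^ (g - 1).
Proof.
rewrite -powR_mulrn ?powR_ge0// -powRrM; congr (_ `^ _).
by rewrite /al; field.
Qed.

Let spow_sq : (spow al u) ^+ 2 = b `^ (g + 1).
Proof.
by rewrite spow_sqr//; congr (_ `^ _); rewrite /al; field.
Qed.

Let b_spow : b `^ (al - 1) * `|spow al u| = b `^ g.
Proof.
have al2 : al - 1 + al = g by rewrite /al; field.
by rewrite norm_spow// -powRD al2// gt_eqF.
Qed.

Let V := z *: ((al * b `^ (al - 1)) *: xi) + spow al u *: w.

(** The part of V along xi lies in the kernel of the Hessian on both sides, so the second-order term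
    sees only w and is entirely an error. In the squared first-order term the part along xi gives
    the coefficient (p - 1) al^2; the cross term and the square of the part along w are errors. *)
Lemma stab_test_le (C : R) : 0 <= C ->
  (forall v, `|stab_hess H p xi v| <= C * (a `^ (p - 2) * `|v| ^+ 2)) ->
  stab_grad H p xi V + stab_hess H p xi V <=
  (p - 1) * al ^+ 2 * (a `^ p * b `^ (g - 1) * z ^+ 2) +
  ((p - 1) * (2 * al * B + B ^+ 2) + C) * (z ^+ 2 * E).
Proof.
move=> C0 hC.
have p10 := ltW p1; have al00 := ltW al0.
have A0 : 0 <= (p - 1) * (2 * al * B + B ^+ 2).
  exact: (mulr_ge0 p10 (addr_ge0 (mulr_ge0 (mulr_ge0 (ler0n R 2) al00) B0) (exprn_ge0 2 B0))).
have [xi0|x0] := eqVneq xi 0.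
  rewrite /stab_grad /stab_hess xi0 eqxx addr0 addr_ge0//; last first.
    by rewrite mulr_ge0 ?addr_ge0// mulr_ge0// exprn_ge0.
  exact: (mulr_ge0 (mulr_ge0 p10 (exprn_ge0 2 al00))
    (mulr_ge0 (mulr_ge0 (powR_ge0 _ _) (powR_ge0 _ _)) (exprn_ge0 2 z0))).
have hV : stab_hess H p xi V = spow al u ^+ 2 * stab_hess H p xi w.
  rewrite /stab_hess (negbTE x0) /V !(hess_formDl, hess_formDr, hess_formZl, hess_formZr).
  by rewrite !(hess_form_radial_l, hess_form_radial_r)//; ring.
have hh : stab_hess H p xi V <= C * (z ^+ 2 * E).
  rewrite hV spow_sq (le_trans (ler_wpM2l (powR_ge0 _ _) (le_trans (ler_norm _) (hC w))))//.
  rewrite [leLHS]mulrCA ler_wpM2l//.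
  have w2 : `|w| ^+ 2 <= (z * t) ^+ 2 by rewrite ler_pXn2r ?nnegrE ?mulr_ge0.
  rewrite mulrCA (le_trans (ler_wpM2l (powR_ge0 _ _) (ler_wpM2l (powR_ge0 _ _) w2)))//.
  rewrite [leLHS](_ : _ = z ^+ 2 * (a `^ (p - 2) * b `^ (g + 1) * t ^+ 2)); last by ring.
  by rewrite ler_wpM2l// exprn_ge0.
have gV : stab_grad H p xi V <= (p - 1) * al ^+ 2 * (a `^ p * b `^ (g - 1) * z ^+ 2) +
    (p - 1) * (2 * al * B + B ^+ 2) * (z ^+ 2 * E).
  rewrite /stab_grad (negbTE x0) /V dotvDr !dotvZr finsler_euler// -/a.
  set d := dotv _ w; have dd : `|d| <= B * (z * t) := dB x0.
  have -> : (p - 1) * a `^ (p - 2) * (z * (al * b `^ (al - 1) * a) + spow al u * d) ^+ 2 =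
    (p - 1) * al ^+ 2 * (a `^ p * b `^ (g - 1) * z ^+ 2) +
    (p - 1) * (2 * al * (z * (a `^ (p - 1) * (b `^ (al - 1) * spow al u) * d)) +
               a `^ (p - 2) * b `^ (g + 1) * d ^+ 2).
    by rewrite -ap -ap2 -b_sq -spow_sq; ring.
  rewrite lerD2l -[leRHS]mulrA ler_wpM2l// [leRHS]mulrDl lerD//.
    rewrite -[leRHS]mulrA ler_wpM2l//; first by rewrite mulr_ge0.
    rewrite [leRHS](_ : _ = z * (B * z * E)); last by ring.
    rewrite ler_wpM2l// (le_trans (ler_norm _))//.
    rewrite normrM [`|_ `^ _ * _|]normrM [`|_ * spow _ _|]normrM !(ger0_norm (powR_ge0 _ _)) b_spow.
    rewrite (le_trans (ler_wpM2l _ dd)) ?mulr_ge0 ?powR_ge0//.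
    rewrite [leLHS](_ : _ = B * z * (a `^ (p - 1) * b `^ g * t)); last by ring.
    by rewrite ler_wpM2l// mulr_ge0.
  have d2 : d ^+ 2 <= (B * (z * t)) ^+ 2.
    by rewrite -real_normK ?num_real// ler_pXn2r ?nnegrE ?mulr_ge0.
  rewrite (le_trans (ler_wpM2l _ d2)) ?mulr_ge0 ?powR_ge0//.
  rewrite [leLHS](_ : _ = B ^+ 2 * z ^+ 2 * (a `^ (p - 2) * b `^ (g + 1) * t ^+ 2)); last by ring.
  by rewrite [leRHS]mulrA ler_wpM2l// mulr_ge0 ?exprn_ge0.
by rewrite (le_trans (lerD gV hh))// -addrA -mulrDl.
Qed.

End pointwise_estimates.

Section energy_estimates.
Context (R : realType) (n : nat) (H : 'rV[R]_n -> R) (p q g : R).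
Context (u : 'rV[R]_n -> R) (Du : 'rV[R]_n -> 'rV[R]_n).
Local Notation mu := (lebesgue_rV R n).
Hypotheses (p2 : 2 <= p) (pq : p - 1 < q) (g1 : 1 < g).
Hypotheses (normH : is_norm H) (C2H : C2_on [set x | x != 0] H).
Hypotheses (usol : weak_solution H p q u Du) (ustab : stable H p q u Du).
Context (z : 'rV[R]_n -> R) (d eps C W r : R).
Hypotheses (C1z : C1_on setT z) (z_ge0 : forall x, 0 <= z x)
  (z0 : forall x, ~ cube n d x -> z x = 0 /\ grad z x = 0)
  (zW : forall x, exists2 t, 0 <= t &
    `|grad z x| <= z x * t /\ z x ^+ 2 * t `^ r <= W).
Hypotheses (C0 : 0 <= C) (young : forall a b t, 0 <= a -> 0 <= b -> 0 <= t ->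
    let E := eps * (a `^ p * b `^ (g - 1) + b `^ (q + g)) + C * t `^ r in
    a `^ (p - 1) * b `^ g * t <= E /\ a `^ (p - 2) * b `^ (g + 1) * t ^+ 2 <= E).

Let mQ := measurable_cube n d.
Let B := finsler_bound H.

Definition reaction_density x : R := `|u x| `^ (q + g) * z x ^+ 2.
Definition diffusion_density x : R :=
  H (Du x) `^ p * `|u x| `^ (g - 1) * z x ^+ 2.

Let q1 : 0 < q - 1.
Proof. by rewrite subr_gt0 (le_lt_trans _ pq)// lerBrDr. Qed.
Let p0 : 0 < p. Proof. exact: lt_le_trans p2. Qed.
Let g0 : 0 < g. Proof. exact: lt_trans g1. Qed.
Let q0 : 0 < q. Proof. by rewrite (lt_trans _ (_ : 1 < q))// -subr_gt0. Qed.

Lemma reaction_density_ge0 x : 0 <= reaction_density x.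
Proof. by rewrite mulr_ge0 ?powR_ge0// exprn_ge0. Qed.

Lemma diffusion_density_ge0 x : 0 <= diffusion_density x.
Proof. by rewrite mulr_ge0 ?exprn_ge0// mulr_ge0 ?powR_ge0. Qed.

Let mu_ : measurable_fun setT u. Proof. by have [_ Lu _] := usol; have [] := Lu. Qed.
Let mDu : measurable_fun setT Du.
Proof.
by have [[_ Dup _] _ _] := usol; apply: measurable_fun_rVP => i; have [] := Dup i.
Qed.
Let mz2 : measurable_fun setT (fun x => z x ^+ 2).
Proof. exact: measurable_funX (continuous_measurable_rV (C1_continuous C1z)). Qed.

Lemma integrable_reaction_density :
  mu.-integrable (cube n d) (EFin \o reaction_density).
Proof.
have [M M0 uM] := bounded_on_cube usol d; have [K K0 zK] := C1_bounded d C1z.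
apply: (@ae_bounded_integrable _ _ _ _ (M `^ (q + g) * K ^+ 2)).
  by apply: measurable_funM => //; exact: measurable_norm_powR.
apply: filterS uM => x uMx Qx; rewrite ger0_norm ?reaction_density_ge0//.
have qg0 : 0 <= q + g by rewrite addr_ge0// ltW.
have zKx : z x ^+ 2 <= K ^+ 2.
  rewrite ler_pXn2r ?nnegrE// (le_trans (ler_norm _))//.
  by have [] := zK x Qx.
by rewrite ler_pM ?powR_ge0 ?exprn_ge0// ge0_ler_powR ?nnegrE// uMx.
Qed.

Lemma integrable_diffusion_density :
  mu.-integrable (cube n d) (EFin \o diffusion_density).
Proof.
have [M M0 uM] := bounded_on_cube usol d; have [K K0 zK] := C1_bounded d C1z.
have [[_ Dup _] _ _] := usol.
have B0 : 0 <= B by exact: finsler_bound_ge0.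
apply: (@ae_le_integrable _ _ _ _ (fun x => (B `^ p * M `^ (g - 1) * K ^+ 2) * `|Du x| `^ p)) => //.
- apply: measurable_funM => //; apply: measurable_funM; last exact: measurable_norm_powR.
  apply: (measurableT_comp (measurable_powR p)); apply: measurableT_comp mDu.
  exact: continuous_measurable_rV (continuous_finsler normH).
- by apply: integrable_EFinZ => //; have [_] := norm_powR_integrable p0 Dup; exact.
apply: filterS uM => x uMx Qx; rewrite ger0_norm ?diffusion_density_ge0//.
have g10 : 0 <= g - 1 by rewrite subr_ge0 ltW.
have zKx : z x ^+ 2 <= K ^+ 2.
  rewrite ler_pXn2r ?nnegrE// (le_trans (ler_norm _))//.
  by have [] := zK x Qx.
rewrite (_ : _ * _ `^ p = (B * `|Du x|) `^ p * M `^ (g - 1) * K ^+ 2); last first.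
  by rewrite powRM//; ring.
rewrite ler_pM ?exprn_ge0 ?mulr_ge0 ?powR_ge0// ler_pM ?powR_ge0//.
  by rewrite ge0_ler_powR ?nnegrE ?mulr_ge0 ?(finsler_ge0 normH) ?finsler_le// ltW.
by rewrite ge0_ler_powR ?nnegrE// uMx.
Qed.

Let X := \int[mu]_(x in cube n d) reaction_density x.
Let Y := \int[mu]_(x in cube n d) diffusion_density x.
Let vol := fine (mu (cube n d)).

Let pw x := eps * (reaction_density x + diffusion_density x) + C * W.

Let ipw : mu.-integrable (cube n d) (EFin \o pw).
Proof.
apply: integrable_EFinD => //; last first.
  by apply: integrable_cst_lty => //; exact: lebesgue_rV_cube_fin.
apply: integrable_EFinZ => //; apply: integrable_EFinD => //.
- exact: integrable_reaction_density.
- exact: integrable_diffusion_density.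
Qed.

Let int_pw : \int[mu]_(x in cube n d) pw x = eps * (X + Y) + C * (W * vol).
Proof.
have iX := integrable_reaction_density; have iY := integrable_diffusion_density.
rewrite /pw RintegralD//; last 2 first.
- by apply: integrable_EFinZ => //; exact: integrable_EFinD.
- by apply: integrable_cst_lty => //; exact: lebesgue_rV_cube_fin.
rewrite Rintegral_cst// mulrA; congr (_ + _).
by rewrite RintegralZl//; [rewrite RintegralD|exact: integrable_EFinD].
Qed.

(** Young's inequality is applied at each point with its own t from the cut-off; multiplying E by
    z^2 turns the t^r term into the constant C W. *)
Let young_at x : exists t E,
  [/\ 0 <= t, `|grad z x| <= z x * t,
      H (Du x) `^ (p - 1) * `|u x| `^ g * t <= E,
      H (Du x) `^ (p - 2) * `|u x| `^ (g + 1) * t ^+ 2 <= E &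
      z x ^+ 2 * E <= pw x].
Proof.
have [t t0 [zt ztW]] := zW x.
have [] := young (finsler_ge0 normH (Du x)) (normr_ge0 (u x)) t0.
set E := eps * _ + _ => E1 E2; exists t, E; split=> //.
rewrite /E mulrDr lerD//.
  by rewrite le_eqVlt; apply/orP; left; apply/eqP;
    rewrite /reaction_density /diffusion_density; ring.
by rewrite mulrCA ler_wpM2l.
Qed.

(** The equation is tested with the cut-off z^2, stability with z, so that both carry the weight
    z^2. The constant A is left free above a bound so that the two estimates can share it. *)
Lemma diffusion_estimate A : 2 * B <= A ->
  g * Y <= X + A * (eps * (X + Y) + C * (W * vol)).
Proof.
move=> BA; have B0 : 0 <= B by exact: finsler_bound_ge0.
have C1zz := @C1M _ _ _ _ C1z C1z.
have z20 x : ~ cube n d x -> z x * z x = 0 /\ grad (fun x => z x * z x) x = 0.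
  move=> /z0[zx gzx]; have [dz _] := C1z I (x := x).
  by have [_ ->] := gradM dz dz; rewrite gzx zx mul0r scaler0 addr0.
have [ifl Efl] := weak_solution_test p2 pq g1 normH C2H usol C1zz z20.
have EX : \int[mu]_(x in cube n d)
    (`|u x| `^ (q - 1) * u x * (spow g (u x) * (z x * z x))) = X.
  apply: eq_Rintegral => x _; rewrite /reaction_density /spow.
  rewrite (_ : _ * _ = (`|u x| `^ (q - 1) * `|u x| `^ (g - 1) * u x ^+ 2) * z x ^+ 2); last by ring.
  congr (_ * _); rewrite -(real_normK (num_real (u x))).
  have c0 : 0 < q - 1 + (g - 1) by rewrite addr_gt0// subr_gt0.
  have cE : q - 1 + (g - 1) = q + g - 2 by ring.
  have -> : `|u x| `^ (q - 1) * `|u x| `^ (g - 1) = `|u x| `^ (q + g - 2).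
    by rewrite -cE [RHS]powRD ?(gt_eqF c0).
  by rewrite powR_mul2// -subr_ge0 -cE ltW.
rewrite -int_pw -EX -Efl -(RintegralZl _ mQ integrable_diffusion_density).
rewrite -(RintegralZl _ mQ ipw) -RintegralD//; last exact: integrable_EFinZ.
apply: le_Rintegral => //.
- by apply: integrable_EFinZ => //; exact: integrable_diffusion_density.
- by apply: integrable_EFinD => //; exact: integrable_EFinZ.
move=> x _; have [t [E [t0 zt E1 E2 zE]]] := young_at x.
have := flux_test_ge p2 g1 normH C2H (z_ge0 x) t0 zt E1.
have [dz _] := C1z I (x := x); have [_ gz2] := gradM dz dz.
rewrite -gz2 -/(test_grad g u Du (fun x => z x * z x) x) -/(diffusion_density x) -/B.
rewrite lerBlDr => h; rewrite (le_trans h)// lerD2l.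
have zE0 : 0 <= z x ^+ 2 * E.
  rewrite mulr_ge0 ?exprn_ge0//.
  by rewrite (le_trans _ E1)// mulr_ge0// mulr_ge0 ?powR_ge0.
exact: (ler_pM (mulr_ge0 (ler0n R 2) B0) zE0 BA zE).
Qed.

Lemma reaction_estimate Ch A : 0 <= Ch ->
  (forall xi v, `|stab_hess H p xi v| <= Ch * (H xi `^ (p - 2) * `|v| ^+ 2)) ->
  (p - 1) * (2 * ((g + 1) / 2) * B + B ^+ 2) + Ch <= A ->
  q * X <= (p - 1) * ((g + 1) / 2) ^+ 2 * Y + A * (eps * (X + Y) + C * (W * vol)).
Proof.
move=> Ch0 hCh BA; have B0 : 0 <= B by exact: finsler_bound_ge0.
have s1 : 1 < (g + 1) / 2 by rewrite ltr_pdivlMr// mul1r ltrD2r.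
have [ig ih] := stable_test p2 pq s1 normH C2H usol C1z z0 ustab.
have EX : \int[mu]_(x in cube n d)
    (q * `|u x| `^ (q - 1) * (spow ((g + 1) / 2) (u x) * z x) ^+ 2) = q * X.
  rewrite -RintegralZl//; last exact: integrable_reaction_density.
  apply: eq_Rintegral => x _; rewrite /reaction_density exprMn -mulrA; congr (_ * _); rewrite mulrA; congr (_ * _).
  rewrite spow_sqr ?(lt_trans _ s1)//.
  have cE : q - 1 + 2 * ((g + 1) / 2) = q + g by field.
  have c0 : 0 < q - 1 + 2 * ((g + 1) / 2) by rewrite cE addr_gt0.
  by rewrite -cE [RHS]powRD ?(gt_eqF c0).
rewrite EX => h; apply: (le_trans h).
rewrite -int_pw -(RintegralZl _ mQ integrable_diffusion_density) -(RintegralZl _ mQ ipw).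
rewrite -!RintegralD//; last 2 first.
- by apply: integrable_EFinZ => //; exact: integrable_diffusion_density.
- exact: integrable_EFinZ.
apply: le_Rintegral => //.
- exact: integrable_EFinD.
- apply: integrable_EFinD => //; apply: integrable_EFinZ => //.
  exact: integrable_diffusion_density.
move=> x _; have [t [E [t0 zt E1 E2 zE]]] := young_at x.
have := stab_test_le p2 g1 normH C2H (z_ge0 x) t0 zt E1 E2 Ch0 (hCh (Du x)).
rewrite -/(test_grad ((g + 1) / 2) u Du z x) -/(diffusion_density x) -/B => hh.
have zE0 : 0 <= z x ^+ 2 * E.
  rewrite mulr_ge0 ?exprn_ge0//.
  by rewrite (le_trans _ E1)// mulr_ge0// mulr_ge0 ?powR_ge0.
have A0 : 0 <= (p - 1) * (2 * ((g + 1) / 2) * B + B ^+ 2) + Ch.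
  rewrite addr_ge0// mulr_ge0//; first by rewrite subr_ge0 (le_trans _ p2)// ler1n.
  by rewrite addr_ge0 ?exprn_ge0// mulr_ge0// mulr_ge0// (le_trans _ (ltW s1)).
by rewrite (le_trans hh)// lerD2l; exact: (ler_pM A0 zE0 BA zE).
Qed.

End energy_estimates.

(** * Decay of the energy on large cubes and conclusion *)

Section decay.
Context (R : realType) (n : nat) (H : 'rV[R]_n -> R) (p q g : R).
Context (u : 'rV[R]_n -> R) (Du : 'rV[R]_n -> 'rV[R]_n).
Local Notation mu := (lebesgue_rV R n).
Hypotheses (p2 : 2 <= p) (pq : p - 1 < q) (g1 : 1 < g)
  (kg : (p - 1) * ((g + 1) / 2) ^+ 2 < g * q).
Hypotheses (normH : is_norm H) (C2H : C2_on [set x | x != 0] H).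
Hypotheses (usol : weak_solution H p q u Du) (ustab : stable H p q u Du).

Let p1 : 1 < p. Proof. by rewrite (lt_le_trans _ p2)// ltr1n. Qed.
Let g0 : 0 < g. Proof. exact: lt_trans g1. Qed.
Let q1 : 1 < q. Proof. by rewrite (le_lt_trans _ pq)// lerBrDr. Qed.
Let q0 : 0 < q. Proof. exact: lt_trans q1. Qed.
Let s0 : 0 < q - p + 1. Proof. by have -> : q - p + 1 = q - (p - 1) by [ring]; rewrite subr_gt0. Qed.

Lemma integrable_powR_cube r c : 0 <= c ->
  mu.-integrable (cube n r) (EFin \o (fun x => `|u x| `^ c)).
Proof.
move=> c0; have [M M0 uM] := bounded_on_cube usol r.
apply: (@ae_bounded_integrable _ _ _ _ (M `^ c)).
  by apply: measurable_norm_powR; have [_ Lu _] := usol; have [] := Lu.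
apply: filterS uM => x uMx Qx; rewrite ger0_norm ?powR_ge0//.
by rewrite ge0_ler_powR ?nnegrE// uMx.
Qed.

Lemma ge0_subset_Rintegral (D E : set 'rV[R]_n) (f : 'rV[R]_n -> R) :
  measurable D -> measurable E -> D `<=` E -> (forall x, 0 <= f x) ->
  mu.-integrable E (EFin \o f) ->
  \int[mu]_(x in D) f x <= \int[mu]_(x in E) f x.
Proof.
move=> mD mE DE f0 fi; apply: fine_le.
- by apply: integrable_fin_num => //; exact: integrableS fi.
- exact: integrable_fin_num.
- apply: ge0_subset_integral => //; first exact: measurable_int fi.
  by move=> x _; rewrite lee_fin.
Qed.

Lemma energy_decay (r := p * (q + g) / (q - p + 1)) : exists2 c, 0 <= c &
  forall r0 rho, 0 < rho -> 0 <= r0 -> n.+1%:R * r0 <= rho ->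
  \int[mu]_(x in cube n r0) (`|u x| `^ (q + g)) <= c * rho `^ (n%:R - r).
Proof.
have p0 : 0 < p by exact: lt_trans p1.
have qg0 : 0 < q + g by exact: addr_gt0.
have B0 : 0 <= finsler_bound H by exact: finsler_bound_ge0.
have [Ch Ch0 hCh] := stab_hess_le p2 normH C2H.
pose A1 := (p - 1) * (2 * ((g + 1) / 2) * finsler_bound H + finsler_bound H ^+ 2) + Ch.
have A10 : 0 <= A1.
  rewrite addr_ge0// mulr_ge0 ?subr_ge0 ?(ltW p1)// addr_ge0 ?exprn_ge0// mulr_ge0//.
  by rewrite mulr_ge0// divr_ge0// addr_ge0// ltW.
pose A := 2 * finsler_bound H + A1.
have A0 : 0 <= A by rewrite addr_ge0// mulr_ge0.
have k0 : 0 <= (p - 1) * ((g + 1) / 2) ^+ 2.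
  by rewrite mulr_ge0 ?subr_ge0 ?(ltW p1)// exprn_ge0// divr_ge0// addr_ge0// ltW.
(* The constants are fixed in the order A, eps, C, C', K, all before rho enters, so the final
   constant is uniform in the scale. *)
have [eps eps0 habs] := absorption A0 k0 g0 q0 kg.
have [C C0 young] := young_scaling p2 pq g1 eps0.
have [C' C'0 hX] := habs C C0.
have r_gt0 : 0 < r by exact: (divr_gt0 (mulr_gt0 p0 qg0) s0).
have [K K0 cut] := cutoff_exists n r_gt0.
exists (C' * (K * 4 ^+ n)); first by rewrite !mulr_ge0// exprn_ge0.
move=> r0 rho rho0 r00 r0rho.
have [z [C1z zK z1 zout zt]] := cut rho rho0.
have z_ge0 x : 0 <= z x by have /andP[] := zK x.
pose W := K * rho `^ (- r).
have W0 : 0 <= W by rewrite mulr_ge0 ?powR_ge0.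
have rho20 : 0 <= 2 * rho by rewrite mulr_ge0// ltW.
have mrho := measurable_cube n (2 * rho); have mr0 := measurable_cube n r0.
have vE : fine (mu (cube n (2 * rho))) = (2 * (2 * rho)) ^+ n.
  by rewrite lebesgue_rV_cube.
have ub : 2 * finsler_bound H <= A by rewrite lerDl.
have e1 := diffusion_estimate p2 pq g1 normH C2H usol C1z z_ge0 zout zt C0 young ub.
have ua : A1 <= A by rewrite lerDr mulr_ge0.
have e2 := reaction_estimate p2 pq g1 normH C2H usol ustab C1z z_ge0 zout zt C0 young
  Ch0 (fun xi v => (hCh xi v).1) ua.
have iX := integrable_reaction_density p2 pq g1 usol (2 * rho) C1z z_ge0.
have vol0 : 0 <= fine (mu (cube n (2 * rho))) by exact: fine_ge0.
have X0 : 0 <= \int[mu]_(x in cube n (2 * rho)) reaction_density q g u z x.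
  by apply: Rintegral_ge0 => x _; exact: reaction_density_ge0.
have Y0 : 0 <= \int[mu]_(x in cube n (2 * rho)) diffusion_density H p g u Du z x.
  by apply: Rintegral_ge0 => x _; exact: diffusion_density_ge0.
have XW := hX _ _ _ X0 Y0 (mulr_ge0 W0 vol0) e1 e2.
have r0n : r0 <= n.+1%:R * r0 by rewrite ler_peMl// ler1n.
have r0rho2 : r0 <= 2 * rho.
  by rewrite (le_trans r0n)// (le_trans r0rho)// ler_peMl ?(ltW rho0)// ler1n.
apply: (@le_trans _ _ (\int[mu]_(x in cube n r0) reaction_density q g u z x)).
  apply: le_Rintegral => //.
  - by apply: integrable_powR_cube; exact: ltW.
  - by have := integrable_reaction_density p2 pq g1 usol r0 C1z z_ge0.
  move=> x xr0; rewrite /reaction_density ler_peMr ?powR_ge0//.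
  (* On the small cube n |x|^2 <= ((n + 1) r0)^2 <= rho^2, which is where the cut-off is at least
     1. *)
  rewrite exprn_ege1// z1// (le_trans _ (_ : (n.+1%:R * r0) ^+ 2 <= _))//; last first.
    by rewrite ler_pXn2r ?nnegrE ?mulr_ge0// ltW.
  rewrite exprMn ler_pM ?exprn_ge0//; last by rewrite ler_pXn2r ?nnegrE.
  by rewrite -natrX ler_nat expnS expn1 (leq_trans (leqnSn n))// leq_pmulr.
apply: le_trans (le_trans XW _).
  by apply: ge0_subset_Rintegral => //; [exact: cubeS|exact: reaction_density_ge0].
(* The cut-off contributes rho^(- r) and the cube of radius 2 rho has volume (4 rho)^n, whence the
   exponent n - r. *)
rewrite vE /W -mulrA ler_wpM2l//.
rewrite powRD; last by rewrite (gt_eqF rho0) implybT.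
rewrite powR_mulrn ?(ltW rho0)// !exprMn.
rewrite (_ : 4 = 2 * 2); last by ring.
by rewrite exprMn le_eqVlt; apply/orP; left; apply/eqP; ring.
Qed.

Lemma solution_ae0 : n%:R * (q - p + 1) < p * (q + g) -> {ae mu, forall x, u x = 0}.
Proof.
move=> nr; have [c c0 hc] := energy_decay; move: hc.
set r := _ / _ => hc.
have nr' : 0 < r - n%:R by rewrite subr_gt0 /r ltr_pdivlMr.
have qg0 : 0 < q + g by exact: addr_gt0.
have I0 k : \int[mu]_(x in cube n k.+1%:R) (`|u x| `^ (q + g)) = 0.
  set I := LHS; apply/eqP; rewrite eq_le; apply/andP; split; last first.
    by apply: Rintegral_ge0 => x _; exact: powR_ge0.
  rewrite leNgt; apply/negP => Ipos.
  (* If the integral I were positive, this rho would make c rho^(n - r) smaller than I,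
     contradicting the decay; the first entry of the maximum ensures that the decay estimate
     applies. *)
  pose rho := Num.max (n.+1%:R * k.+1%:R) ((c / I + 1) `^ (r - n%:R)^-1).
  have cI0 : 0 < c / I + 1 by rewrite ltr_wpDl// divr_ge0// ltW.
  have rho0 : 0 < rho by rewrite lt_max powR_gt0 ?orbT.
  have := hc k.+1%:R rho rho0 (ler0n _ _).
  rewrite le_max lexx => /(_ isT); rewrite leNgt => /negP; apply.
  have rp : c / I < rho `^ (r - n%:R).
    rewrite (@lt_le_trans _ _ (c / I + 1)) ?ltrDl//.
    have {1}-> : c / I + 1 = ((c / I + 1) `^ (r - n%:R)^-1) `^ (r - n%:R).
      by rewrite -powRrM mulVf ?(gt_eqF nr')// powRr1// ltW.
    by rewrite ge0_ler_powR ?nnegrE ?powR_ge0 ?(ltW nr') ?(ltW rho0)// le_max lexx orbT.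
  rewrite -opprB powRN -/I ltr_pdivrMr ?powR_gt0// mulrC.
  by rewrite -ltr_pdivrMr.
have ae k : {ae mu, forall x, cube n k.+1%:R x -> u x = 0}.
  have mk := measurable_cube n (k.+1%:R : R).
  have ik := integrable_powR_cube k.+1%:R (ltW qg0).
  have : ae_eq mu (cube n k.+1%:R) (EFin \o (fun x => `|u x| `^ (q + g))) (cst 0%E).
    apply/ae_eq_integral_abs => //; first exact: measurable_int ik.
    rewrite (eq_integral (EFin \o (fun x => `|u x| `^ (q + g)))); last first.
      by move=> x _ /=; rewrite ger0_norm ?powR_ge0.
    by rewrite -[LHS]fineK ?integrable_fin_num// -[fine _]/(Rintegral _ _ _) I0.
  apply: filterS => x h Qx; have := h Qx; move=> /eqP.
  by rewrite /= eqe powR_eq0 normr_eq0 => /andP[/eqP].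
have /ae_foralln := ae; apply: filterS => x h.
pose k := Num.Def.archi_bound `|x|; apply: (h k).
rewrite /cube/= (le_trans (ltW (archi_boundP (normr_ge0 x))))//.
by rewrite ler_nat.
Qed.

End decay.

Theorem corollary1p4 (R : realType) (N : nat) (H : 'rV[R]_N -> R) (p q : R)
    (u : 'rV[R]_N -> R) (Du : 'rV[R]_N -> 'rV[R]_N)
    (N_ge2 : (2 <= N)%N) (H_finsler : finsler_norm H) (p_ge2 : 2 <= p)
    (u_sol : weak_solution H p q u Du) (u_stable : stable H p q u Du)
    (q_range : if N%:R <= p * (p + 3) / (p - 1) then p - 1 < q
               else p - 1 < q < q_c N p) :
  {ae lebesgue_rV R N, forall x, u x = 0}.
Proof.
have [normH C2H _] := H_finsler.
have [pq gap] := exponent_gap N_ge2 p_ge2 q_range.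
have [g [g1 kg ng]] := gamma_exists p_ge2 pq gap.
exact: solution_ae0 p_ge2 pq g1 kg normH C2H u_sol u_stable ng.
Qed.
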